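(* Let $\mu$ be a finite positive Borel measure on $\mathbb{T}$ and let $u$ be an inner function. If the embedding $K_u\hookrightarrow\mathcal{D}(\mu)$ holds, then $\mu(\sigma(u))=0$.
   Context: $\mathbb{D}$ is the open unit disk in $\mathbb{C}$, $\mathbb{T}=\partial\mathbb{D}$, $dA$ is two-dimensional Lebesgue measure, and $H^2(\mathbb{D})$ is the usual Hardy space. An inner function is a bounded analytic function $u$ on $\mathbb{D}$ whose boundary values satisfy $|u|=1$ a.e. on $\mathbb{T}$. The model space is $K_u=H^2(\mathbb{D})\ominus uH^2(\mathbb{D})$, with the $H^2$ norm. The boundary spectrum of $u$ is $\sigma(u)=\{\lambda\in\mathbb{T}:\liminf_{z\to\lambda}|u(z)|<1\}$, where $z$ ranges over $\mathbb{D}$. For inner $u$ this equals $\{\lambda\in\mathbb{T}:\liminf_{z\to\lambda}|u(z)|=0\}$ and is a closed set. The Poisson integral of $\mu$ is $P\mu(z)=\int_{\mathbb{T}}\frac{1-|z|^2}{|\lambda-z|^2}\,d\mu(\lambda)$, $z\in\mathbb{D}$. For $f$ holomorphic on $\mathbb{D}$, the harmonically weighted Dirichlet integral is $D_\mu(f)=\frac1\pi\int_{\mathbb{D}}|f'(z)|^2P\mu(z)\,dA(z)$. The harmonically weighted Dirichlet space is $\mathcal{D}(\mu)=\{f\text{ holomorphic on }\mathbb{D}: D_\mu(f)<\infty\}$, with norm given by $\|f\|_\mu^2=\|f\|_{H^2}^2+D_\mu(f)$. The embedding $K_u\hookrightarrow\mathcal{D}(\mu)$ holds means: $K_u\subseteq\mathcal{D}(\mu)$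 and there is $C>0$ with $\|f\|_{H^2}^2+D_\mu(f)\le C\|f\|_{H^2}^2$ for all $f\in K_u$. *)

(* Defs.v *)
From HB Require Import structures.
From mathcomp Require Import all_boot all_order all_algebra.
From mathcomp Require Import all_classical all_reals all_analysis.
From mathcomp Require Import complex.

Set Implicit Arguments.
Unset Strict Implicit.
Unset Printing Implicit Defensive.

Import Order.TTheory GRing.Theory Num.Theory.
Import numFieldNormedType.Exports.

Local Open Scope classical_set_scope.
Local Open Scope ring_scope.
Local Open Scope complex_scope.

(* MathComp-Analysis gives C^o its norm topology for every numFieldType C;
   the concrete type R[i] does not inherit it by itself. *)
HB.instance Definition _ (R : rcfType) := NormedModule.copy R[i] R[i]^o.

Definition cmod (R : rcfType) (z : R[i]) : R := ComplexField.Normc.normc z.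

Definition unit_disc (R : rcfType) : set R[i] := [set z | cmod z < 1].

Definition unit_circle (R : rcfType) : set R[i] := [set z | cmod z = 1].
Arguments unit_disc {R}.
Arguments unit_circle {R}.

(* The plane carries the product sigma-algebra of R x R, which is the Borel
   sigma-algebra of C under [cplx]. Measures on the circle are measures on the
   plane that vanish off the circle. *)
Notation plane R := (measurableTypeR R * measurableTypeR R)%type.

Definition cplx (R : realType) (p : plane R) : R[i] := p.1 +i* p.2.

Definition carried_by_circle (R : realType) (mu : set (plane R) -> \bar R) :=
  mu (~` (@cplx R @^-1` unit_circle)) = 0%E.

(* Functions on the disc are total functions on R[i]; their values outside the
   disc never matter. [derivable f z 1] is complex differentiability, the
   scalars being R[i] itself. *)
Definition holomorphic (R : realType) (f : R[i] -> R[i]) :=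
  forall z, unit_disc z -> derivable f z 1.

Definition taylor_coef (R : realType) (f : R[i] -> R[i]) (n : nat) : R[i] :=
  derive1n n f 0 / (n`!)%:R.

(* H^2 as the holomorphic functions with square-summable Taylor coefficients,
   with the corresponding l^2 norm and inner product. *)
Definition hardy_norm2 (R : realType) (f : R[i] -> R[i]) : \bar R :=
  (\sum_(0 <= n <oo) ((cmod (taylor_coef f n)) ^+ 2)%:E)%E.

Definition hardy_space (R : realType) : set (R[i] -> R[i]) :=
  [set f | holomorphic f /\ (hardy_norm2 f < +oo)%E].
Arguments hardy_space {R}.

Definition hardy_dot (R : realType) (f g : R[i] -> R[i]) : R[i] :=
  limn (series (fun n => taylor_coef f n * (taylor_coef g n)^*)).

(* Boundary values are radial limits, a.e. with respect to arc length. *)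
Definition inner_function (R : realType) (u : R[i] -> R[i]) :=
  [/\ holomorphic u,
      exists M : R, forall z, unit_disc z -> cmod (u z) <= M
    & {ae @lebesgue_measure R, forall t : R, 0 <= t < 2 * pi ->
        exists2 w : R[i], cmod w = 1
          & u (r%:C * (cos t +i* sin t)) @[r --> (1 : R)^'-] --> w}].

Definition model_space (R : realType) (u : R[i] -> R[i]) :
    set (R[i] -> R[i]) :=
  [set f | hardy_space f /\
     forall g, hardy_space g -> hardy_dot f (fun z => u z * g z) = 0].

Definition boundary_spectrum (R : realType) (u : R[i] -> R[i]) : set R[i] :=
  [set l | unit_circle l /\
     (limf_einf (fun z => (cmod (u z))%:E) (within unit_disc (nbhs l)) < 1)%E].

Definition poisson (R : realType) (mu : set (plane R) -> \bar R) (z : R[i]) :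
    \bar R :=
  (\int[mu]_(p in @cplx R @^-1` unit_circle)
     ((1 - cmod z ^+ 2) / cmod (cplx p - z) ^+ 2)%:E)%E.

Definition dirichlet_integral (R : realType) (mu : set (plane R) -> \bar R)
    (f : R[i] -> R[i]) : \bar R :=
  ((pi^-1)%:E * \int[@lebesgue_measure R \x @lebesgue_measure R]_(p in
       @cplx R @^-1` unit_disc)
     ((cmod (derive1 f (cplx p)) ^+ 2)%:E * poisson mu (cplx p)))%E.

Definition dirichlet_space (R : realType) (mu : set (plane R) -> \bar R) :
    set (R[i] -> R[i]) :=
  [set f | holomorphic f /\ (dirichlet_integral mu f < +oo)%E].

Definition model_space_embeds (R : realType) (u : R[i] -> R[i])
    (mu : set (plane R) -> \bar R) :=
  model_space u `<=` dirichlet_space mu /\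
  exists2 C : R, 0 < C & forall f, model_space u f ->
    (hardy_norm2 f + dirichlet_integral mu f <= C%:E * hardy_norm2 f)%E.

(* Main.v *)
Require Import Defs.
From mathcomp Require Import all_boot all_order all_algebra.
From mathcomp Require Import all_classical all_reals all_analysis.
From mathcomp Require Import measurable_realfun complex ring lra.

(** Let [w] be a point of the disc at which [|u w| <= 1 - t], and consider the
    reproducing kernel of the model space,
    [k z = (1 - conj (u w) * u z) / (1 - conj w * z)]. Its squared norm is at most
    of order [1/d], where [d = 1 - |w|]. The Schwarz-Pick inequality shows that
    when [w] is close to the circle, its derivative is at least of order [1/d^2]
    on a square around [w] whose side is comparable with [d]
    ([model_kernel_deriv_lower]). If [l] is a point of the circle at distance
    less than [r] from [w], the Poisson integral of [mu] is on this square at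
    least of order [d / r^2] times the mass of the disc of center [l] and radius
    [r]. Inserting [k] in the inequality given by the embedding therefore bounds
    this mass by a multiple of [r^2], with a constant depending on [t] but not on
    [r] ([disc_measure_le]).

    The points of the boundary spectrum are those which, for some [t > 0], are
    limits of points [w] of the previous kind; for a given [t], the estimate
    holds around each of them and for all [r]. As the circle is covered by [N]
    discs of radius [O(1/N)], the total mass of these points is [O(1/N)]
    ([spectral_set_null]), and countably many values of [t] suffice. Measurability
    comes from the continuity of [u], which allows [w] to have rational
    coordinates ([spectrum_bigcup]).

    That [k] belongs to the model space, with the bound on its norm, is a matter
    of taking limits of means over circles of radius [r < 1]. On such a circle
    Parseval's identity holds and the inner product of a function [q] with the
    Szego kernel at [w] is exactly [q (r^2 * w)] ([ip_szego]); multiplication by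
    an inner function preserves the inner products in the limit [r = 1], by
    dominated convergence ([ip_isometry]). This also gives [|u| <= 1] on the disc
    ([inner_le1]).

    All this is based on Cauchy's formula for functions which are differentiable
    in the complex sense at each point of the disc ([cauchy_formula]). It is
    obtained from Goursat's theorem on rectangles ([goursat]), transported to
    annuli by the exponential: the mean of a holomorphic function over a circle
    does not depend on the radius ([circle_mean_const]). *)

Set Implicit Arguments.
Unset Strict Implicit.
Unset Printing Implicit Defensive.

Import Order.TTheory GRing.Theory Num.Theory.
Import numFieldNormedType.Exports.

Local Open Scope classical_set_scope.
Local Open Scope ring_scope.
Local Open Scope complex_scope.
Local Notation Re := complex.Re.
Local Notation Im := complex.Im.

(** * The modulus of a complex number *)

Section Modulus.
Context {R : rcfType}.
Implicit Types z w : R[i].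

Lemma complex_ext z w : Re z = Re w -> Im z = Im w -> z = w.
Proof. by case: z => a b; case: w => c d /= -> ->. Qed.

Lemma cRe_real (x : R) : Re x%:C = x. Proof. by []. Qed.

Lemma cIm_real (x : R) : Im x%:C = 0. Proof. by []. Qed.

Lemma cRe_opp z : Re (- z) = - Re z. Proof. by case: z. Qed.

Lemma cmodE z : cmod z = Num.sqrt (Re z ^+ 2 + Im z ^+ 2).
Proof. by case: z. Qed.

Lemma normC_cmod z : `|z| = (cmod z)%:C.
Proof. by case: z. Qed.

Lemma cmod_ge0 z : 0 <= cmod z.
Proof. by rewrite cmodE sqrtr_ge0. Qed.

Lemma cmod0 : cmod (0 : R[i]) = 0.
Proof. exact: ComplexField.Normc.normc0. Qed.

Lemma cmod1 : cmod (1 : R[i]) = 1.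
Proof. exact: ComplexField.Normc.normc1. Qed.

Lemma cmod_eq0 z : (cmod z == 0) = (z == 0).
Proof.
apply/eqP/eqP => [|->]; last exact: cmod0.
exact: ComplexField.Normc.eq0_normc.
Qed.

Lemma cmod_gt0 z : (0 < cmod z) = (z != 0).
Proof. by rewrite lt_def cmod_ge0 andbT cmod_eq0. Qed.

Lemma cmodM z w : cmod (z * w) = cmod z * cmod w.
Proof. exact: ComplexField.Normc.normcM. Qed.

Lemma cmodV z : cmod z^-1 = (cmod z)^-1.
Proof. exact: ComplexField.Normc.normcV. Qed.

Lemma cmodD z w : cmod (z + w) <= cmod z + cmod w.
Proof. by rewrite -lecR rmorphD /= -!normC_cmod ler_normD. Qed.

Lemma cmodN z : cmod (- z) = cmod z.
Proof. by apply: complexI; rewrite -!normC_cmod normrN. Qed.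

Lemma cmodBC z w : cmod (z - w) = cmod (w - z).
Proof. by rewrite -cmodN opprB. Qed.

Lemma cmodB z w : cmod (z - w) <= cmod z + cmod w.
Proof. by rewrite (le_trans (cmodD _ _)) // cmodN. Qed.

Lemma cmodBl z w : cmod z - cmod w <= cmod (z - w).
Proof. by rewrite lerBlDr -{1}(subrK w z) cmodD. Qed.

Lemma cmodX z n : cmod (z ^+ n) = cmod z ^+ n.
Proof.
elim: n => [|n IH]; first by rewrite !expr0 cmod1.
by rewrite !exprS cmodM IH.
Qed.

Lemma cmod_real (x : R) : cmod x%:C = `|x|.
Proof. by rewrite cmodE /= expr0n addr0 sqrtr_sqr. Qed.

Lemma cmod_conj z : cmod z^* = cmod z.
Proof. by case: z => x y; rewrite !cmodE /= sqrrN. Qed.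

Lemma cmod_Re z : `|Re z| <= cmod z.
Proof. by rewrite cmodE -sqrtr_sqr ler_sqrt ?lerDl ?addr_ge0 ?sqr_ge0. Qed.

Lemma cmod_Im z : `|Im z| <= cmod z.
Proof. by rewrite cmodE -sqrtr_sqr ler_sqrt ?lerDr ?addr_ge0 ?sqr_ge0. Qed.

Lemma cmod_i : cmod ('i : R[i]) = 1.
Proof. by rewrite cmodE /= expr0n expr1n add0r sqrtr1. Qed.

Lemma cmod_le_ReIm z : cmod z <= `|Re z| + `|Im z|.
Proof.
rewrite {1}(complexE z) (le_trans (cmodD _ _)) // cmodM cmod_i mul1r.
by rewrite !cmod_real.
Qed.

Lemma cmod_sqr z : cmod z ^+ 2 = Re z ^+ 2 + Im z ^+ 2.
Proof. by rewrite cmodE sqr_sqrtr ?addr_ge0 ?sqr_ge0. Qed.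

Lemma mulc_conj z : z * z^* = (cmod z ^+ 2)%:C.
Proof.
rewrite cmod_sqr; case: z => x y; apply: complex_ext => /=; ring.
Qed.

Lemma cmod_sum (I : Type) (r : seq I) (P : pred I) (F : I -> R[i]) :
  cmod (\sum_(i <- r | P i) F i) <= \sum_(i <- r | P i) cmod (F i).
Proof.
elim/big_ind2: _ => //; first by rewrite cmod0.
by move=> a b c d ab cd; rewrite (le_trans (cmodD _ _)) // lerD.
Qed.

Lemma cReM z w : Re (z * w) = Re z * Re w - Im z * Im w.
Proof. by case: z => a b; case: w. Qed.

Lemma cImM z w : Im (z * w) = Re z * Im w + Im z * Re w.
Proof. by case: z => a b; case: w. Qed.

Lemma cReD z w : Re (z + w) = Re z + Re w.
Proof. by case: z => a b; case: w. Qed.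

Lemma cImD z w : Im (z + w) = Im z + Im w.
Proof. by case: z => a b; case: w. Qed.


Lemma cRe_realM (c : R) z : Re (c%:C * z) = c * Re z.
Proof. by rewrite cReM cRe_real cIm_real mul0r subr0. Qed.

Lemma cReB z w : Re (z - w) = Re z - Re w.
Proof. by rewrite cReD cRe_opp. Qed.

End Modulus.

Arguments cmod : simpl never.

(** * Limits, continuity and complex derivatives *)

Section Limits.
Context {R : realType}.

(** Limits of complex functions on a space of increments [T] whose size is
    measured by [N]. Taking [T] to be the line or the plane gives continuity
    along a curve and continuity in the plane with a single set of rules. *)
Definition tends {T : Type} (N : T -> R) (g : T -> R[i]) (l : R[i]) :=
  forall e : R, 0 < e ->
    exists2 d : R, 0 < d & forall h, N h < d -> cmod (g h - l) < e.

Lemma tends_cst T (N : T -> R) (l : R[i]) : tends N (fun _ => l) l.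
Proof.
move=> e e0; exists 1 => // h _.
by rewrite subrr cmod0.
Qed.

Lemma tends_eq T (N : T -> R) g1 g2 l :
  g1 =1 g2 -> tends N g1 l -> tends N g2 l.
Proof. by move=> /funext ->. Qed.

Lemma tendsD T (N : T -> R) f g l m :
  tends N f l -> tends N g m -> tends N (fun h => f h + g h) (l + m).
Proof.
move=> fl gm e e0.
have e20 : 0 < e / 2 by lra.
have [d1 d10 H1] := fl _ e20; have [d2 d20 H2] := gm _ e20.
exists (Num.min d1 d2); first by rewrite lt_min d10.
move=> h; rewrite lt_min => /andP[/H1 h1 /H2 h2].
rewrite (_ : _ - _ = (f h - l) + (g h - m)); last by ring.
by rewrite (le_lt_trans (cmodD _ _)) //; lra.
Qed.

Lemma tendsM T (N : T -> R) f g l m :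
  tends N f l -> tends N g m -> tends N (fun h => f h * g h) (l * m).
Proof.
move=> fl gm e e0.
have l0 := cmod_ge0 l; have m0 := cmod_ge0 m.
pose K := cmod l + cmod m + 1.
have K0 : 0 < K by rewrite /K; lra.
pose s := Num.min 1 (e / (2 * K)).
have s0 : 0 < s by rewrite lt_min ltr01 divr_gt0 // mulr_gt0.
have s1 : s <= 1 by rewrite ge_min lexx.
have sK : s * K <= e / 2.
  have : s <= e / (2 * K) by rewrite ge_min lexx orbT.
  rewrite -(ler_pM2r K0) => /le_trans; apply.
  by rewrite invfM mulrA divfK ?gt_eqF.
have [d1 d10 H1] := fl _ s0; have [d2 d20 H2] := gm _ s0.
exists (Num.min d1 d2); first by rewrite lt_min d10.
move=> h; rewrite lt_min => /andP[/H1 h1 /H2 h2].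
rewrite (_ : _ - _ = (f h - l) * (g h - m) + l * (g h - m) + (f h - l) * m);
  last by ring.
have := cmodD ((f h - l) * (g h - m) + l * (g h - m)) ((f h - l) * m).
have := cmodD ((f h - l) * (g h - m)) (l * (g h - m)).
have a0 := cmod_ge0 (f h - l); have b0 := cmod_ge0 (g h - m).
rewrite !cmodM.
set a := cmod (f h - l) in h1 a0 *; set b := cmod (g h - m) in h2 b0 *.
have : a * b <= s by nra.
have : cmod l * b <= cmod l * s by nra.
have : a * cmod m <= s * cmod m by nra.
rewrite /K in sK; lra.
Qed.

Lemma tendsN T (N : T -> R) f l :
  tends N f l -> tends N (fun h => - f h) (- l).
Proof.
move=> fl e e0; have [d d0 H] := fl _ e0; exists d => // h /H.
by rewrite -opprD cmodN.
Qed.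

Lemma tendsB T (N : T -> R) f g l m :
  tends N f l -> tends N g m -> tends N (fun h => f h - g h) (l - m).
Proof. by move=> fl gm; apply/tendsD/tendsN. Qed.

Lemma tends_conj T (N : T -> R) f l :
  tends N f l -> tends N (fun h => (f h)^*) l^*.
Proof.
move=> fl e e0; have [d d0 H] := fl _ e0; exists d => // h /H.
by rewrite -rmorphB cmod_conj.
Qed.

Lemma tendsV T (N : T -> R) f l :
  l != 0 -> tends N f l -> tends N (fun h => (f h)^-1) l^-1.
Proof.
rewrite -cmod_gt0 => l0 fl e e0.
pose s := Num.min (cmod l / 2) (e * cmod l ^+ 2 / 2).
have s0 : 0 < s by rewrite lt_min !divr_gt0 // mulr_gt0 // exprn_gt0.
have [d d0 H] := fl _ s0; exists d => // h /H; rewrite lt_min => /andP[h1 h2].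
have fh : cmod l / 2 < cmod (f h).
  by have := cmodBl l (f h); rewrite cmodBC; lra.
have fh0 : 0 < cmod (f h) by lra.
rewrite (_ : _ - _ = (l - f h) * (f h)^-1 * l^-1); last first.
  by field; rewrite -!cmod_gt0 l0 fh0.
rewrite !cmodM !cmodV cmodBC -mulrA -invfM ltr_pdivrMr ?mulr_gt0 //.
apply: (lt_le_trans h2).
have : cmod l / 2 * cmod l <= cmod (f h) * cmod l by rewrite ler_wpM2r // ltW.
by nra.
Qed.

Lemma tends_comp T (N : T -> R) (f g : _ -> R[i]) l :
  tends (@cmod R) f l -> tends N g 0 -> tends N (fun h => f (g h)) l.
Proof.
move=> fl g0 e e0; have [d d0 H] := fl _ e0; have [c c0 K] := g0 _ d0.
by exists c => // h /K; rewrite subr0 => /H.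
Qed.

Lemma tends_id : tends (@cmod R) (fun h : R[i] => h) 0.
Proof. by move=> e e0; exists e => // h; rewrite subr0. Qed.

Definition ccont (f : R[i] -> R[i]) z := tends (@cmod R) (fun h => f (z + h)) (f z).

Definition rcont (g : R -> R[i]) t :=
  tends (fun s => `|s|) (fun s => g (t + s)) (g t).

Lemma rcont_comp f g t : ccont f (g t) -> rcont g t -> rcont (fun s => f (g s)) t.
Proof.
move=> cf cg.
have g0 : tends (fun s => `|s|) (fun s => g (t + s) - g t) 0.
  rewrite -[0](subrr (g t)).
  exact/tendsB/tends_cst.
apply: tends_eq (tends_comp cf g0) => s /=.
by rewrite addrC subrK.
Qed.

(** Caratheodory's form of the complex derivative: the difference quotient
    extends continuously by [d]. It makes the product and chain rules purely
    algebraic. *)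
Definition is_cderiv (f : R[i] -> R[i]) (z d : R[i]) :=
  exists2 q : R[i] -> R[i], q 0 = d /\ tends (@cmod R) q d
    & forall h, f (z + h) = f z + q h * h.

Lemma cderiv_cont f z d : is_cderiv f z d -> ccont f z.
Proof.
move=> [q [_ qd] fE].
rewrite /ccont (_ : f z = f z + d * 0); last by ring.
apply: (@tends_eq _ _ (fun h => f z + q h * h)) => [h|]; first by rewrite fE.
exact: tendsD (@tends_cst _ _ _) (tendsM qd tends_id).
Qed.

Lemma cderiv_cst c z : is_cderiv (fun _ => c) z 0.
Proof.
exists (fun _ => 0) => [|h]; last by rewrite mul0r addr0.
by split => //; exact: tends_cst.
Qed.

Lemma cderiv_id z : is_cderiv (fun x => x) z 1.
Proof.
exists (fun _ => 1) => [|h]; last by rewrite mul1r.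
by split => //; exact: tends_cst.
Qed.

Lemma cderivD f g z a b : is_cderiv f z a -> is_cderiv g z b ->
  is_cderiv (fun x => f x + g x) z (a + b).
Proof.
move=> [q [q0 qa] fE] [p [p0 pb] gE].
exists (fun h => q h + p h) => [|h]; last by rewrite fE gE; ring.
by split; [rewrite q0 p0|exact: tendsD].
Qed.

Lemma cderivM f g z a b : is_cderiv f z a -> is_cderiv g z b ->
  is_cderiv (fun x => f x * g x) z (a * g z + f z * b).
Proof.
move=> [q [q0 qa] fE] [p [p0 pb] gE].
exists (fun h => q h * g z + f z * p h + q h * p h * h) => [|h]; last first.
  by rewrite fE gE; ring.
split; first by rewrite q0 p0 mulr0 addr0.
rewrite (_ : _ + _ = a * g z + f z * b + a * b * 0); last by ring.
apply: tendsD (tendsM (tendsM qa pb) tends_id).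
by apply: tendsD; apply: tendsM => //; exact: tends_cst.
Qed.

Lemma cderivZ c f z a : is_cderiv f z a -> is_cderiv (fun x => c * f x) z (c * a).
Proof.
by move=> /(cderivM (cderiv_cst c z)); rewrite mul0r add0r.
Qed.

Lemma cderivN f z a : is_cderiv f z a -> is_cderiv (fun x => - f x) z (- a).
Proof.
move=> [q [q0 qa] fE]; exists (fun h => - q h) => [|h]; last by rewrite fE; ring.
by rewrite q0; split => //; exact: tendsN.
Qed.

Lemma cderivB f g z a b : is_cderiv f z a -> is_cderiv g z b ->
  is_cderiv (fun x => f x - g x) z (a - b).
Proof. by move=> fa gb; apply/cderivD/cderivN. Qed.

Lemma cderivV z : z != 0 -> is_cderiv (fun x => x^-1) z (- (z ^+ 2)^-1).
Proof.
move=> z0; exists (fun h => - (if z + h == 0 then z^-1 * h^-1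
                               else ((z + h) * z)^-1)); last first.
  move=> h; case: (eqVneq (z + h) 0) => [zh|zh].
    have hz : h = - z by rewrite -(addKr z h) zh addr0.
    by rewrite zh invr0 hz; field.
  by field; rewrite zh z0.
rewrite addr0 (negPf z0) expr2; split => //.
have zz : z * z != 0 by rewrite mulf_neq0.
apply: tendsN.
have : tends (@cmod R) (fun h => ((z + h) * z)^-1) (z * z)^-1.
  apply: tendsV => //; apply: tendsM; last exact: tends_cst.
  rewrite -[X in tends _ _ X](addr0 z).
  exact: tendsD (@tends_cst _ _ _) tends_id.
move=> T e e0; have [d d0 H] := T _ e0.
exists (Num.min d (cmod z)); first by rewrite lt_min d0 cmod_gt0.
move=> h; rewrite lt_min => /andP[hd hz].
case: eqP => [zh|_]; last exact: H.
by move: hz; rewrite -(addKr z h) zh addr0 cmodN ltxx.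
Qed.

Lemma cderiv_comp f g z a b : is_cderiv f (g z) a -> is_cderiv g z b ->
  is_cderiv (fun x => f (g x)) z (a * b).
Proof.
move=> [q [q0 qa] fE] [p [p0 pb] gE].
exists (fun h => q (p h * h) * p h) => [|h]; last by rewrite gE fE; ring.
split; first by rewrite mulr0 q0 p0.
apply: tendsM (pb); apply: (tends_comp qa).
rewrite -[X in tends _ _ X](mulr0 b).
exact: (tendsM pb tends_id).
Qed.

Lemma cderiv_near f g z a d : 0 < d ->
  (forall h, cmod h < d -> f (z + h) = g (z + h)) ->
  is_cderiv f z a -> is_cderiv g z a.
Proof.
move=> d0 fg [q [q0 qa] fE].
have fgz : f z = g z by move: (fg 0); rewrite cmod0 addr0 => ->.
exists (fun h => if cmod h < d then q h else (g (z + h) - g z) / h) => [|h].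
  rewrite cmod0 d0; split => // e e0; have [c c0 H] := qa _ e0.
  exists (Num.min d c); first by rewrite lt_min d0.
  by move=> h; rewrite lt_min => /andP[-> /H].
case: ifPn => [hd|]; first by rewrite -fg // fE fgz.
move=> hd; rewrite divfK; first by ring.
apply: contraNneq hd => ->; by rewrite cmod0.
Qed.

(** The topology of the complex numbers is described by balls whose radii are
    complex numbers; the positive ones are real. *)
Lemma gt0_complex (e : R[i]) : 0 < e -> e = (Re e)%:C /\ 0 < Re e.
Proof.
move=> e0; have eE : e = (Re e)%:C.
  by rewrite [in LHS](complexE e) (ger0_Im (ltW e0)) mulr0 addr0.
by split => //; rewrite -ltcR -eE.
Qed.

Lemma nbhs_dnbhs_cmod (P : R[i] -> Prop) :
  (\forall h \near 0^', P h) <->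
  exists2 d : R, 0 < d & forall h, h != 0 -> cmod h < d -> P h.
Proof.
split.
  move=> /nbhs_ballP[e /= e0 H].
  have [eE re0] := gt0_complex e0.
  exists (Re e) => // h h0 he; apply: H => //.
  by rewrite -ball_normE /= sub0r normrN normC_cmod eE ltcR.
move=> [d d0 H]; apply/nbhs_ballP; exists d%:C => /=; first by rewrite ltcR.
move=> h; rewrite -ball_normE /= sub0r normrN normC_cmod ltcR => hd h0.
exact: H.
Qed.

Lemma cvg_dnbhs_cmod (q : R[i] -> R[i]) (l : R[i]) :
  (q h @[h --> 0^'] --> l) <->
  forall e : R, 0 < e -> exists2 d : R, 0 < d &
    forall h, h != 0 -> cmod h < d -> cmod (q h - l) < e.
Proof.
split=> [/cvgrPdist_lt H e e0|H].
  have /H/nbhs_dnbhs_cmod[d d0 K] : 0 < e%:C by rewrite ltcR.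
  exists d => // h h0 /(K _ h0).
  by rewrite normC_cmod ltcR cmodBC.
apply/cvgrPdist_lt => e e0; apply/nbhs_dnbhs_cmod.
have [eE re0] := gt0_complex e0.
have [d d0 K] := H _ re0; exists d => // h h0 /(K _ h0).
by rewrite cmodBC eE normC_cmod ltcR.
Qed.

Lemma quotient_cvgP (f : R[i] -> R[i]) z d :
  (h^-1 *: (f (h + z) - f z) @[h --> 0^'] --> d) <-> is_cderiv f z d.
Proof.
split=> [/cvg_dnbhs_cmod H|[q [q0 qd] fE]].
  exists (fun h => if h == 0 then d else h^-1 * (f (h + z) - f z)).
    rewrite eqxx; split=> // e e0; have [c c0 K] := H _ e0.
    exists c => // h hc; case: eqP => [_|/eqP h0]; first by rewrite subrr cmod0.
    exact: K.
  move=> h; case: eqP => [->|/eqP h0]; first by rewrite mulr0 !addr0.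
  by rewrite [h + z]addrC; field.
apply/cvg_dnbhs_cmod => e e0; have [c c0 K] := qd _ e0.
exists c => // h h0 /K.
rewrite [h + z]addrC fE (_ : _ *: _ = q h) //.
by rewrite [f z + _]addrC addrK /GRing.scale /=; field.
Qed.

Lemma derivable_cderiv (f : R[i] -> R[i]) z :
  derivable f z 1 <-> exists d, is_cderiv f z d.
Proof.
rewrite /derivable /=.
have -> : (fun h : R[i] => h^-1 *: (f (h *: 1 + z) - f z)) =
  (fun h : R[i] => h^-1 *: (f (h + z) - f z)).
  by apply/funext => h; rewrite /GRing.scale /= mulr1.
split=> [/cvg_ex[d /quotient_cvgP fd]|[d /quotient_cvgP fd]]; first by exists d.
by apply/cvg_ex; exists d.
Qed.

Lemma cderiv_derive1 (f : R[i] -> R[i]) z d : is_cderiv f z d -> derive1 f z = d.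
Proof. by move=> /quotient_cvgP fd; apply/cvg_lim. Qed.

End Limits.

(** * Integrals of complex functions over real intervals *)

Section Integral.
Context {R : realType}.
Implicit Types (f g : R -> R[i]) (a b c t : R).

Local Notation mu := (@lebesgue_measure R).

Definition cint a b g : R[i] :=
  (\int[mu]_(t in `[a, b]) Re (g t))%R +i* (\int[mu]_(t in `[a, b]) Im (g t))%R.

Definition cont_on a b g := forall t, a <= t <= b -> rcont g t.

Lemma rcont_Re g t : rcont g t -> {for t, continuous (fun s => Re (g s))}.
Proof.
move=> gt; apply/cvgrPdist_lt => e e0; have [d d0 H] := gt _ e0.
apply/nbhs_ballP; exists d => //= s; rewrite /ball /= => ts.
have := H (s - t); rewrite distrC subrKC => /(_ ts).
apply: le_lt_trans; apply: le_trans (cmod_Re _).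
by rewrite raddfB distrC.
Qed.

Lemma rcont_Im g t : rcont g t -> {for t, continuous (fun s => Im (g s))}.
Proof.
move=> gt; apply/cvgrPdist_lt => e e0; have [d d0 H] := gt _ e0.
apply/nbhs_ballP; exists d => //= s; rewrite /ball /= => ts.
have := H (s - t); rewrite distrC subrKC => /(_ ts).
apply: le_lt_trans; apply: le_trans (cmod_Im _).
by rewrite raddfB distrC.
Qed.

Lemma cont_integrable (h : R -> R) a b :
  (forall t, a <= t <= b -> {for t, continuous h}) ->
  mu.-integrable `[a, b] (EFin \o h).
Proof.
move=> ch; apply: continuous_compact_integrable; first exact: segment_compact.
apply: continuous_in_subspaceT => t; rewrite inE /= in_itv /=.
exact: ch.
Qed.

Lemma integrable_Re a b g : cont_on a b g ->
  mu.-integrable `[a, b] (EFin \o (fun t => Re (g t))).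
Proof. by move=> cg; apply: cont_integrable => t /cg /rcont_Re. Qed.

Lemma integrable_Im a b g : cont_on a b g ->
  mu.-integrable `[a, b] (EFin \o (fun t => Im (g t))).
Proof. by move=> cg; apply: cont_integrable => t /cg /rcont_Im. Qed.

Lemma eq_cint a b f g : (forall t, a <= t <= b -> f t = g t) ->
  cint a b f = cint a b g.
Proof.
move=> fg; congr (_ +i* _); apply: eq_Rintegral => t;
  by rewrite inE /= in_itv /= => /fg ->.
Qed.

Lemma Re_cint a b g : Re (cint a b g) = (\int[mu]_(t in `[a, b]) Re (g t))%R.
Proof. by []. Qed.

Lemma Im_cint a b g : Im (cint a b g) = (\int[mu]_(t in `[a, b]) Im (g t))%R.
Proof. by []. Qed.

Lemma cintD a b f g : cont_on a b f -> cont_on a b g ->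
  cint a b (fun t => f t + g t) = cint a b f + cint a b g.
Proof.
move=> cf cg; apply: complex_ext.
  rewrite [RHS]cReD !Re_cint -RintegralD ?integrable_Re //.
  by apply: eq_Rintegral => t _; rewrite cReD.
rewrite [RHS]cImD !Im_cint -RintegralD ?integrable_Im //.
by apply: eq_Rintegral => t _; rewrite cImD.
Qed.

Lemma cintZ a b c g : cont_on a b g ->
  cint a b (fun t => c%:C * g t) = c%:C * cint a b g.
Proof.
move=> cg; apply: complex_ext.
  rewrite [RHS]cReM !Re_cint !cRe_real mul0r subr0 -RintegralZl ?integrable_Re //.
  by apply: eq_Rintegral => t _; rewrite cReM cRe_real mul0r subr0.
rewrite [RHS]cImM !Im_cint !cRe_real mul0r addr0 -RintegralZl ?integrable_Im //.
by apply: eq_Rintegral => t _; rewrite cImM cRe_real mul0r addr0.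
Qed.

Lemma cont_onM a b f g : cont_on a b f -> cont_on a b g ->
  cont_on a b (fun t => f t * g t).
Proof. by move=> cf cg t ab; apply: tendsM; [exact: cf|exact: cg]. Qed.

Lemma cont_onD a b f g : cont_on a b f -> cont_on a b g ->
  cont_on a b (fun t => f t + g t).
Proof. by move=> cf cg t ab; apply: tendsD; [exact: cf|exact: cg]. Qed.

Lemma cont_onN a b f : cont_on a b f -> cont_on a b (fun t => - f t).
Proof. by move=> cf t ab; apply: tendsN; exact: cf. Qed.

Lemma cont_onB a b f g : cont_on a b f -> cont_on a b g ->
  cont_on a b (fun t => f t - g t).
Proof. by move=> cf cg; apply/cont_onD/cont_onN. Qed.

Lemma cont_on_conj a b f : cont_on a b f -> cont_on a b (fun t => (f t)^*).
Proof. by move=> cf t ab; apply: tends_conj; exact: cf. Qed.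

Lemma cont_on_cst a b (z : R[i]) : cont_on a b (fun _ => z).
Proof. by move=> t _; exact: tends_cst. Qed.

Lemma cont_on_sum a b (f : nat -> R -> R[i]) n :
  (forall k, (k < n)%N -> cont_on a b (f k)) ->
  cont_on a b (fun t => \sum_(k < n) f k t).
Proof.
move=> cf; elim: n cf => [|n IH] cf.
  under eq_fun do rewrite big_ord0.
  exact: cont_on_cst.
under eq_fun do rewrite big_ord_recr /=.
apply: cont_onD; last exact: cf.
by apply: IH => k kn; apply: cf; exact: ltnW.
Qed.

Lemma cintMi a b g : cont_on a b g ->
  cint a b (fun t => 'i * g t) = 'i * cint a b g.
Proof.
move=> cg; apply: complex_ext.
  rewrite [RHS]cReM !Re_cint mul0r mul1r sub0r -mulN1r -RintegralZl ?integrable_Im //.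
  by apply: eq_Rintegral => t _; rewrite cReM /=; ring.
rewrite [RHS]cImM !Im_cint mul0r mul1r add0r.
by apply: eq_Rintegral => t _; rewrite cImM /=; ring.
Qed.

Lemma cintM a b (z : R[i]) g : cont_on a b g ->
  cint a b (fun t => z * g t) = z * cint a b g.
Proof.
move=> cg.
transitivity (cint a b (fun t => (Re z)%:C * g t + 'i * ((Im z)%:C * g t))).
  by apply: eq_cint => t _; rewrite [in LHS](complexE z) mulrDl mulrA.
have ci (w : R[i]) : cont_on a b (fun t => w * g t).
  exact/cont_onM/cg/cont_on_cst.
rewrite cintD // ?cintMi // ?cintZ //; first by rewrite [in RHS](complexE z) mulrDl mulrA.
exact/cont_onM/ci/cont_on_cst.
Qed.

Lemma cintN a b g : cont_on a b g -> cint a b (fun t => - g t) = - cint a b g.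
Proof.
move=> cg; rewrite -mulN1r -cintM //.
by apply: eq_cint => t _; rewrite mulN1r.
Qed.

Lemma cintB a b f g : cont_on a b f -> cont_on a b g ->
  cint a b (fun t => f t - g t) = cint a b f - cint a b g.
Proof. by move=> cf cg; rewrite cintD ?cintN //; exact: cont_onN. Qed.

Lemma cint_cst a b z : a <= b -> cint a b (fun _ => z) = (b - a)%:C * z.
Proof.
move=> ab; have mE : fine (mu `[a, b]) = b - a.
  rewrite lebesgue_measure_itv /= lte_fin; case: ltP => //= ba.
  by apply/esym/eqP; rewrite subr_eq0 eq_le ba ab.
apply: complex_ext.
  by rewrite [RHS]cReM Re_cint Rintegral_cst // mE cRe_real cIm_real; ring.
by rewrite [RHS]cImM Im_cint Rintegral_cst // mE cRe_real cIm_real; ring.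
Qed.

Lemma cint_conj a b g : cont_on a b g ->
  cint a b (fun t => (g t)^*) = (cint a b g)^*.
Proof.
move=> cg; apply: complex_ext.
  transitivity (Re (cint a b g)); last by case: (cint a b g).
  by rewrite !Re_cint; apply: eq_Rintegral => t _; case: (g t).
transitivity (- Im (cint a b g)); last by case: (cint a b g).
rewrite !Im_cint -mulN1r -RintegralZl ?integrable_Im //.
by apply: eq_Rintegral => t _; rewrite mulN1r; case: (g t).
Qed.

Lemma cint_split c a b g : a <= c <= b -> cont_on a b g ->
  cint a b g = cint a c g + cint c b g.
Proof.
move=> /andP[ac cb] cg.
have split (h : R -> R) : mu.-integrable `[a, b] (EFin \o h) ->
    (\int[mu]_(t in `[a, b]) h t)%R =
    (\int[mu]_(t in `[a, c]) h t)%R + (\int[mu]_(t in `[c, b]) h t)%R.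
  move=> ih; apply/eqP; rewrite addrC -subr_eq; apply/eqP.
  rewrite Rintegral_itvB ?bnd_simp //.
  rewrite Rintegral_itv_obnd_cbnd //; apply: integrableS ih => //.
  by apply: subset_itvr; rewrite bnd_simp.
apply: complex_ext; first by rewrite cReD !Re_cint; apply/split/integrable_Re.
by rewrite cImD !Im_cint; apply/split/integrable_Im.
Qed.

Lemma cint_sum a b (f : nat -> R -> R[i]) n :
  (forall k, (k < n)%N -> cont_on a b (f k)) ->
  cint a b (fun t => \sum_(k < n) f k t) = \sum_(k < n) cint a b (f k).
Proof.
elim: n => [|n IH] cf.
  rewrite big_ord0; apply: complex_ext; rewrite ?Re_cint ?Im_cint /=;
    under eq_Rintegral do rewrite big_ord0 /=; by rewrite Rintegral_cst // mul0r.
rewrite big_ord_recr /= -IH => [|k kn]; last by apply: cf; exact: ltnW.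
rewrite -cintD; [|by apply: cont_on_sum => k kn; apply: cf; exact: ltnW|exact: cf].
by apply: eq_cint => t _; rewrite big_ord_recr.
Qed.

Lemma le_cint_Re a b f g : cont_on a b f -> cont_on a b g ->
  (forall t, a <= t <= b -> Re (f t) <= Re (g t)) ->
  Re (cint a b f) <= Re (cint a b g).
Proof.
move=> cf cg fg; by apply: le_Rintegral; rewrite ?integrable_Re.
Qed.

(** The factor [2] comes from bounding the real and imaginary parts
    separately; the sharp constant is never at stake. *)
Lemma cmod_cint a b g M : a <= b -> cont_on a b g ->
  (forall t, a <= t <= b -> cmod (g t) <= M) ->
  cmod (cint a b g) <= 2 * M * (b - a).
Proof.
move=> ab cg gM.
have bound (h : R -> R) : mu.-integrable `[a, b] (EFin \o h) ->
    (forall t, a <= t <= b -> `|h t| <= M) ->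
    `|(\int[mu]_(t in `[a, b]) h t)%R| <= M * (b - a).
  move=> ih hM; apply: le_trans (le_normr_Rintegral _ ih) _ => //.
  have mE : fine (mu `[a, b]) = b - a.
    rewrite lebesgue_measure_itv /= lte_fin; case: ltP => //= ba.
    by apply/esym/eqP; rewrite subr_eq0 eq_le ba ab.
  rewrite -mE -Rintegral_cst //; apply: le_Rintegral => //.
  - exact: integrable_norm.
  - by apply: cont_integrable => t _; exact: cvg_cst.
rewrite -mulrA mulr_natl mulr2n.
apply: le_trans (cmod_le_ReIm _) _; rewrite Re_cint Im_cint; apply: lerD.
  by apply: (bound _ (integrable_Re cg)) => t /gM; exact/le_trans/cmod_Re.
by apply: (bound _ (integrable_Im cg)) => t /gM; exact/le_trans/cmod_Im.
Qed.

End Integral.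

Arguments cint : simpl never.

(** * The Cauchy-Goursat theorem *)

Section Goursat.
Context {R : realType}.

Lemma nested_halves (A : R) (x : nat -> R) : 0 <= A ->
  (forall n, x n.+1 = x n \/ x n.+1 = x n + A / 2 ^+ n.+1) ->
  exists p, forall n, x n <= p <= x n + A / 2 ^+ n.
Proof.
move=> A0 step.
have half n : A / 2 ^+ n = A / 2 ^+ n.+1 + A / 2 ^+ n.+1.
  by rewrite exprS; field; rewrite expf_neq0.
have pos n : 0 <= A / 2 ^+ n by rewrite divr_ge0 // exprn_ge0.
have up n k : x n <= x (n + k)%N.
  elim: k => [|k IH]; first by rewrite addn0.
  apply: le_trans IH _; rewrite addnS.
  by case: (step (n + k)%N) => ->; rewrite ?lerDl.
have down n k : x (n + k)%N + A / 2 ^+ (n + k) <= x n + A / 2 ^+ n.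
  elim: k => [|k IH]; first by rewrite addn0.
  apply: le_trans _ IH; rewrite addnS [in leRHS]half.
  have := pos (n + k).+1.
  by case: (step (n + k)%N) => ->; lra.
have bnd n m : x m <= x n + A / 2 ^+ n.
  case: (leqP n m) => nm.
    rewrite -(subnKC nm); apply: le_trans (down n (m - n)%N).
    by rewrite lerDl.
  rewrite -(subnKC (ltnW nm)); apply: le_trans (up m (n - m)%N) _.
  by rewrite lerDl.
exists (sup (range x)) => n; apply/andP; split.
  apply: ub_le_sup; last by exists n.
  by exists (x 0%N + A / 2 ^+ 0) => _ [m _ <-].
by apply: ge_sup; [exists (x 0%N), 0%N|move=> _ [m _ <-]].
Qed.

(** Dependent choice, followed by nested intervals in each coordinate. The
    property [P n] lives on the rectangle of sides [A / 2 ^ n] and [B / 2 ^ n]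
    with lower left corner [p]; the conclusion is the compactness behind
    Goursat's theorem. *)
Lemma quartering (A B : R) (P : nat -> R * R -> Prop) p0 : 0 <= A -> 0 <= B ->
  P 0%N p0 ->
  (forall n p, P n p -> exists q, [/\ P n.+1 q,
     q.1 = p.1 \/ q.1 = p.1 + A / 2 ^+ n.+1
   & q.2 = p.2 \/ q.2 = p.2 + B / 2 ^+ n.+1]) ->
  exists p : R * R, forall n, exists q : R * R, [/\ P n q,
     q.1 <= p.1 <= q.1 + A / 2 ^+ n & q.2 <= p.2 <= q.2 + B / 2 ^+ n].
Proof.
move=> A0 B0 P0 step.
pose good n p q := [/\ P n.+1 q, q.1 = p.1 \/ q.1 = p.1 + A / 2 ^+ n.+1
   & q.2 = p.2 \/ q.2 = p.2 + B / 2 ^+ n.+1].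
pose fix s n : R * R := if n is m.+1 then xget p0 (good m (s m)) else p0.
have sP n : P n (s n).
  elim: n => // n /step[q qP] /=.
  by case: (@xgetPex _ p0 (good n (s n)) (ex_intro _ q qP)).
have sg n : good n (s n) (s n.+1).
  by have [q qP] := step _ _ (sP n); exact: (xgetPex p0 (ex_intro _ q qP)).
have [x xP] := @nested_halves A (fun n => (s n).1) A0 (fun n => let: And3 _ h _ := sg n in h).
have [y yP] := @nested_halves B (fun n => (s n).2) B0 (fun n => let: And3 _ _ h := sg n in h).
by exists (x, y) => n; exists (s n).
Qed.

(** The integral of [F z dz] along the boundary of the rectangle
    [[a, b] x [c, d]], counterclockwise. Opposite sides are put together, which
    makes the contribution of an affine [F] obviously zero. *)
Definition boundary_integral (F : R[i] -> R[i]) (a b c d : R) : R[i] :=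
  cint a b (fun s => F (s +i* c) - F (s +i* d)) +
  'i * cint c d (fun t => F (b +i* t) - F (a +i* t)).

Definition cderivable_on (F : R[i] -> R[i]) a b c d := forall s t,
  a <= s <= b -> c <= t <= d -> exists w, is_cderiv F (s +i* t) w.

Lemma cderivable_sub F a b c d a' b' c' d' :
  a <= a' -> b' <= b -> c <= c' -> d' <= d ->
  cderivable_on F a b c d -> cderivable_on F a' b' c' d'.
Proof.
move=> aa bb cc dd dF s t /andP[as' sb] /andP[ct td].
apply: dF; apply/andP; split; first exact: le_trans as'.
- exact: le_trans bb.
- exact: le_trans ct.
- exact: le_trans dd.
Qed.

Lemma rcont_hline (y x : R) : rcont (fun s => s +i* y) x.
Proof.
move=> e e0; exists e => // h he.
rewrite (_ : _ - _ = h%:C) ?cmod_real //.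
by apply: complex_ext; rewrite /= ?subrr // addrC addKr.
Qed.

Lemma rcont_vline (x y : R) : rcont (fun t => x +i* t) y.
Proof.
move=> e e0; exists e => // h he.
rewrite (_ : _ - _ = 'i * h%:C) ?cmodM ?cmod_i ?mul1r ?cmod_real //.
by apply: complex_ext; rewrite /= ?subrr ?mul0r ?subr0 //; ring.
Qed.

Lemma cont_hline F a b c d y : cderivable_on F a b c d -> c <= y <= d ->
  cont_on a b (fun s => F (s +i* y)).
Proof.
move=> dF yP s sP; have [w Fw] := dF _ _ sP yP.
exact: rcont_comp (cderiv_cont Fw) (@rcont_hline y s).
Qed.

Lemma cont_vline F a b c d x : cderivable_on F a b c d -> a <= x <= b ->
  cont_on c d (fun t => F (x +i* t)).
Proof.
move=> dF xP t tP; have [w Fw] := dF _ _ xP tP.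
exact: rcont_comp (cderiv_cont Fw) (@rcont_vline x t).
Qed.

Lemma boundary_splitx m F a b c d : a <= m <= b -> c <= d ->
  cderivable_on F a b c d ->
  boundary_integral F a b c d =
  boundary_integral F a m c d + boundary_integral F m b c d.
Proof.
move=> /andP[am mb] cd dF.
have ab := le_trans am mb.
have hl y : c <= y <= d -> cont_on a b (fun s => F (s +i* y)) by exact: cont_hline.
have vl x : a <= x <= b -> cont_on c d (fun t => F (x +i* t)) by exact: cont_vline.
rewrite /boundary_integral (@cint_split _ m a b) ?am //; last first.
  by apply: cont_onB; apply: hl; rewrite lexx cd.
rewrite (@eq_cint _ c d (fun t => F (b +i* t) - F (a +i* t))
  (fun t => (F (b +i* t) - F (m +i* t)) + (F (m +i* t) - F (a +i* t)))); last first.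
  by move=> t _; ring.
rewrite (@cintD _ c d); first by ring.
  by apply: cont_onB; apply: vl; rewrite ?lexx ?ab ?am.
by apply: cont_onB; apply: vl; rewrite ?lexx ?ab ?am.
Qed.

Lemma boundary_splity m F a b c d : a <= b -> c <= m <= d ->
  cderivable_on F a b c d ->
  boundary_integral F a b c d =
  boundary_integral F a b c m + boundary_integral F a b m d.
Proof.
move=> ab /andP[cm md] dF.
have cd := le_trans cm md.
have hl y : c <= y <= d -> cont_on a b (fun s => F (s +i* y)) by exact: cont_hline.
have vl x : a <= x <= b -> cont_on c d (fun t => F (x +i* t)) by exact: cont_vline.
rewrite /boundary_integral (@cint_split _ m c d) ?cm //; last first.
  by apply: cont_onB; apply: vl; rewrite lexx ab.
rewrite (@eq_cint _ a b (fun s => F (s +i* c) - F (s +i* d))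
  (fun t => (F (t +i* c) - F (t +i* m)) + (F (t +i* m) - F (t +i* d)))); last first.
  by move=> t _; ring.
rewrite (@cintD _ a b); first by ring.
  by apply: cont_onB; apply: hl; rewrite ?lexx ?cd ?cm.
by apply: cont_onB; apply: hl; rewrite ?lexx ?cd ?cm.
Qed.

Lemma cint_near_cst a b (g : R -> R[i]) w M : a <= b -> cont_on a b g ->
  (forall t, a <= t <= b -> cmod (g t - w) <= M) ->
  cmod (cint a b g - (b - a)%:C * w) <= 2 * M * (b - a).
Proof.
move=> ab cg gM; rewrite -cint_cst // -cintB //; last exact: cont_on_cst.
by apply: cmod_cint => //; apply: cont_onB => //; exact: cont_on_cst.
Qed.

(** The first order part of [F] does not contribute, so the boundary integral
    over a small rectangle around a point of differentiability is negligible
    with respect to its squared diameter. *)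
Lemma boundary_small F a b c d p w e : a <= b -> c <= d ->
  cderivable_on F a b c d ->
  (forall s t, a <= s <= b -> c <= t <= d ->
     cmod (F (s +i* t) - F p - w * ((s +i* t) - p)) <= e) ->
  cmod (boundary_integral F a b c d) <= 4 * e * ((b - a) + (d - c)).
Proof.
move=> ab cd dF small.
have hl y : c <= y <= d -> cont_on a b (fun s => F (s +i* y)) by exact: cont_hline.
have vl x : a <= x <= b -> cont_on c d (fun t => F (x +i* t)) by exact: cont_vline.
pose r z := F z - F p - w * (z - p).
have rE z z' : F z - F z' - w * (z - z') = r z - r z' by rewrite /r; ring.
have H1 : cmod (cint a b (fun s => F (s +i* c) - F (s +i* d)) -
    (b - a)%:C * (w * (- 'i * (d - c)%:C))) <= 2 * (2 * e) * (b - a).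
  apply: cint_near_cst => //.
    by apply: cont_onB; apply: hl; rewrite lexx cd.
  move=> s sP.
  have -> : - 'i * (d - c)%:C = (s +i* c) - (s +i* d).
    by apply: complex_ext => /=; ring.
  rewrite rE (le_trans (cmodB _ _)) // mulr_natl mulr2n.
  by rewrite lerD // small // lexx cd.
have H2 : cmod (cint c d (fun t => F (b +i* t) - F (a +i* t)) -
    (d - c)%:C * (w * (b - a)%:C)) <= 2 * (2 * e) * (d - c).
  apply: cint_near_cst => //.
    by apply: cont_onB; apply: vl; rewrite lexx ab.
  move=> t tP.
  have -> : (b - a)%:C = (b +i* t) - (a +i* t).
    by apply: complex_ext => /=; ring.
  rewrite rE (le_trans (cmodB _ _)) // mulr_natl mulr2n.
  by rewrite lerD // small // lexx ab.
rewrite /boundary_integral.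
set I1 := cint a b _ in H1 *; set I2 := cint c d _ in H2 *.
have -> : I1 + 'i * I2 = (I1 - (b - a)%:C * (w * (- 'i * (d - c)%:C))) +
    'i * (I2 - (d - c)%:C * (w * (b - a)%:C)) by ring.
apply: le_trans (cmodD _ _) _; rewrite cmodM cmod_i mul1r.
move: H1 H2; move: (cmod _) (cmod _) => x y; lra.
Qed.

(** A nonzero value [J] would survive in one of the quarters at each
    subdivision, up to a factor [1/4]: this contradicts [boundary_small] at the
    point to which the rectangles shrink. *)
Theorem goursat F a b c d : a <= b -> c <= d ->
  cderivable_on F a b c d -> boundary_integral F a b c d = 0.
Proof.
move=> ab cd dF; apply/eqP; rewrite -cmod_eq0; apply: contraT => nz.
set J := cmod _ in nz.
have J0 : 0 < J by rewrite lt_def nz cmod_ge0.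
pose A := b - a; pose B := d - c.
have A0 : 0 <= A by rewrite subr_ge0.
have B0 : 0 <= B by rewrite subr_ge0.
have pos n : 0 < (2 : R) ^+ n by rewrite exprn_gt0.
pose P n (p : R * R) := [/\ a <= p.1, p.1 + A / 2 ^+ n <= b, c <= p.2,
  p.2 + B / 2 ^+ n <= d & J / (2 ^+ n * 2 ^+ n) <=
  cmod (boundary_integral F p.1 (p.1 + A / 2 ^+ n) p.2 (p.2 + B / 2 ^+ n))].
have P0 : P 0%N (a, c).
  by split; rewrite /= ?expr0 ?mulr1 ?divr1 // /A /B ?subrKC.
have step n p : P n p -> exists q, [/\ P n.+1 q,
     q.1 = p.1 \/ q.1 = p.1 + A / 2 ^+ n.+1
   & q.2 = p.2 \/ q.2 = p.2 + B / 2 ^+ n.+1].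
  case: p => x y [/= ax xb cy yd JP].
  have half (X : R) : X / 2 ^+ n = X / 2 ^+ n.+1 + X / 2 ^+ n.+1.
    by rewrite exprS; field; rewrite expf_neq0.
  set h := A / 2 ^+ n.+1; set k := B / 2 ^+ n.+1.
  have h0 : 0 <= h by rewrite divr_ge0 // ltW.
  have k0 : 0 <= k by rewrite divr_ge0 // ltW.
  rewrite !half -/h -/k in xb yd JP.
  have dF' : cderivable_on F x (x + (h + h)) y (y + (k + k)).
    exact: cderivable_sub dF.
  have JE : boundary_integral F x (x + (h + h)) y (y + (k + k)) =
    boundary_integral F x (x + h) y (y + k) +
    boundary_integral F (x + h) (x + h + h) y (y + k) +
    (boundary_integral F x (x + h) (y + k) (y + k + k) +
     boundary_integral F (x + h) (x + h + h) (y + k) (y + k + k)).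
    rewrite !addrA in dF' *.
    have xP : x <= x + h <= x + h + h by rewrite !lerDl h0.
    have yP : y <= y + k <= y + k + k by rewrite !lerDl k0.
    have [/andP[_ xh] /andP[yk yk']] := (xP, yP).
    have xx : x <= x + h + h by lra.
    rewrite (boundary_splity xx yP dF').
    rewrite (boundary_splitx (d := y + k) xP) //; last by apply: cderivable_sub dF'.
    rewrite (boundary_splitx (c := y + k) xP) //; last by apply: cderivable_sub dF'.
    by rewrite !addrA.
  pose J' := J / (2 ^+ n.+1 * 2 ^+ n.+1).
  have J'E : J / (2 ^+ n * 2 ^+ n) = 4 * J'.
    by rewrite /J' !exprS; field; rewrite expf_neq0.
  rewrite J'E JE in JP.
  have := cmodD (boundary_integral F x (x + h) y (y + k))
    (boundary_integral F (x + h) (x + h + h) y (y + k)).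
  have := cmodD (boundary_integral F x (x + h) (y + k) (y + k + k))
    (boundary_integral F (x + h) (x + h + h) (y + k) (y + k + k)).
  have {JP} := le_trans JP (cmodD _ _).
  have ax' : a <= x + h by rewrite (le_trans ax) ?lerDl.
  have cy' : c <= y + k by rewrite (le_trans cy) ?lerDl.
  have xb' : x + h + h <= b by rewrite -addrA.
  have yd' : y + k + k <= d by rewrite -addrA.
  have xb0 : x + h <= b by apply: le_trans xb'; rewrite lerDl.
  have yd0 : y + k <= d by apply: le_trans yd'; rewrite lerDl.
  have [J1|J1] := lerP J' (cmod (boundary_integral F x (x + h) y (y + k))).
    by move=> *; exists (x, y); split; [split|left|left].
  have [J2|J2] := lerP J' (cmod (boundary_integral F (x + h) (x + h + h) y (y + k))).
    by move=> *; exists (x + h, y); split; [split|right|left].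
  have [J3|J3] := lerP J' (cmod (boundary_integral F x (x + h) (y + k) (y + k + k))).
    by move=> *; exists (x, y + k); split; [split|left|right].
  have [J4|J4] := lerP J' (cmod (boundary_integral F (x + h) (x + h + h)
                                                   (y + k) (y + k + k))).
    by move=> *; exists (x + h, y + k); split; [split|right|right].
  move: (cmod (_ + _)) (cmod (_ + _)) J1 J2 J3 J4.
  move: (cmod _) (cmod _) (cmod _) (cmod _) => *; lra.
have [[px py] pP] := quartering A0 B0 P0 step.
have [w [q [_ qw] FE]] : exists w, is_cderiv F (px +i* py) w.
  have [[x y] [[/= ax xb cy yd _] /andP[xp px'] /andP[yp py']]] := pP 0%N.
  by apply: dF; apply/andP; split; lra.
pose D := A + B + 1.
have D0 : 0 < D by rewrite /D; lra.
(* The bound [4 * (e * (D / 2 ^+ n)) * (D / 2 ^+ n)] of [boundary_small] is then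
   half of the lower bound [J / 4 ^ n] of the boundary integral. *)
pose e := J / (8 * D ^+ 2).
have e0 : 0 < e by rewrite divr_gt0 // mulr_gt0 // exprn_gt0.
have [eta eta0 qe] := qw _ e0.
have [n nP] : exists n, D / 2 ^+ n < eta.
  exists (Num.bound (D / eta)); rewrite ltr_pdivrMr // mulrC -ltr_pdivrMr //.
  exact: upper_nthrootP.
have [[x y] [[/= ax xb cy yd JP] /andP[xp px'] /andP[yp py']]] := pP n.
set h := A / 2 ^+ n in ax xb JP px'; set k := B / 2 ^+ n in cy yd JP py'.
have h0 : 0 <= h by rewrite divr_ge0 // ltW.
have k0 : 0 <= k by rewrite divr_ge0 // ltW.
have hkD : h + k <= D / 2 ^+ n by rewrite -mulrDl ler_pM2r ?invr_gt0 // /D lerDl.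
have xh : x <= x + h by rewrite lerDl.
have yk : y <= y + k by rewrite lerDl.
have sub : cderivable_on F x (x + h) y (y + k) by exact: cderivable_sub dF.
have small s t : x <= s <= x + h -> y <= t <= y + k ->
    cmod (F (s +i* t) - F (px +i* py) - w * ((s +i* t) - (px +i* py))) <=
    e * (D / 2 ^+ n).
  move=> /andP[xs sx] /andP[yt ty].
  set z := (s +i* t) - (px +i* py).
  have zD : cmod z <= D / 2 ^+ n.
    apply: le_trans hkD; apply: le_trans (cmod_le_ReIm _) _ => /=.
    apply: lerD; rewrite ler_norml lerBlDl lerBrDl.
      by apply/andP; split; [rewrite lerBlDr (le_trans px')|rewrite (le_trans sx)] ;
        rewrite ?lerD2r.
    by apply/andP; split; [rewrite lerBlDr (le_trans py')|rewrite (le_trans ty)] ;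
      rewrite ?lerD2r.
  have -> : s +i* t = (px +i* py) + z by rewrite /z subrKC.
  rewrite FE (_ : _ - _ - _ = (q z - w) * z); last by ring.
  rewrite cmodM ler_pM ?cmod_ge0 // ltW // qe //.
  exact: le_lt_trans nP.
have := boundary_small xh yk sub small.
rewrite ![_ + _ - _]addrC !addKr => bs.
have := le_trans JP bs.
have : 4 * (e * (D / 2 ^+ n)) * (h + k) <= 4 * (e * (D / 2 ^+ n)) * (D / 2 ^+ n).
  rewrite ler_pM2l //.
  by rewrite mulr_gt0 // mulr_gt0 // divr_gt0.
have -> : 4 * (e * (D / 2 ^+ n)) * (D / 2 ^+ n) = J / (2 ^+ n * 2 ^+ n) / 2.
  by rewrite /e; move: (pos n) => /lt0r_neq0; move: (2 ^+ n) => T T0; field; rewrite T0 gt_eqF.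
have : 0 < J / (2 ^+ n * 2 ^+ n) by rewrite divr_gt0 // mulr_gt0.
move=> K0 K1 K2; have := le_trans K2 K1; lra.
Qed.

End Goursat.

(** * The complex exponential and means over circles *)

Section Circle.
Context {R : realType}.

Definition cis (t : R) : R[i] := cos t +i* sin t.

Lemma cmod_cis t : cmod (cis t) = 1.
Proof. by rewrite cmodE /= cos2Dsin2 sqrtr1. Qed.

Lemma cisD s t : cis (s + t) = cis s * cis t.
Proof. by apply: complex_ext; rewrite ?cReM ?cImM /= ?cosD ?sinD //; ring. Qed.

Lemma cis0 : cis 0 = 1.
Proof. by apply: complex_ext; rewrite /= ?cos0 ?sin0. Qed.

Lemma cis2pi : cis (2 * pi) = 1.
Proof. by apply: complex_ext; rewrite /= mulr_natl ?cos2pi ?sin2pi. Qed.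

Definition cexp (z : R[i]) : R[i] := (expR (Re z))%:C * cis (Im z).

Lemma cexpD z w : cexp (z + w) = cexp z * cexp w.
Proof. by rewrite /cexp cReD cImD expRD cisD rmorphM /=; ring. Qed.

Lemma real_deriv_small (f : R -> R) x d : is_derive x (1 : R) f d ->
  forall e, 0 < e -> exists2 c, 0 < c &
    forall h, `|h| < c -> `|f (x + h) - f x - d * h| <= e * `|h|.
Proof.
move=> fd e e0.
have : (fun h : R => h^-1 *: (f (h + x) - f x)) @ 0^' --> d.
  have : cvg ((fun h : R => h^-1 *: (f (h *: 1 + x) - f x)) @ 0^').
    exact: (@ex_derive _ _ _ _ _ _ _ fd).
  have -> : (fun h : R => h^-1 *: (f (h + x) - f x)) =
    (fun h : R => h^-1 *: (f (h *: 1 + x) - f x)).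
    by apply/funext => h; rewrite /GRing.scale /= mulr1.
  by rewrite -(@derive_val _ _ _ _ _ _ _ fd).
move=> /cvgrPdist_lt /(_ _ e0) /nbhs_ballP[c /= c0 H].
exists c => // h hc.
have [->|h0] := eqVneq h 0.
  by rewrite addr0 subrr mulr0 subr0 normr0 mulr0.
have := H h; rewrite /ball /= sub0r normrN => /(_ hc h0).
rewrite /GRing.scale /= => /ltW.
rewrite -(ler_pM2r (_ : 0 < `|h|)) ?normr_gt0 // -normrM.
rewrite (_ : (_ - _) * h = - (f (x + h) - f x - d * h)) ?normrN //.
by rewrite [h + x]addrC; field.
Qed.

(** By the addition formula it is enough to differentiate at [0], where the
    expansions of order one of [expR], [cos] and [sin] are available. *)
Lemma cderiv_cexp z : is_cderiv cexp z (cexp z).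
Proof.
pose q h := if h == 0 then 1 else (cexp h - 1) / h.
have c0 : cexp 0 = 1 by rewrite /cexp /= expR0 cis0 mulr1.
exists (fun h => cexp z * q h); last first.
  move=> h; rewrite cexpD /q; case: eqVneq => [->|h0]; first by rewrite c0; ring.
  by field.
rewrite /q eqxx mulr1; split => //.
rewrite -[X in tends _ _ X]mulr1; apply: tendsM; first exact: tends_cst.
move=> e e0.
have [s e40 [s1 se]] : exists2 s, 0 < s & s <= 1 /\ s <= e / 16.
  exists (Num.min 1 (e / 16)); first by rewrite lt_min ltr01 divr_gt0.
  by rewrite !ge_min !lexx orbT.
have [d1 d10 H1] := real_deriv_small (is_derive_expR (0 : R)) e40.
have [d2 d20 H2] := real_deriv_small (is_derive_sin (0 : R)) e40.
have [d3 d30 H3] := real_deriv_small (is_derive_cos (0 : R)) e40.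
pose d := Num.min (Num.min d1 d2) (Num.min d3 s).
have d0 : 0 < d by rewrite !lt_min d10 d20 d30 e40.
exists d => // h; rewrite !lt_min => /andP[/andP[hd1 hd2] /andP[hd3 hs]].
case: eqVneq => [_|h0]; first by rewrite subrr cmod0.
have x1 := le_lt_trans (cmod_Re h) hd1; have xs := le_lt_trans (cmod_Re h) hs.
have y2 := le_lt_trans (cmod_Im h) hd2; have y3 := le_lt_trans (cmod_Im h) hd3.
have ys := le_lt_trans (cmod_Im h) hs.
move: (H1 _ x1) (H2 _ y2) (H3 _ y3).
rewrite !add0r expR0 sin0 cos0 oppr0 mul0r !mul1r !subr0.
have -> : (cexp h - 1) / h - 1 = (cexp h - 1 - h) / h by field.
rewrite cmodM cmodV ltr_pdivrMr ?cmod_gt0 //.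
have xN := cmod_Re h; have yN := cmod_Im h.
have N0 : 0 < cmod h by rewrite cmod_gt0.
have := cmod_le_ReIm (cexp h - 1 - h).
rewrite !cReD !cImD !raddfN /= !(mul0r, subr0, addr0, oppr0).
case: h h0 hd1 hd2 hd3 hs x1 y2 y3 xs ys xN yN N0 => x y /= _ _ _ _ _ _ _ _.
move: (cmod (x +i* y)) (cmod _) (expR x) (sin y) (cos y) => N' N E S C.
move=> xs ys xN yN N0 le H4 H5 H6; apply: le_lt_trans le _.
have -> : E * C - 1 - x = (E - 1 - x) * C + (1 + x) * (C - 1) by ring.
have -> : E * S - y = (E - 1) * S + (S - y) by ring.
have s0 := ltW e40; have x0 := normr_ge0 x; have y0 := normr_ge0 y.
have x1 : `|x| <= 1 by lra.
have y1 : `|y| <= 1 by lra.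
have sx : s * `|x| <= `|x| by rewrite ler_piMl.
have sy : s * `|y| <= `|y| by rewrite ler_piMl.
have sxN : s * `|x| <= s * N by rewrite ler_wpM2l.
have syN : s * `|y| <= s * N by rewrite ler_wpM2l.
have C2 : `|C| <= 2.
  have -> : C = (C - 1) + 1 by ring.
  by rewrite (le_trans (ler_normD _ _)) // normr1; lra.
have x2 : `|1 + x| <= 2 by rewrite (le_trans (ler_normD _ _)) // normr1; lra.
have E2 : `|E - 1| <= 2 * s.
  have -> : E - 1 = (E - 1 - x) + x by ring.
  by rewrite (le_trans (ler_normD _ _)) //; lra.
have S2 : `|S| <= 2 * N.
  have -> : S = (S - y) + y by ring.
  by rewrite (le_trans (ler_normD _ _)) //; lra.
have := ler_normD ((E - 1 - x) * C) ((1 + x) * (C - 1)).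
have := ler_normD ((E - 1) * S) (S - y).
rewrite !normrM.
have : `|E - 1 - x| * `|C| <= s * N * 2 by rewrite ler_pM //; lra.
have : `|1 + x| * `|C - 1| <= 2 * (s * N) by rewrite ler_pM //; lra.
have : `|E - 1| * `|S| <= 2 * s * (2 * N) by rewrite ler_pM.
have : `|S - y| <= s * N by lra.
have : s * N <= e / 16 * N by rewrite ler_pM2r.
have : 0 < e * N by rewrite mulr_gt0.
move: (`|_ + _|) (`|_ + _|) => u v; lra.
Qed.

Lemma cexp_ln r t : 0 < r -> cexp (ln r +i* t) = r%:C * cis t.
Proof. by move=> r0; rewrite /cexp /= lnK. Qed.

Definition circ (r t : R) : R[i] := r%:C * cis t.

Lemma cmod_circ r t : 0 <= r -> cmod (circ r t) = r.
Proof. by move=> r0; rewrite /circ cmodM cmod_cis mulr1 cmod_real ger0_norm. Qed.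

Lemma rcont_cis t : rcont cis t.
Proof.
have -> : cis = (fun s : R => cexp (0 +i* s)).
  by apply/funext => s; rewrite /cexp /= expR0 mul1r.
exact: rcont_comp (cderiv_cont (cderiv_cexp _)) (rcont_vline _ _).
Qed.

Lemma rcont_circ r t : rcont (circ r) t.
Proof. exact: tendsM (@tends_cst _ _ _ _) (rcont_cis t). Qed.

Definition on_circle := cont_on (0 : R) (2 * pi).

Lemma pi2_gt0 : 0 < 2 * pi :> R.
Proof. by rewrite mulr_gt0 // pi_gt0. Qed.

Definition avg (g : R -> R[i]) : R[i] := ((2 * pi)^-1)%:C * cint 0 (2 * pi) g.

Lemma eq_avg f g : (forall t, f t = g t) -> avg f = avg g.
Proof. by move=> /funext ->. Qed.

Lemma avg_cst z : avg (fun _ => z) = z.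
Proof.
rewrite /avg cint_cst ?(ltW pi2_gt0) // subr0 mulrA -rmorphM mulVf ?mul1r //.
by rewrite gt_eqF // pi2_gt0.
Qed.

Lemma avgD f g : on_circle f -> on_circle g ->
  avg (fun t => f t + g t) = avg f + avg g.
Proof. by move=> cf cg; rewrite /avg cintD // mulrDr. Qed.

Lemma avgB f g : on_circle f -> on_circle g ->
  avg (fun t => f t - g t) = avg f - avg g.
Proof. by move=> cf cg; rewrite /avg cintB // mulrBr. Qed.

Lemma avgM z g : on_circle g -> avg (fun t => z * g t) = z * avg g.
Proof. by move=> cg; rewrite /avg cintM // mulrCA. Qed.

Lemma avg_conj g : on_circle g -> avg (fun t => (g t)^*) = (avg g)^*.
Proof. by move=> cg; rewrite /avg cint_conj // rmorphM /= oppr0. Qed.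

Lemma avg_sum (f : nat -> R -> R[i]) n : (forall k, on_circle (f k)) ->
  avg (fun t => \sum_(k < n) f k t) = \sum_(k < n) avg (f k).
Proof. by move=> cf; rewrite /avg cint_sum => [|k _]; [rewrite mulr_sumr|exact: cf]. Qed.

Lemma le_avg_Re f g : on_circle f -> on_circle g ->
  (forall t, Re (f t) <= Re (g t)) -> Re (avg f) <= Re (avg g).
Proof.
move=> cf cg fg; rewrite /avg !cReM !cIm_real !mul0r !subr0 !cRe_real.
by rewrite ler_wpM2l ?invr_ge0 ?(ltW pi2_gt0) //; apply: le_cint_Re.
Qed.

Lemma cmod_avg g M : on_circle g ->
  (forall t, 0 <= t <= 2 * pi -> cmod (g t) <= M) ->
  cmod (avg g) <= 2 * M.
Proof.
move=> cg gM; rewrite /avg cmodM cmod_real ger0_norm ?invr_ge0 ?(ltW pi2_gt0) //.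
rewrite mulrC ler_pdivrMr ?pi2_gt0 //.
have := @cmod_cint _ 0 (2 * pi) g M (ltW pi2_gt0) cg gM.
by rewrite subr0.
Qed.

Lemma circ_cont G r : (forall z, cmod z = r -> ccont G z) -> 0 <= r ->
  on_circle (fun t => G (circ r t)).
Proof.
move=> cG r0 t _; apply: rcont_comp (rcont_circ r t).
by apply: cG; rewrite cmod_circ.
Qed.

(** In the coordinate [log z] the annulus becomes a rectangle of height [2 * pi]
    and the integrals over its two horizontal sides cancel by periodicity:
    Goursat's theorem compares the two vertical sides. *)
Lemma circle_mean_const G r0 r1 : 0 < r0 -> r0 <= r1 ->
  (forall z, r0 <= cmod z <= r1 -> exists w, is_cderiv G z w) ->
  avg (fun t => G (circ r0 t)) = avg (fun t => G (circ r1 t)).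
Proof.
move=> r00 r01 dG; have r10 := lt_le_trans r00 r01.
pose F z := G (cexp z).
have dF : cderivable_on F (ln r0) (ln r1) 0 (2 * pi).
  move=> s t /andP[s0 s1] _.
  have [|w Gw] := dG (cexp (s +i* t)).
    rewrite /cexp cmodM cmod_cis mulr1 cmod_real /= ger0_norm ?expR_ge0 //.
    by rewrite -{1}(lnK r00) -{1}(lnK r10) !ler_expR s0.
  by exists (w * cexp (s +i* t)); apply: cderiv_comp Gw (cderiv_cexp _).
have l01 : ln r0 <= ln r1 by rewrite ler_ln.
have := goursat l01 (ltW pi2_gt0) dF; rewrite /boundary_integral.
have -> : cint (ln r0) (ln r1) (fun s => F (s +i* 0) - F (s +i* (2 * pi))) = 0.
  rewrite (@eq_cint _ _ _ _ (fun _ => 0)) ?cint_cst ?mulr0 // => s _.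
  by rewrite /F /cexp /= cis0 cis2pi subrr.
rewrite add0r => /eqP; rewrite mulf_eq0 -cmod_eq0 cmod_i oner_eq0 /=.
rewrite cintB; [|apply: cont_vline dF _; rewrite lexx l01 // ..].
rewrite subr_eq0 => /eqP; rewrite /F => E.
rewrite /avg; congr (_ * _).
have circE r : 0 < r -> (fun t => G (circ r t)) = (fun t => G (cexp (ln r +i* t))).
  by move=> r_gt0; apply/funext => t; rewrite cexp_ln.
by rewrite (circE _ r00) (circE _ r10).
Qed.

End Circle.

(** * Cauchy's formula *)

Section Cauchy.
Context {R : realType}.

(** Compactness of [[0, 2 * pi]]. *)
Lemma circle_uniform G (r e : R) : 0 <= r ->
  (forall z, cmod z = r -> ccont G z) -> 0 < e ->
  exists2 d, 0 < d & forall rho, `|rho - r| < d -> forall t, 0 <= t <= 2 * pi ->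
    cmod (G (circ rho t) - G (circ r t)) < e.
Proof.
move=> r0 cG e0.
have cpt := @segment_compact R 0 (2 * pi).
pose P (rho t : R) := cmod (G (circ rho t) - G (circ r t)) < e.
have loc t : `[0, 2 * pi]%classic t -> \forall t' \near t & rho \near nbhs r, P rho t'.
  move=> _; rewrite /P.
  have [d1 d10 H1] := cG (circ r t) (cmod_circ t r0) _ (divr_gt0 e0 (ltr0n _ 2)).
  have r10 : 0 < 2 * (r + 1) by lra.
  have [d2 d20 H2] := rcont_cis t (divr_gt0 d10 r10).
  have close t' rho : `|t - t'| < d2 -> `|r - rho| < d1 / 2 ->
      cmod (G (circ rho t') - G (circ r t)) < e / 2.
    move=> tt' rr.
    have {}H2 := H2 (t' - t); rewrite subrKC distrC in H2.
    have -> : circ rho t' = circ r t + (circ rho t' - circ r t) by rewrite subrKC.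
    apply: H1.
    have -> : circ rho t' - circ r t = (rho - r)%:C * cis t' + r%:C * (cis t' - cis t).
      by rewrite /circ rmorphB /=; ring.
    apply: le_lt_trans (cmodD _ _) _.
    rewrite !cmodM cmod_cis mulr1 !cmod_real distrC (ger0_norm r0).
    have := H2 tt'; rewrite ltr_pdivlMr //.
    have := cmod_ge0 (cis t' - cis t).
    by move: (cmod _) => x; nra.
  exists (ball t d2, ball r (d1 / 2)) => /=.
    by split; apply: nbhsx_ballx => //; rewrite divr_gt0.
  case=> t' rho /= [tt' rr].
  have A := close t' rho tt' rr.
  have B : cmod (G (circ r t') - G (circ r t)) < e / 2.
    by apply: close => //; rewrite subrr normr0 divr_gt0.
  have -> : G (circ rho t') - G (circ r t') =
    (G (circ rho t') - G (circ r t)) - (G (circ r t') - G (circ r t)) by ring.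
  by apply: le_lt_trans (cmodB _ _) _; lra.
have : \forall rho \near nbhs r, `[0, 2 * pi]%classic `<=` P rho.
  exact: (compact_near_coveringP _).1 cpt R (nbhs r) P _ loc.
move=> /(@nbhs_ballP R R)[d /= d0 H].
exists d => // rho rr t tP; apply: (H rho); first by rewrite /ball /= distrC.
by rewrite /= in_itv.
Qed.


Lemma cmod_small_eq0 (x : R[i]) : (forall e, 0 < e -> cmod x <= e) -> x = 0.
Proof.
move=> H; apply/eqP; rewrite -cmod_eq0 eq_le cmod_ge0 andbT.
by apply/ler_addgt0Pr => e e0; rewrite add0r; exact: H.
Qed.

Lemma circle_mean_near G (r e : R) : 0 <= r ->
  (forall z, cmod z = r -> ccont G z) -> 0 < e ->
  exists2 d, 0 < d & forall rho, 0 <= rho -> `|rho - r| < d ->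
    (forall z, cmod z = rho -> ccont G z) ->
    cmod (avg (fun t => G (circ rho t)) - avg (fun t => G (circ r t))) <= e.
Proof.
move=> r0 cG e0; have [d d0 H] := circle_uniform r0 cG (divr_gt0 e0 (ltr0n _ 2)).
exists d => // rho rho0 rr cGrho.
have c1 := circ_cont cGrho rho0; have c2 := circ_cont cG r0.
have c12 : on_circle (fun t => G (circ rho t) - G (circ r t)) by exact: cont_onB.
rewrite -avgB // /avg cmodM cmod_real ger0_norm ?invr_ge0 ?(ltW pi2_gt0) //.
rewrite mulrC ler_pdivrMr ?pi2_gt0 //.
have b t : 0 <= t <= 2 * pi -> cmod (G (circ rho t) - G (circ r t)) <= e / 2.
  by move=> tP; exact/ltW/H.
have := cmod_cint (ltW pi2_gt0) c12 b; rewrite subr0.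
by rewrite [2 * (e / 2)]mulrC divfK.
Qed.

(** At the inner radius [a] differentiability is replaced by continuity: the
    mean is constant for larger radii and its limit at [a] is the mean
    over the circle of radius [a]. *)
Lemma circle_mean_end G (a b : R) : 0 <= a -> a < b ->
  (forall z, a <= cmod z <= b -> ccont G z) ->
  (forall z, a < cmod z <= b -> exists w, is_cderiv G z w) ->
  avg (fun t => G (circ b t)) = avg (fun t => G (circ a t)).
Proof.
move=> a0 ab cG dG; apply/eqP; rewrite -subr_eq0; apply/eqP.
apply: cmod_small_eq0 => e e0.
have cGa z : cmod z = a -> ccont G z by move=> za; apply: cG; rewrite za lexx ltW.
have [d d0 H] := circle_mean_near a0 cGa e0.
pose rho := Num.min b (a + d / 2).
have [ar rb rd] : [/\ a < rho, rho <= b & rho <= a + d / 2].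
  by rewrite /rho; split; rewrite ?lt_min ?ge_min ?lexx ?orbT ?ab //=; lra.
have rho0 : 0 < rho by exact: le_lt_trans ar.
rewrite -(circle_mean_const rho0 rb); last first.
  by move=> z /andP[rz zb]; apply: dG; rewrite zb (lt_le_trans ar).
apply: H; first exact: ltW.
  by rewrite ger0_norm; lra.
by move=> z zr; apply: cG; rewrite zr rb ltW.
Qed.

Lemma circle_mean_const_left G (a b : R) : 0 < a -> a < b ->
  (forall z, a <= cmod z <= b -> ccont G z) ->
  (forall z, a <= cmod z < b -> exists w, is_cderiv G z w) ->
  avg (fun t => G (circ b t)) = avg (fun t => G (circ a t)).
Proof.
move=> a0 ab cG dG; apply/eqP; rewrite -subr_eq0; apply/eqP.
apply: cmod_small_eq0 => e e0.
have b0 : 0 <= b by lra.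
have cGb z : cmod z = b -> ccont G z by move=> zb; apply: cG; rewrite zb lexx ltW.
have [d d0 H] := circle_mean_near b0 cGb e0.
pose rho := Num.max a (b - d / 2).
have [ar rb rd] : [/\ a <= rho, rho < b & b - d / 2 <= rho].
  by rewrite /rho; split; rewrite ?gt_max ?le_max ?lexx ?orbT ?ab //=; lra.
rewrite (circle_mean_const a0 ar); last first.
  by move=> z /andP[az zr]; apply: dG; rewrite az (le_lt_trans zr).
rewrite cmodBC; apply: H; first by lra.
  by rewrite ltr0_norm; lra.
by move=> z zr; apply: cG; rewrite zr ar ltW.
Qed.

(** The mean is constant in the radius on either side of [cmod p], and it is
    continuous in the radius at [cmod p] and at [0]. *)
Lemma circle_mean_center G (p : R[i]) (r : R) : 0 < r -> cmod p < r ->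
  (forall z, cmod z <= r -> ccont G z) ->
  (forall z, z != p -> cmod z <= r -> exists w, is_cderiv G z w) ->
  avg (fun t => G (circ r t)) = G 0.
Proof.
move=> r0 pr cG dG.
have -> : G 0 = avg (fun t => G (circ 0 t)).
  by under eq_fun do rewrite /circ mul0r; rewrite avg_cst.
have outer : avg (fun t => G (circ r t)) = avg (fun t => G (circ (cmod p) t)).
  apply: circle_mean_end => //; first exact: cmod_ge0.
    by move=> z /andP[_]; exact: cG.
  move=> z /andP[pz zr]; apply: dG => //.
  by apply: contraTneq pz => ->; rewrite ltxx.
rewrite outer; have [->|p0] := eqVneq (cmod p) 0; first by [].
have {}p0 : 0 < cmod p by rewrite lt_def p0 cmod_ge0.
have c20 : 0 < cmod p / 2 by rewrite divr_gt0.
rewrite (@circle_mean_const_left G (cmod p / 2)) //; first last.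
- move=> z /andP[_ zp]; apply: dG; last by exact/ltW/(lt_trans zp).
  by apply: contraTneq zp => ->; rewrite ltxx.
- by move=> z /andP[_ zp]; apply: cG; exact/ltW/(le_lt_trans zp).
- by rewrite ltr_pdivrMr //; lra.
apply: circle_mean_end => //.
  by move=> z /andP[_ zp]; apply: cG; lra.
move=> z /andP[_ zp]; apply: dG; last by lra.
by apply: contraTneq zp => ->; rewrite -ltNge; lra.
Qed.

(** The mean does not depend on the radius beyond [cmod z], and it tends to [1]
    as the radius grows. *)
Lemma avg_cauchy_kernel (r : R) z : cmod z < r ->
  avg (fun t => circ r t / (circ r t - z)) = 1.
Proof.
move=> zr; have z0 := cmod_ge0 z; have r0 : 0 < r by exact: le_lt_trans zr.
have dK rho w : cmod z < rho -> cmod w = rho ->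
    exists d, is_cderiv (fun w => w / (w - z)) w d.
  move=> zrho wr; eexists; apply: cderivM (cderiv_id _) _.
  apply: (@cderiv_comp _ (fun w => w^-1) (fun w => w - z)).
    apply: cderivV; rewrite subr_eq0; apply: contraTneq zrho => <-.
    by rewrite wr ltxx.
  exact: cderivB (cderiv_id _) (cderiv_cst _ _).
apply/eqP; rewrite -subr_eq0; apply/eqP; apply: cmod_small_eq0 => e e0.
pose rho := r + 2 * cmod z / e.
have rr : r <= rho by rewrite lerDl divr_ge0 // ?mulr_ge0 // ltW.
rewrite (@circle_mean_const _ (fun w => w / (w - z)) r rho) //; last first.
  by move=> w /andP[rw _]; apply: dK (erefl _); exact: lt_le_trans rw.
have zrho : cmod z < rho by exact: lt_le_trans rr.
have rho0 : 0 <= rho by lra.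
have cK : on_circle (fun t => circ rho t / (circ rho t - z)).
  apply: circ_cont (fun w => w / (w - z)) _ _ rho0 => w wr.
  by have [d /cderiv_cont] := dK rho w zrho wr.
rewrite -[X in _ - X](avg_cst 1) -avgB //; last exact: cont_on_cst.
have -> : e = 2 * (e / 2) by rewrite mulrC divfK.
apply: cmod_avg; first by apply: cont_onB => //; exact: cont_on_cst.
move=> t _.
have d0 : rho - cmod z <= cmod (circ rho t - z).
  by have := cmodBl (circ rho t) z; rewrite cmod_circ.
have nz : circ rho t - z != 0 by rewrite -cmod_gt0; lra.
rewrite (_ : _ - 1 = z / (circ rho t - z)); last by field.
rewrite cmodM cmodV ler_pdivrMr ?cmod_gt0 //.
apply: le_trans (_ : e / 2 * (rho - cmod z) <= _); last by rewrite ler_pM2l // divr_gt0.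
have -> : e / 2 * (rho - cmod z) = cmod z + e / 2 * (r - cmod z).
  by rewrite /rho; field; exact: lt0r_neq0.
by rewrite lerDl mulr_ge0 //; lra.
Qed.

Definition hol (f : R[i] -> R[i]) := forall z, cmod z < 1 -> exists d, is_cderiv f z d.

Lemma hol_cont f z : hol f -> cmod z < 1 -> ccont f z.
Proof. by move=> fh /fh[d /cderiv_cont]. Qed.

Lemma hol_on_circle f (r : R) : hol f -> 0 <= r < 1 -> on_circle (fun t => f (circ r t)).
Proof.
move=> fh /andP[r0 r1]; apply: circ_cont r0 => z zr.
by apply: hol_cont => //; rewrite zr.
Qed.

Lemma circ_sub_neq0 (r : R) z t : cmod z < r -> circ r t - z != 0.
Proof.
move=> zr; have r0 : 0 <= r by have := cmod_ge0 z; lra.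
by rewrite subr_eq0; apply: contraTneq zr => <-; rewrite cmod_circ // ltxx.
Qed.

Lemma on_circle_circ (r : R) : on_circle (circ r).
Proof. by move=> t _; exact: rcont_circ. Qed.

Lemma on_circle_kernel (r : R) z : cmod z < r -> on_circle (fun t => (circ r t - z)^-1).
Proof.
move=> zr t _; apply: tendsV; first exact: circ_sub_neq0.
apply: tendsB; last exact: tends_cst.
exact: rcont_circ.
Qed.

(** Apply [circle_mean_center] to [x * (f x - f z) / (x - z)]: it vanishes at [0]
    and is continuous at its exceptional point [z]. *)
Theorem cauchy_formula f (r : R) z : hol f -> r < 1 -> cmod z < r ->
  avg (fun t => f (circ r t) * circ r t / (circ r t - z)) = f z.
Proof.
move=> fh r1 zr; have z0 := cmod_ge0 z.
have r0 : 0 < r by lra.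
have r01 : 0 <= r < 1 by rewrite r1 ltW.
have [w [q [q0 qw] fE]] := fh z (lt_trans zr r1).
pose G x := if x == z then z * w else x * (f x - f z) / (x - z).
have GE h : G (z + h) = (z + h) * q h.
  rewrite /G -subr_eq0 addrC addKr; case: eqVneq => [->|h0].
    by rewrite addr0 q0.
  by rewrite fE; field.
have cGz : ccont G z.
  rewrite /ccont (_ : G z = z * w); last by rewrite /G eqxx.
  apply: (@tends_eq _ _ _ (fun h => (z + h) * q h)) => [h|]; first by rewrite GE.
  apply: tendsM qw; rewrite -[X in tends _ _ X](addr0 z).
  exact: tendsD (@tends_cst _ _ _ _) tends_id.
have dG x : x != z -> cmod x <= r -> exists d, is_cderiv G x d.
  move=> xz xr; have [d fx] := fh x (le_lt_trans xr r1).
  have xz0 : 0 < cmod (x - z) by rewrite cmod_gt0 subr_eq0.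
  eexists; apply: (@cderiv_near _ (fun x => x * (f x - f z) * (x - z)^-1) _ _ _ _ xz0).
    move=> h hx; rewrite /G; case: eqP => [xhz|//].
    by move: hx; rewrite -xhz opprD addNKr cmodN ltxx.
  apply: cderivM.
    by apply: cderivM (cderiv_id _) (cderivB fx (cderiv_cst _ _)).
  apply: (@cderiv_comp _ (fun w => w^-1) (fun w => w - z)).
    by apply: cderivV; rewrite subr_eq0.
  exact: cderivB (cderiv_id _) (cderiv_cst _ _).
have cG x : cmod x <= r -> ccont G x.
  move=> xr; have [->//|xz] := eqVneq x z.
  by have [d /cderiv_cont] := dG x xz xr.
have G0 : G 0 = 0.
  by rewrite /G; case: eqVneq => [<-|_]; rewrite ?mul0r.
have := circle_mean_center r0 zr cG dG; rewrite G0.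
have -> : (fun t => G (circ r t)) = (fun t =>
    f (circ r t) * circ r t / (circ r t - z) - f z * (circ r t / (circ r t - z))).
  apply/funext => t; rewrite /G -subr_eq0 (negPf (circ_sub_neq0 t zr)); ring.
have cf := hol_on_circle fh r01.
have ck : on_circle (fun t => circ r t / (circ r t - z)).
  exact: cont_onM (on_circle_circ r) (on_circle_kernel zr).
rewrite avgB.
- by rewrite avgM // avg_cauchy_kernel // mulr1 => /eqP; rewrite subr_eq0 => /eqP.
- apply: cont_onM (on_circle_kernel zr).
  exact: cont_onM cf (on_circle_circ r).
- exact: cont_onM (@cont_on_cst _ _ _ _) ck.
Qed.

End Cauchy.

(** * Taylor coefficients *)

Section Taylor.
Context {R : realType}.

Lemma cont_on_bounded (a b : R) g : a <= b -> cont_on a b g ->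
  exists2 M : R, 0 <= M & forall t, a <= t <= b -> cmod (g t) <= M.
Proof.
move=> ab cg.
have cc : {within `[a, b]%classic, continuous (fun t => cmod (g t))}.
  apply: continuous_in_subspaceT => t; rewrite inE /= in_itv /= => tP.
  apply/cvgrPdist_lt => e e0; have [d d0 H] := cg t tP e e0.
  apply/nbhs_ballP; exists d => //= s; rewrite /ball /= => ts.
  have := H (s - t); rewrite distrC subrKC => /(_ ts).
  apply: le_lt_trans; rewrite ler_norml; apply/andP; split.
    rewrite lerNl opprB; exact: cmodBl.
  by rewrite cmodBC; exact: cmodBl.
have [c _ cP] := EVT_max ab cc.
exists (cmod (g c)) => [|t tP]; first exact: cmod_ge0.
by apply: cP; rewrite in_itv.
Qed.

Lemma on_circle_bounded g : on_circle g ->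
  exists2 M : R, 0 <= M & forall t, 0 <= t <= 2 * pi -> cmod (g t) <= M.
Proof. exact: cont_on_bounded (ltW (pi2_gt0)). Qed.

(** The polynomial [(p ^+ k - s ^+ k) / (p - s)]. *)
Fixpoint powerq k (p s : R[i]) : R[i] :=
  if k is j.+1 then p * powerq j p s + s ^+ j else 0.

Lemma powerqE k p s : p ^+ k - s ^+ k = (p - s) * powerq k p s.
Proof.
elim: k => [|k IH] /=; first by rewrite !expr0 subrr mulr0.
by rewrite mulrDr mulrCA -IH !exprS; ring.
Qed.

Lemma powerqxx k s : s * powerq k s s = k%:R * s ^+ k.
Proof.
elim: k => [|k IH] /=; first by rewrite mulr0 mul0r.
by rewrite mulrDr IH exprS -natr1; ring.
Qed.

Lemma powerq_bound k (B : R) : 0 <= B ->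
  exists2 K, 0 <= K & forall s, cmod s <= B -> cmod (powerq k s s) <= K.
Proof.
move=> B0; elim: k => [|k [K K0 IH]] /=.
  by exists 0 => // s _; rewrite cmod0.
exists (B * K + B ^+ k); first by rewrite addr_ge0 ?mulr_ge0 ?exprn_ge0.
move=> s sB; apply: le_trans (cmodD _ _) _; rewrite cmodM cmodX lerD //.
  by rewrite ler_pM ?cmod_ge0 // IH.
by rewrite lerXn2r ?nnegrE ?cmod_ge0.
Qed.

Lemma powerq_lip k (B : R) : 0 <= B ->
  exists2 K, 0 <= K & forall p s, cmod p <= B -> cmod s <= B ->
    cmod (powerq k p s - powerq k s s) <= K * cmod (p - s).
Proof.
move=> B0; elim: k => [|k [K K0 IH]] /=.
  by exists 0 => // p s _ _; rewrite subrr cmod0 mul0r.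
have [L L0 LP] := powerq_bound k B0.
exists (B * K + L); first by rewrite addr_ge0 ?mulr_ge0.
move=> p s pB sB.
rewrite (_ : _ - _ = p * (powerq k p s - powerq k s s) + (p - s) * powerq k s s);
  last by ring.
apply: le_trans (cmodD _ _) _; rewrite !cmodM mulrDl lerD //.
  by rewrite -mulrA ler_pM ?cmod_ge0 // IH.
by rewrite mulrC ler_wpM2r ?cmod_ge0 // LP.
Qed.

Lemma cont_on_exp (a b : R) g k : cont_on a b g -> cont_on a b (fun t => g t ^+ k).
Proof.
move=> cg; elim: k => [|k IH].
  by under eq_fun do rewrite expr0; exact: cont_on_cst.
by under eq_fun do rewrite exprS; exact: cont_onM.
Qed.

Lemma cont_on_powerq (a b : R) f g k : cont_on a b f -> cont_on a b g ->
  cont_on a b (fun t => powerq k (f t) (g t)).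
Proof.
move=> cf cg; elim: k => [|k IH] /=; first exact: cont_on_cst.
by apply: cont_onD; [exact: cont_onM|exact: cont_on_exp].
Qed.

Lemma cderiv_intro f q z w (d : R) : 0 < d -> q 0 = w -> tends (@cmod R) q w ->
  (forall h, cmod h < d -> f (z + h) = f z + q h * h) -> is_cderiv f z w.
Proof.
move=> d0 q0 qw fE.
have zh h : z + h - z = h by rewrite addrC addKr.
apply: (@cderiv_near _ (fun x => f z + q (x - z) * (x - z)) _ _ _ _ d0).
  by move=> h hd; rewrite fE // zh.
exists q => // h.
by rewrite zh subrr mulr0 addr0.
Qed.

(** The difference quotients of the kernel converge uniformly on the circle,
    which allows to differentiate under the integral sign. *)
Lemma cderiv_kernel phi k (r : R) z : on_circle phi -> cmod z < r ->
  is_cderiv (fun z => avg (fun t => phi t * (circ r t - z)^-1 ^+ k)) z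
    (k%:R * avg (fun t => phi t * (circ r t - z)^-1 ^+ k.+1)).
Proof.
move=> cphi zr.
pose d := (r - cmod z) / 2; have d0 : 0 < d by rewrite divr_gt0 // subr_gt0.
have dE : r - cmod z = d + d by rewrite /d; field.
pose s h t := (circ r t - (z + h))^-1.
have zh h : cmod h < d -> cmod (z + h) < r.
  by move=> hd; apply: le_lt_trans (cmodD _ _) _; lra.
have cs h : cmod h < d -> on_circle (s h).
  by move=> hd; apply: on_circle_kernel; exact: zh.
have h0d : cmod (0 : R[i]) < d by rewrite cmod0.
have sz t : s 0 t = (circ r t - z)^-1 by rewrite /s addr0.
have sd h t : cmod h < d -> s h t - s 0 t = h * (s h t * s 0 t).
  move=> hd; rewrite /s addr0.
  by field; rewrite circ_sub_neq0 // circ_sub_neq0 // zh.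
pose B := d^-1; have B0 : 0 <= B by rewrite invr_ge0 ltW.
have r0 : 0 <= r by have := cmod_ge0 z; lra.
have sB h t : cmod h < d -> cmod (s h t) <= B.
  move=> hd; rewrite /s cmodV lef_pV2 ?posrE //; last first.
    by rewrite cmod_gt0 circ_sub_neq0 // zh.
  have := cmodBl (circ r t) (z + h); rewrite cmod_circ //.
  by have := cmodD z h; lra.
pose w h t := s h t * s 0 t * powerq k (s h t) (s 0 t).
have cw h : cmod h < d -> on_circle (w h).
  move=> hd; apply: cont_onM; last by apply: cont_on_powerq; exact: cs.
  by apply: cont_onM; exact: cs.
have wk t : w 0 t = k%:R * s 0 t ^+ k.+1.
  by rewrite /w -mulrA powerqxx exprS mulrCA.
apply: (@cderiv_intro _ (fun h => avg (fun t => phi t * w h t)) _ _ d) => //.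
- rewrite -avgM; last by apply: cont_onM => //; under eq_fun do rewrite -sz; exact/cont_on_exp/cs.
  by apply: eq_avg => t; rewrite wk sz mulrCA.
- rewrite -avgM; last by apply: cont_onM => //; under eq_fun do rewrite -sz; exact/cont_on_exp/cs.
  have -> : avg (fun t => k%:R * (phi t * (circ r t - z)^-1 ^+ k.+1)) =
      avg (fun t => phi t * w 0 t).
    by apply: eq_avg => t; rewrite wk sz mulrCA.
  have [M M0 phiM] := on_circle_bounded cphi.
  have [K K0 KP] := powerq_lip k B0; have [L L0 LP] := powerq_bound k B0.
  pose T := M * (B * (B ^+ 2 * L + B * (K * B ^+ 2))) * 2 + 1.
  have T0 : 0 < T.
    by rewrite ltr_wpDl // !mulr_ge0 // addr_ge0 // !mulr_ge0 // exprn_ge0.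
  move=> e e0; exists (Num.min d (e / T)); first by rewrite lt_min d0 divr_gt0.
  move=> h; rewrite lt_min => /andP[hd]; rewrite ltr_pdivlMr // => he.
  have cpw h' : cmod h' < d -> on_circle (fun t => phi t * w h' t).
    by move=> h'd; apply: cont_onM => //; exact: cw.
  rewrite -avgB; [|exact: cpw|exact: cpw].
  pose N := M * (B * (B ^+ 2 * L + B * (K * B ^+ 2))) * cmod h.
  apply: le_lt_trans (_ : 2 * N < e); last first.
    apply: le_lt_trans he; rewrite /T /N; move: (M * _) (cmod_ge0 h) => X h0'.
    by rewrite (_ : cmod h * _ = 2 * (X * cmod h) + cmod h) ?lerDl //; ring.
  apply: cmod_avg; first by apply: cont_onB; exact: cpw.
  move=> t tP; rewrite -mulrBr cmodM /N -!mulrA ler_pM ?cmod_ge0 ?phiM //.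
  rewrite (_ : w h t - w 0 t = s 0 t * ((s h t - s 0 t) * powerq k (s 0 t) (s 0 t)
    + s h t * (powerq k (s h t) (s 0 t) - powerq k (s 0 t) (s 0 t)))); last first.
    by rewrite /w; ring.
  have dB : cmod (s h t - s 0 t) <= B ^+ 2 * cmod h.
    rewrite sd // cmodM mulrC ler_wpM2r ?cmod_ge0 // cmodM expr2.
    by rewrite ler_pM ?cmod_ge0 ?sB.
  rewrite cmodM ler_pM ?cmod_ge0 ?sB //.
  apply: le_trans (cmodD _ _) _; rewrite !cmodM mulrDl lerD //.
    rewrite (_ : _ * cmod h = B ^+ 2 * cmod h * L); last by ring.
    by rewrite ler_pM ?cmod_ge0 ?LP ?sB.
  rewrite (_ : _ * cmod h = B * (K * (B ^+ 2 * cmod h))); last by ring.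
  rewrite ler_pM ?mulr_ge0 ?cmod_ge0 ?sB //.
  apply: le_trans (KP _ _ (sB _ _ hd) (sB _ _ h0d)) _.
  by rewrite ler_wpM2l.
move=> h hd.
have cp h' : cmod h' < d -> on_circle (fun t => phi t * s h' t ^+ k).
  by move=> h'd; apply: cont_onM => //; exact/cont_on_exp/cs.
have -> : avg (fun t => phi t * (circ r t - z)^-1 ^+ k) =
  avg (fun t => phi t * s 0 t ^+ k) by apply: eq_avg => t; rewrite sz.
apply/eqP; rewrite [X in _ == X]addrC -subr_eq -avgB; [|exact: cp|exact: cp].
rewrite mulrC -avgM; last by apply: cont_onM => //; exact: cw.
apply/eqP/eq_avg => t; rewrite -mulrBr powerqE sd // /w; ring.
Qed.

Lemma derive1n_cauchy f (r : R) n z : hol f -> r < 1 -> cmod z < r ->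
  derive1n n f z = (n`!)%:R *
    avg (fun t => f (circ r t) * circ r t * (circ r t - z)^-1 ^+ n.+1).
Proof.
move=> fh r1; elim: n z => [|n IH] z zr.
  by rewrite fact0 mul1r; exact/esym/(cauchy_formula fh r1 zr).
have r0 : 0 <= r < 1 by have := cmod_ge0 z; lra.
rewrite derive1nS; apply: cderiv_derive1.
have zr0 : 0 < r - cmod z by rewrite subr_gt0.
apply: (@cderiv_near _ (fun x => (n`!)%:R *
    avg (fun t => f (circ r t) * circ r t * (circ r t - x)^-1 ^+ n.+1)) _ _ _ _ zr0).
  by move=> h hd; rewrite IH //; apply: le_lt_trans (cmodD _ _) _; lra.
rewrite factS natrM [n.+1%:R * _]mulrC -mulrA.
apply: cderivZ; apply: cderiv_kernel zr.
apply: cont_onM; first exact: hol_on_circle.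
exact: on_circle_circ.
Qed.

Lemma circV (r t : R) : 0 < r -> (circ r t)^-1 = (r^-1)%:C * (cis t)^*.
Proof.
move=> r0; rewrite /circ invfM fmorphV; congr (_ * _).
have c0 : cis t != 0 by rewrite -cmod_gt0 cmod_cis.
apply: (mulfI c0); rewrite mulfV // mulc_conj cmod_cis expr1n //.
Qed.

(** This identifies the coefficients defined by iterated derivatives at [0] with
    Fourier coefficients; everything about Hardy spaces rests on it. *)
Lemma taylor_coefE f n (r : R) : hol f -> 0 < r < 1 ->
  taylor_coef f n * (r ^+ n)%:C = avg (fun t => f (circ r t) * (cis t)^* ^+ n).
Proof.
move=> fh /andP[r0 r1].
rewrite /taylor_coef (@derive1n_cauchy f r) ?cmod0 //.
rewrite [_%:R * _]mulrC mulfK ?pnatr_eq0 -?lt0n ?fact_gt0 // mulrC -avgM; last first.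
  apply: cont_onM.
    by apply: cont_onM; [apply: hol_on_circle => //; rewrite ltW|exact: on_circle_circ].
  by apply: cont_on_exp; apply: on_circle_kernel; rewrite cmod0.
apply: eq_avg => t; rewrite subr0 exprS.
have c0 : circ r t != 0 by rewrite -cmod_gt0 cmod_circ ?ltW.
have V := circV t r0; set x := circ r t in c0 V *; clearbody x.
rewrite -!mulrA (mulVKf c0) mulrCA; congr (_ * _).
rewrite V exprMn rmorphXn /= mulrA -exprMn -rmorphM mulfV ?gt_eqF //.
by rewrite expr1n mul1r.
Qed.

End Taylor.

(** * Power series and Parseval's identity *)

Section Parseval.
Context {R : realType}.

Lemma geometric_small (M k e : R) : 0 <= k < 1 -> 0 <= M -> 0 < e ->
  exists N, forall n, (N <= n)%N -> M * k ^+ n <= e.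
Proof.
move=> /andP[k0 k1] M0 e0.
have M10 : 0 < M + 1 by lra.
have : k ^+ n @[n --> \oo] --> (0 : R) by apply: cvg_expr; rewrite ger0_norm.
move=> /cvgrPdist_le /(_ _ (divr_gt0 e0 M10))[N _ NP].
exists N => n /NP /=; rewrite sub0r normrN ger0_norm ?exprn_ge0 //.
rewrite ler_pdivlMr // mulrC; apply: le_trans.
by rewrite ler_wpM2r ?exprn_ge0 // lerDl.
Qed.

Lemma cmod_avg_le g b : on_circle g -> on_circle b ->
  (forall t : R, cmod (g t) <= Re (b t)) -> cmod (avg g) <= Re (avg b).
Proof.
move=> cg cb gb; set z := avg g.
(* a unimodular [c] with [c * z] real and nonnegative *)
have [c c1 cz] : exists2 c : R[i], cmod c <= 1 & cmod z = Re (c * z).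
  have [->|z0] := eqVneq z 0; first by exists 0; rewrite ?cmod0 ?ler01 // mulr0.
  exists (z^* / (cmod z)%:C).
    by rewrite cmodM cmodV cmod_real cmod_conj ger0_norm ?cmod_ge0 // mulfV // cmod_eq0.
  have n0 : cmod z != 0 by rewrite cmod_eq0.
  rewrite mulrAC [_^* * _]mulrC mulc_conj -fmorphV -rmorphM cRe_real.
  by rewrite expr2 mulfK.
rewrite cz -avgM //; apply: le_avg_Re => // [|t].
  by apply: cont_onM => //; exact: cont_on_cst.
apply: le_trans (gb t); apply: le_trans (ler_norm _) _.
by apply: le_trans (cmod_Re _) _; rewrite cmodM ler_piMl ?cmod_ge0.
Qed.

Lemma taylor_coef_avg f n (r : R) : hol f -> 0 < r < 1 ->
  taylor_coef f n = avg (fun t => f (circ r t) * (circ r t)^-1 ^+ n).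
Proof.
move=> fh rP; have /andP[r0 r1] := rP.
have rn0 : (r ^+ n)%:C != 0 by rewrite -cmod_gt0 cmod_real normr_gt0 expf_neq0 ?gt_eqF.
apply: (mulIf rn0); rewrite taylor_coefE // mulrC -avgM; last first.
  apply: cont_onM; first by apply: hol_on_circle => //; rewrite ltW.
  apply: cont_on_exp => t _; apply: tendsV; last exact: rcont_circ.
  by rewrite -cmod_gt0 cmod_circ // ltW.
apply: eq_avg => t; rewrite mulrCA; congr (_ * _).
by rewrite circV // exprMn rmorphXn /= mulrA -exprMn -rmorphM mulfV ?gt_eqF // expr1n mul1r.
Qed.

Lemma kernel_expansion (x z : R[i]) N : x != 0 -> x - z != 0 ->
  x / (x - z) = \sum_(k < N) z ^+ k * x^-1 ^+ k + (z / x) ^+ N * (x / (x - z)).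
Proof.
move=> x0 xz; elim: N => [|N IH]; first by rewrite big_ord0 expr0 mul1r add0r.
rewrite [LHS]IH big_ord_recr /= -addrA; congr (_ + _).
by rewrite -exprMn exprS; field; rewrite x0 xz.
Qed.

Lemma taylor_remainder f (r : R) : hol f -> 0 < r < 1 ->
  exists2 M, 0 <= M & forall z N, cmod z < r ->
    cmod (f z - \sum_(k < N) taylor_coef f k * z ^+ k) <=
    M / (r - cmod z) * (cmod z / r) ^+ N.
Proof.
move=> fh rP; have /andP[r0 r1] := rP.
have cf : on_circle (fun t => f (circ r t)) by apply: hol_on_circle => //; rewrite ltW.
have [M M0 fM] := on_circle_bounded cf.
exists (2 * (M * r)) => [|z N zr]; first by rewrite !mulr_ge0 // ltW.
have x0 t : circ r t != 0 by rewrite -cmod_gt0 cmod_circ // ltW.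
have cV : on_circle (fun t => (circ r t)^-1).
  by move=> t _; apply: tendsV (x0 t) _; exact: rcont_circ.
have cK : on_circle (fun t => circ r t / (circ r t - z)).
  by apply: cont_onM; [exact: on_circle_circ|exact: on_circle_kernel].
have cT k : on_circle (fun t => f (circ r t) * (z ^+ k * (circ r t)^-1 ^+ k)).
  apply: cont_onM cf _; apply: cont_onM; first exact: cont_on_cst.
  exact: cont_on_exp.
rewrite -(cauchy_formula fh r1 zr).
have -> : \sum_(k < N) taylor_coef f k * z ^+ k =
    avg (fun t => \sum_(k < N) f (circ r t) * (z ^+ k * (circ r t)^-1 ^+ k)).
  rewrite (avg_sum _ cT); apply: eq_bigr => k _.
  rewrite (taylor_coef_avg _ fh rP) mulrC -avgM; last by apply: cont_onM => //; exact: cont_on_exp.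
  by apply: eq_avg => t; rewrite mulrCA.
rewrite -avgB; first last.
- exact: (cont_on_sum (fun k _ => cT k)).
- by apply: cont_onM; [apply: cont_onM => //; exact: on_circle_circ|exact: on_circle_kernel].
rewrite (@eq_avg _ _ (fun t =>
  f (circ r t) * ((z / circ r t) ^+ N * (circ r t / (circ r t - z))))); last first.
  move=> t; rewrite -mulr_sumr -mulrA -mulrBr; congr (_ * _).
  by rewrite {1}(kernel_expansion N (x0 t) (circ_sub_neq0 t zr)) [LHS]addrC addKr.
have rz : 0 < r - cmod z by rewrite subr_gt0.
have -> : 2 * (M * r) / (r - cmod z) * (cmod z / r) ^+ N =
    2 * (M * ((cmod z / r) ^+ N * (r / (r - cmod z)))).
  by move: (_ ^+ N) => X; field; exact: lt0r_neq0.
apply: cmod_avg => [|t tP].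
  apply: cont_onM => //; apply: cont_onM => //; apply: cont_on_exp.
  by apply: cont_onM => //; exact: cont_on_cst.
rewrite cmodM [cmod (_ ^+ N * _)]cmodM cmodX [cmod (z / _)]cmodM.
rewrite [cmod (circ r t / _)]cmodM !cmodV !cmod_circ ?(ltW r0) //.
have zr0 : 0 <= cmod z / r by rewrite divr_ge0 ?cmod_ge0 ?ltW.
rewrite ler_pM ?fM ?cmod_ge0 ?mulr_ge0 ?exprn_ge0 ?invr_ge0 ?cmod_ge0 ?(ltW r0) //.
rewrite ler_wpM2l ?exprn_ge0 // ler_wpM2l ?(ltW r0) // lef_pV2 ?posrE //.
  by have := cmodBl (circ r t) z; rewrite cmod_circ // ltW.
by rewrite cmod_gt0 circ_sub_neq0.
Qed.

Lemma taylor_series f z e : hol f -> cmod z < 1 -> 0 < e :> R ->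
  exists N, forall n, (N <= n)%N ->
    cmod (f z - \sum_(k < n) taylor_coef f k * z ^+ k) <= e.
Proof.
move=> fh z1 e0; have z0 := cmod_ge0 z.
pose r := (1 + cmod z) / 2.
have [zr r1] : cmod z < r /\ r < 1 by rewrite /r; split; lra.
have r0 : 0 < r by lra.
have rP : 0 < r < 1 by rewrite r0.
have [M M0 H] := taylor_remainder fh rP.
have M'0 : 0 <= M / (r - cmod z) by rewrite divr_ge0 // subr_ge0 ltW.
have k1 : 0 <= cmod z / r < 1 by rewrite divr_ge0 ?(ltW r0) //= ltr_pdivrMr ?mul1r.
have [N NP] := geometric_small k1 M'0 e0.
by exists N => n /NP; apply: le_trans; exact: H.
Qed.

(** The inner product of square integrable functions on the circle of radius
    [r < 1], where holomorphic functions are continuous. The inner product of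
    the Hardy space is its limit when [r] tends to [1]. *)
Definition ip (r : R) p q : R[i] := avg (fun t => p (circ r t) * (q (circ r t))^*).

Lemma ip_cont (r : R) p q : hol p -> hol q -> 0 <= r < 1 ->
  on_circle (fun t => p (circ r t) * (q (circ r t))^*).
Proof.
move=> ph qh rP; apply: cont_onM; first exact: hol_on_circle.
by apply: cont_on_conj; exact: hol_on_circle.
Qed.

Lemma conj_circX (r t : R) k : ((circ r t) ^+ k)^* = (r ^+ k)%:C * (cis t)^* ^+ k.
Proof.
rewrite /circ exprMn [LHS]rmorphM; congr (_ * _); last exact: rmorphXn.
rewrite -[r%:C ^+ k]rmorphXn.
by apply: complex_ext; rewrite /= ?oppr0.
Qed.

(** Only [q] is expanded, with a uniform remainder on the circle; the Taylor
    coefficients of [p] then appear as means. *)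
Lemma parseval (r e : R) p q : hol p -> hol q -> 0 < r < 1 -> 0 < e ->
  exists N, forall n, (N <= n)%N -> cmod (ip r p q -
    \sum_(k < n) taylor_coef p k * (taylor_coef q k)^* * (r ^+ k * r ^+ k)%:C) <= e.
Proof.
move=> ph qh rP e0; have /andP[r0 r1] := rP.
have rP' : 0 <= r < 1 by rewrite r1 ltW.
(* The coefficients of [q] are estimated on the larger circle of radius [s], so
   that the remainder decays like [(r / s) ^+ N]. *)
pose s := (1 + r) / 2; have [rs s1] : r < s /\ s < 1 by rewrite /s; split; lra.
have s0 : 0 < s by lra.
have sP : 0 < s < 1 by rewrite s0.
have [M M0 H] := taylor_remainder qh sP.
have cp := hol_on_circle ph rP'; have cq := hol_on_circle qh rP'.
have [L L0 pL] := on_circle_bounded cp.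
have M'0 : 0 <= 2 * (L * (M / (s - r))) by rewrite !mulr_ge0 // invr_ge0 subr_ge0 ltW.
have k1 : 0 <= r / s < 1 by rewrite divr_ge0 ?(ltW r0) ?(ltW s0) //= ltr_pdivrMr ?mul1r.
have [N NP] := geometric_small k1 M'0 e0.
exists N => n /NP; apply: le_trans.
have cT k : on_circle (fun t => p (circ r t) * (taylor_coef q k * circ r t ^+ k)^*).
  apply: cont_onM cp _; apply: cont_on_conj; apply: cont_onM; first exact: cont_on_cst.
  exact: cont_on_exp (on_circle_circ r).
have -> : \sum_(k < n) taylor_coef p k * (taylor_coef q k)^* * (r ^+ k * r ^+ k)%:C =
    avg (fun t => \sum_(k < n) p (circ r t) * (taylor_coef q k * circ r t ^+ k)^*).
  rewrite (avg_sum _ cT); apply: eq_bigr => k _.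
  rewrite [(r ^+ k * r ^+ k)%:C]rmorphM mulrACA taylor_coefE //.
  rewrite mulrC -avgM; last first.
    by apply: cont_onM cp _; apply: cont_on_exp; apply: cont_on_conj => t _; exact: rcont_cis.
  apply: eq_avg => t; rewrite mulrCA; congr (_ * _).
  rewrite [RHS]rmorphM -mulrA; congr (_ * _).
  exact/esym/conj_circX.
rewrite /ip -avgB; [|exact: ip_cont|exact: (cont_on_sum (fun k _ => cT k))].
rewrite -!mulrA; apply: cmod_avg.
  by apply: cont_onB; [exact: ip_cont|exact: (cont_on_sum (fun k _ => cT k))].
move=> t tP.
rewrite -mulr_sumr -mulrBr -rmorph_sum -rmorphB cmodM cmod_conj.
rewrite ler_pM ?cmod_ge0 ?pL //.
have := H (circ r t) n; rewrite cmod_circ ?(ltW r0) // -mulrA => /(_ rs).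
by under eq_bigr do rewrite mulrC.
Qed.

Lemma cmod_Re_sub (x : R[i]) (s : R) : `|Re x - s| <= cmod (x - s%:C).
Proof. by have := cmod_Re (x - s%:C); rewrite cReB. Qed.

Lemma sum_ord_le (F : nat -> R) n m : (forall k, 0 <= F k) -> (n <= m)%N ->
  \sum_(k < n) F k <= \sum_(k < m) F k.
Proof.
move=> F0 nm; rewrite -(big_mkord xpredT F) -(big_mkord xpredT F).
by rewrite [leRHS](big_cat_nat (leq0n n) nm) //= lerDl sumr_ge0.
Qed.

Lemma bessel (r : R) p n : hol p -> 0 < r < 1 ->
  \sum_(k < n) (cmod (taylor_coef p k) * r ^+ k) ^+ 2 <= Re (ip r p p).
Proof.
move=> ph rP; apply/ler_addgt0Pr => e e0.
have [N NP] := parseval ph ph rP e0.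
have := NP (maxn n N) (leq_maxr _ _).
have -> : \sum_(k < maxn n N) taylor_coef p k * (taylor_coef p k)^* * (r ^+ k * r ^+ k)%:C
  = (\sum_(k < maxn n N) (cmod (taylor_coef p k) * r ^+ k) ^+ 2)%:C.
  rewrite rmorph_sum; apply: eq_bigr => k _.
  by rewrite mulc_conj -rmorphM exprMn expr2.
move=> /(le_trans (cmod_Re_sub _ _)); rewrite ler_norml => /andP[H _].
apply: le_trans (_ : \sum_(k < maxn n N) (cmod (taylor_coef p k) * r ^+ k) ^+ 2 <= _).
  by apply: (sum_ord_le (fun k => sqr_ge0 (cmod (taylor_coef p k) * r ^+ k))); exact: leq_maxl.
by move: H; move: (Re _) (\sum_(k < _) _) => x y; lra.
Qed.

Lemma mean_le_coef (r : R) p G : hol p -> 0 < r < 1 ->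
  (forall n, \sum_(k < n) cmod (taylor_coef p k) ^+ 2 <= G) ->
  Re (ip r p p) <= G.
Proof.
move=> ph rP pG; have /andP[r0 r1] := rP; apply/ler_addgt0Pr => e e0.
have [N NP] := parseval ph ph rP e0.
have := NP N (leqnn _).
have -> : \sum_(k < N) taylor_coef p k * (taylor_coef p k)^* * (r ^+ k * r ^+ k)%:C
  = (\sum_(k < N) (cmod (taylor_coef p k) * r ^+ k) ^+ 2)%:C.
  rewrite rmorph_sum; apply: eq_bigr => k _.
  by rewrite mulc_conj -rmorphM exprMn expr2.
move=> /(le_trans (cmod_Re_sub _ _)); rewrite ler_norml => /andP[_ H].
have : \sum_(k < N) (cmod (taylor_coef p k) * r ^+ k) ^+ 2 <=
    \sum_(k < N) cmod (taylor_coef p k) ^+ 2.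
  apply: ler_sum => k _; rewrite exprMn ler_piMr ?sqr_ge0 //.
  by apply: exprn_ile1; rewrite ?exprn_ge0 ?exprn_ile1 ?(ltW r0) ?(ltW r1).
have := pG N; move: H; move: (Re _) (\sum_(k < _) _) (\sum_(k < _) _) => x y w; lra.
Qed.

End Parseval.

(** * Radial limits of means *)

Section Radial.
Context {R : realType}.

(** A sequence of radii, so that dominated convergence applies. *)
Definition rseq (n : nat) : R := 1 - (n.+2%:R)^-1.

Lemma rseqP n : 0 < rseq n < 1.
Proof.
have n0 : 0 < n.+2%:R :> R by rewrite ltr0n.
rewrite subr_gt0 invf_lt1 // ltr1n /= gtrBl invr_gt0 //.
Qed.

Lemma rseq_ge0 n : 0 <= rseq n < 1.
Proof. by have /andP[r0 ->] := rseqP n; rewrite ltW. Qed.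

Lemma rseq_near e : 0 < e -> \forall n \near \oo, 1 - rseq n <= e.
Proof.
move=> e0; exists (Num.bound e^-1) => // n /= Hn.
rewrite /rseq opprB addrC subrK -[e]invrK lef_pV2 ?posrE ?ltr0n ?invr_gt0 //.
apply: ltW; apply: lt_le_trans (archi_boundP (ltW _)) _; first by rewrite invr_gt0.
by rewrite ler_nat; apply: leq_trans Hn _; rewrite leqW // leqW.
Qed.

Lemma bernoulli (r : R) n : 0 <= r <= 1 -> 1 - r ^+ n <= n%:R * (1 - r).
Proof.
move=> /andP[r0 r1]; elim: n => [|n IH]; first by rewrite expr0 subrr mul0r.
have rn : r ^+ n <= 1 by apply: exprn_ile1.
have rn0 : 0 <= r ^+ n by rewrite exprn_ge0.
rewrite exprS -natr1; nra.
Qed.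

Lemma rseq_pow_near k e : 0 < e ->
  \forall n \near \oo, forall j, (j < k)%N -> 1 - rseq n ^+ j * rseq n ^+ j <= e.
Proof.
move=> e0; have k0 : 0 < k%:R * 2 + 1 :> R by rewrite ltr_wpDl // mulr_ge0.
have := rseq_near (divr_gt0 e0 k0); apply: filterS => n rn j jk.
have /andP[r0 r1] := rseqP n.
rewrite -exprD; apply: le_trans (bernoulli _ _) _; first by rewrite (ltW r0) ltW.
move: rn; rewrite ler_pdivlMr // => rn; apply: le_trans _ rn.
rewrite mulrC ler_wpM2l ?subr_ge0 ?(ltW r1) //.
rewrite natrD; have : j%:R <= k%:R :> R by rewrite ler_nat ltnW.
lra.
Qed.

(** Bessel's inequality at the radius [rseq n], in which a finite sum of
    coefficients is not affected much by the powers of [rseq n]. *)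
Lemma coef_sum_le p G : hol p ->
  (forall e, 0 < e -> \forall n \near \oo, Re (ip (rseq n) p p) <= G + e) ->
  forall m, \sum_(k < m) cmod (taylor_coef p k) ^+ 2 <= G.
Proof.
move=> ph H m; apply/ler_addgt0Pr => e e0.
set S := \sum_(k < m) _.
have S0 : 0 <= S by apply: sumr_ge0 => k _; exact: sqr_ge0.
have e20 : 0 < e / 2 by rewrite divr_gt0.
have S1 : 0 < S + 1 by rewrite ltr_wpDl.
near \oo => n.
have h1 : Re (ip (rseq n) p p) <= G + e / 2 by near: n; exact: H.
have h2 j : (j < m)%N -> 1 - rseq n ^+ j * rseq n ^+ j <= e / 2 / (S + 1).
  by move: j; near: n; apply: rseq_pow_near; rewrite divr_gt0.
have := le_trans (bessel m ph (rseqP n)) h1.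
have : S - \sum_(k < m) (cmod (taylor_coef p k) * rseq n ^+ k) ^+ 2 <= e / 2 / (S + 1) * S.
  rewrite /S -sumrB mulr_sumr; apply: ler_sum => k _.
  have := h2 k (ltn_ord k); rewrite exprMn !expr2.
  by have := sqr_ge0 (cmod (taylor_coef p k)); rewrite expr2; nra.
have : e / 2 / (S + 1) * S <= e / 2.
  rewrite mulrAC ler_pdivrMr // ler_wpM2l ?ltW //; lra.
move: (Re _) (\sum_(k < m) _ ^+ 2) h1 => x y; rewrite -/S; lra.
Unshelve. all: by end_near. Qed.

(** Abel's theorem for the absolutely convergent series of the products of the
    coefficients: the tails are small uniformly in the radius. *)
Lemma ip_abel p q P Q : hol p -> hol q ->
  (forall n, \sum_(k < n) cmod (taylor_coef p k) ^+ 2 <= P) ->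
  (forall n, \sum_(k < n) cmod (taylor_coef q k) ^+ 2 <= Q) ->
  forall e, 0 < e -> exists N, forall m, (N <= m)%N -> \forall n \near \oo,
    cmod (ip (rseq n) p q -
          \sum_(k < m) taylor_coef p k * (taylor_coef q k)^*) <= e.
Proof.
move=> ph qh pP qQ e e0.
pose x k := taylor_coef p k * (taylor_coef q k)^*.
pose A n := \sum_(k < n) cmod (x k).
have Amono n m : (n <= m)%N -> A n <= A m.
  by apply: (sum_ord_le (fun k => cmod_ge0 (x k))).
have A0 n : 0 <= A n by apply: sumr_ge0 => k _; exact: cmod_ge0.
have Aub n : A n <= P + Q.
  apply: le_trans (lerD (pP n) (qQ n)); rewrite -big_split /=.
  apply: ler_sum => k _; rewrite /x cmodM cmod_conj.
  have := cmod_ge0 (taylor_coef p k); have := cmod_ge0 (taylor_coef q k).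
  by move: (cmod _) (cmod _) => a b; nra.
have e40 : 0 < e / 4 by rewrite divr_gt0.
have [N NP] : exists N, forall m, (N <= m)%N -> A m - A N <= e / 4.
  have sA : has_sup (range A).
    by split; [exists (A 0%N), 0%N|exists (P + Q) => _ [n _ <-]].
  have [_ [N _ <-] NP] := sup_adherent e40 sA.
  exists N => m Nm; have : A m <= sup (range A) by apply: sup_upper_bound => //; exists m.
  by move: NP; move: (sup _) => s; lra.
exists N => m Nm.
have PQ1 : 0 < P + Q + 1 by have := A0 0%N; have := Aub 0%N; lra.
near=> n.
have h2 j : (j < m)%N -> 1 - rseq n ^+ j * rseq n ^+ j <= e / 4 / (P + Q + 1).
  by move: j; near: n; apply: rseq_pow_near; rewrite divr_gt0.
have /andP[r0 r1] := rseqP n; set r := rseq n in h2 r0 r1 *.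
have [L LP] := parseval ph qh (rseqP n) e40.
have LP' := LP (maxn m L) (leq_maxr _ _).
have mM : (m <= maxn m L)%N by exact: leq_maxl.
set M := maxn m L in LP' mM.
pose y k := x k * (r ^+ k * r ^+ k)%:C.
have LPy : cmod (ip r p q - \sum_(k < M) y k) <= e / 4 by exact: LP'.
have rr k : 0 <= r ^+ k * r ^+ k <= 1.
  have rk : 0 <= r ^+ k by rewrite exprn_ge0 // ltW.
  have rk1 : r ^+ k <= 1 by rewrite exprn_ile1 // ltW.
  by rewrite mulr_ge0 //= mulr_ile1.
have tail : cmod (\sum_(k < M) y k - \sum_(k < m) y k) <= e / 4.
  apply: le_trans (_ : A M - A m <= _); last first.
    apply: le_trans (NP _ (leq_trans Nm mM)); rewrite lerD2l lerN2.
    exact: Amono.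
  rewrite /A -(big_mkord xpredT y) -(big_mkord xpredT y).
  rewrite -(big_mkord xpredT (fun k => cmod (x k))).
  rewrite -(big_mkord xpredT (fun k => cmod (x k))).
  rewrite !(big_cat_nat (leq0n m) mM) /= ![_ + _ - _]addrAC !subrr !add0r.
  apply: le_trans (cmod_sum _ _ _) _; apply: ler_sum => k _.
  have /andP[k0 k1] := rr k.
  by rewrite /y cmodM cmod_real ger0_norm // ler_piMr ?cmod_ge0.
have headd : cmod (\sum_(k < m) y k - \sum_(k < m) x k) <= e / 4.
  apply: le_trans (_ : e / 4 / (P + Q + 1) * A m <= _); last first.
    rewrite mulrAC ler_pdivrMr // ler_wpM2l ?(ltW e40) //.
    by apply: le_trans (Aub m) _; rewrite lerDl.
  rewrite -sumrB /A mulr_sumr.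
  apply: le_trans (cmod_sum _ _ _) _; apply: ler_sum => k _.
  rewrite /y -[X in _ - X]mulr1 -mulrBr -(rmorph1 (real_complex R)) -rmorphB.
  rewrite cmodM cmod_real distrC ger0_norm; last first.
    by rewrite subr_ge0; have /andP[] := rr k.
  by rewrite mulrC ler_wpM2r ?cmod_ge0 // h2.
rewrite (_ : _ - _ = (ip r p q - \sum_(k < M) y k) +
  (\sum_(k < M) y k - \sum_(k < m) y k) + (\sum_(k < m) y k - \sum_(k < m) x k));
  last by ring.
apply: le_trans (cmodD _ _) _.
have := cmodD (ip r p q - \sum_(k < M) y k) (\sum_(k < M) y k - \sum_(k < m) y k).
move: LPy tail headd.
move: (cmod (_ + _)) (cmod _) (cmod _) (cmod _) => a b c d; lra.
Unshelve. all: by end_near. Qed.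

End Radial.

(** * Inner functions *)

Section Inner.
Context {R : realType}.
Local Notation mu := (@lebesgue_measure R).
Local Notation rseq := (@rseq R).
Local Notation rseqP := (@rseqP R).
Local Notation rseq_ge0 := (@rseq_ge0 R).

Lemma holP (f : R[i] -> R[i]) : holomorphic f <-> hol f.
Proof.
by split=> fh z zP; move: (fh z zP); rewrite derivable_cderiv.
Qed.

Lemma rseq_cvg_left : rseq n @[n --> \oo] --> (1 : R)^'-.
Proof.
move=> A /nbhs_ballP[d /= d0 dA]; have d20 : 0 < d / 2 by rewrite divr_gt0.
have := rseq_near d20; apply: filterS => n rn.
have /andP[r0 r1] := rseqP n.
apply: dA => //; rewrite /ball /= ger0_norm ?subr_ge0 ?ltW //; lra.
Qed.

Lemma tends_seq_cvg (f : R -> R[i]) w : f r @[r --> (1 : R)^'-] --> w ->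
  forall e, 0 < e -> \forall n \near \oo, cmod (f (rseq n) - w) < e.
Proof.
move=> fw e e0.
have /cvgrPdist_lt H := cvg_comp _ _ rseq_cvg_left fw.
have := H e%:C; rewrite ltcR => /(_ e0); apply: filterS => n.
by rewrite normC_cmod ltcR cmodBC.
Qed.

(** The radial limits of [u] have modulus one almost everywhere and [u] is
    bounded, so this is dominated convergence along the radii [rseq]. *)
Lemma inner_mean u : inner_function u -> forall e, 0 < e ->
  \forall n \near \oo,
    Re (avg (fun t => ((1 - cmod (u (circ (rseq n) t)) ^+ 2) ^+ 2)%:C)) <= e.
Proof.
move=> [/holP uh [M uM] uae] e e0.
pose g n t := (1 - cmod (u (circ (rseq n) t)) ^+ 2) ^+ 2.
have gc n : on_circle (fun t => (g n t)%:C).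
  have uc : on_circle (fun t => u (circ (rseq n) t)) by apply/hol_on_circle/rseq_ge0.
  have -> : (fun t => (g n t)%:C) = (fun t =>
     (1 - u (circ (rseq n) t) * (u (circ (rseq n) t))^*) ^+ 2).
    by apply/funext => t; rewrite mulc_conj -(rmorph1 (real_complex R)) -rmorphB -rmorphXn.
  apply: cont_on_exp; apply: cont_onB; first exact: cont_on_cst.
  by apply: cont_onM => //; exact: cont_on_conj.
have gint n : mu.-integrable `[0, 2 * pi] (EFin \o g n) by exact: integrable_Re (gc n).
have M0 : 0 <= M by apply: le_trans (cmod_ge0 (u 0)) (uM 0 _); rewrite /unit_disc /= cmod0.
have gM n t : 0 <= g n t <= (1 + M ^+ 2) ^+ 2.
  rewrite sqr_ge0 /= /g -[leLHS]real_normK ?num_real //.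
  rewrite lerXn2r ?nnegrE ?addr_ge0 ?sqr_ge0 //.
  have um : cmod (u (circ (rseq n) t)) <= M.
    by apply: uM; rewrite /unit_disc /= cmod_circ; have /andP[r0 r1] := rseqP n; rewrite ?ltW.
  apply: le_trans (ler_normB _ _) _; rewrite normr1 lerD2l ger0_norm ?sqr_ge0 //.
  by rewrite lerXn2r ?nnegrE ?cmod_ge0.
have gint' n : mu.-integrable `[0, 2 * pi[ (EFin \o g n).
  apply: integrableS (gint n) => //.
  by apply: subset_itvl; rewrite bnd_simp.
have gm n := measurable_int mu (gint' n).
have bm : {ae mu, forall t, `[0, 2 * pi[%classic t ->
    (EFin \o g n) t @[n --> \oo] --> 0%E}.
  apply: negligibleS uae => t /=; apply: contra_not => ut.
  rewrite in_itv /= => /ut[w w1 uw]; apply: cvg_EFin; first exact: nearW.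
  pose F n := cmod (u (circ (rseq n) t)).
  have F1 : F n @[n --> \oo] --> (1 : R).
    apply/cvgrPdist_lt => d d0; have := tends_seq_cvg uw d0.
    apply: filterS => n; apply: le_lt_trans.
    rewrite distrC -w1 ler_norml; apply/andP; split.
      by rewrite lerNl opprB cmodBC; exact: cmodBl.
    exact: cmodBl.
  have -> : 0 = (1 - 1 * 1) * (1 - 1 * 1) :> R by rewrite mulr1 subrr mul0r.
  have F2 : (1 - F n * F n) @[n --> \oo] --> (1 - 1 * 1 : R).
    have := cvgB (@cvg_cst _ (1 : R) nat \oo _) (cvgM F1 F1).
    exact.
  rewrite (_ : fine \o _ = (fun n => (1 - F n * F n) * (1 - F n * F n))); last first.
    by apply/funext => n; rewrite /= /g !expr2.
  exact: (cvgM F2 F2).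
have cst_int : mu.-integrable `[0, 2 * pi[ (EFin \o (fun _ : R => (1 + M ^+ 2) ^+ 2)).
  apply: integrableS (cont_integrable (a := 0) (b := 2 * pi) _) => //.
    by apply: subset_itvl; rewrite bnd_simp.
  by move=> t _; exact: cvg_cst.
have bd : {ae mu, forall t n, `[0, 2 * pi[%classic t ->
    (`|(EFin \o g n) t| <= ((1 + M ^+ 2) ^+ 2)%:E)%E}.
  apply: aeW => t n _ /=; rewrite lee_fin.
  by have /andP[g0 gn] := gM n t; rewrite ger0_norm.
have [_ _] := @dominated_convergence _ _ _ mu `[0, 2 * pi[%classic
  (measurable_itv _) (fun n => EFin \o g n) (fun _ => 0%E)
  (fun _ => ((1 + M ^+ 2) ^+ 2)%:E) gm (measurable_cst _) bm cst_int bd.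
rewrite integral0 => /fine_cvg /cvgrPdist_le.
have e2pi : 0 < e * (2 * pi) by rewrite mulr_gt0 // pi2_gt0.
move=> /(_ _ e2pi); apply: filterS => n.
rewrite sub0r normrN => gn.
rewrite /avg cReM cRe_real cIm_real mul0r subr0 Re_cint mulrC ler_pdivrMr ?pi2_gt0 //.
apply: le_trans gn; apply: le_trans (ler_norm _) _.
by rewrite -(Rintegral_itv_bndo_bndc (gint' n)).
Qed.

End Inner.

(** * Reproducing kernels *)

Section Kernels.
Context {R : realType}.
Local Notation rseq := (@rseq R).
Local Notation rseqP := (@rseqP R).
Local Notation rseq_ge0 := (@rseq_ge0 R).
Implicit Types (f g h p q u : R[i] -> R[i]) (w z : R[i]).

Lemma holM f g : hol f -> hol g -> hol (fun z => f z * g z).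
Proof.
by move=> fh gh z z1; have [a fa] := fh z z1; have [b gb] := gh z z1;
  eexists; exact: cderivM fa gb.
Qed.

Lemma holB f g : hol f -> hol g -> hol (fun z => f z - g z).
Proof.
by move=> fh gh z z1; have [a fa] := fh z z1; have [b gb] := gh z z1;
  eexists; exact: cderivB fa gb.
Qed.

Lemma hol_cst w : hol (fun _ => w).
Proof. by move=> z _; eexists; exact: cderiv_cst. Qed.

(** The Szego kernel, reproducing for the Hardy space. *)
Definition szego w z : R[i] := (1 - w^* * z)^-1.

Lemma szego_den w z : cmod w < 1 -> cmod z <= 1 -> 1 - cmod w <= cmod (1 - w^* * z).
Proof.
move=> w1 z1; have := cmodBl 1 (w^* * z); rewrite cmod1 cmodM cmod_conj.
have := cmod_ge0 w; have : cmod w * cmod z <= cmod w by rewrite ler_piMr ?cmod_ge0.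
lra.
Qed.

Lemma szego_den0 w z : cmod w < 1 -> cmod z <= 1 -> 1 - w^* * z != 0.
Proof. by move=> w1 z1; rewrite -cmod_gt0; have := szego_den w1 z1; lra. Qed.

Lemma cderiv_szego w z : cmod w < 1 -> cmod z <= 1 ->
  is_cderiv (szego w) z (w^* / (1 - w^* * z) ^+ 2).
Proof.
move=> w1 z1; have n0 := szego_den0 w1 z1.
have -> : w^* / (1 - w^* * z) ^+ 2 = - ((1 - w^* * z) ^+ 2)^-1 * (0 - w^* * 1).
  by rewrite mulr1 sub0r mulrNN mulrC.
apply: (@cderiv_comp _ (fun x => x^-1) (fun z => 1 - w^* * z)); first exact: cderivV.
apply: cderivB; first exact: cderiv_cst.
exact/cderivZ/cderiv_id.
Qed.

Lemma hol_szego w : cmod w < 1 -> hol (szego w).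
Proof. by move=> w1 z z1; eexists; exact: cderiv_szego w1 (ltW z1). Qed.

Lemma szego_bound w z : cmod w < 1 -> cmod z <= 1 ->
  cmod (szego w z) <= (1 - cmod w)^-1.
Proof.
move=> w1 z1; rewrite /szego cmodV lef_pV2 ?posrE; first exact: szego_den.
  by rewrite cmod_gt0 szego_den0.
by rewrite subr_gt0.
Qed.

(** On the circle of radius [r] one has [conj x = r^2 / x], so the conjugate of
    the Szego kernel at [w] is the Cauchy kernel at [r^2 * w]. The reproducing
    property is thus exact before the limit [r = 1]. *)
Lemma ip_szego r q w : hol q -> 0 < r < 1 -> cmod w < 1 ->
  ip r q (szego w) = q ((r * r)%:C * w).
Proof.
move=> qh /andP[r0 r1] w1.
have rw : cmod ((r * r)%:C * w) < r.
  rewrite cmodM cmod_real ger0_norm ?mulr_ge0 ?ltW // -mulrA gtr_pMr //.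
  by apply: mulr_ilt1; rewrite ?cmod_ge0 ?ltW.
rewrite -(cauchy_formula qh r1 rw) /ip; apply: eq_avg => t.
rewrite -mulrA; congr (_ * _).
have x0 : circ r t != 0 by rewrite -cmod_gt0 cmod_circ // ltW.
have xx : circ r t * (circ r t)^* = (r * r)%:C by rewrite mulc_conj cmod_circ ?expr2 ?ltW.
have n0 : circ r t - (r * r)%:C * w != 0 by exact: circ_sub_neq0.
have -> : (szego w (circ r t))^*%R = (1 - w * (circ r t)^*)^-1.
  by rewrite /szego fmorphV rmorphB rmorph1 rmorphM /= conjCK.
rewrite -xx in n0 *; move: n0.
have -> : circ r t - circ r t * (circ r t)^* * w = circ r t * (1 - w * (circ r t)^*).
  by rewrite mulrBr mulr1 -mulrA [w * _]mulrC.
rewrite mulf_eq0 negb_or => /andP[_ n1].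
by rewrite invfM mulrA mulfV // mul1r.
Qed.

Lemma ip_sym r p q : hol p -> hol q -> 0 <= r < 1 -> ip r p q = (ip r q p)^*.
Proof.
move=> ph qh rP; rewrite -avg_conj; last exact: ip_cont.
apply: eq_avg => t; rewrite [RHS]rmorphM mulrC; congr (_ * _).
exact/esym/conjcK.
Qed.

Lemma near_shrink q w e : hol q -> cmod w < 1 -> 0 < e ->
  \forall n \near \oo, cmod (q ((rseq n * rseq n)%:C * w) - q w) <= e.
Proof.
move=> qh w1 e0; have [d d0 H] := hol_cont qh w1 e0.
have d20 : 0 < d / 2 by rewrite divr_gt0.
have := rseq_pow_near 2 d20; apply: filterS => n /(_ 1%N isT); rewrite !expr1 => rn.
have -> : (rseq n * rseq n)%:C * w = w + (rseq n * rseq n - 1)%:C * w.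
  by move: (rseq n * rseq n) => X; rewrite rmorphB rmorph1 mulrBl mul1r [RHS]addrC subrK.
apply/ltW/H; rewrite cmodM cmod_real distrC ger0_norm.
  apply: le_lt_trans (_ : 1 - rseq n * rseq n < d); last by lra.
  rewrite ler_piMr ?ltW //; have /andP[r0 r1] := rseqP n; nra.
by have /andP[r0 r1] := rseqP n; nra.
Qed.

Lemma szego_diag w : szego w w = ((1 - cmod w ^+ 2)^-1)%:C.
Proof.
by rewrite /szego [w^* * w]mulrC mulc_conj -(rmorph1 (real_complex R)) -rmorphB -fmorphV.
Qed.

Lemma ip_szego_le w r : cmod w < 1 -> 0 < r < 1 ->
  Re (ip r (szego w) (szego w)) <= (1 - cmod w ^+ 2)^-1.
Proof.
move=> w1 rP; have /andP[r0 r1] := rP; have w0 := cmod_ge0 w.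
rewrite ip_szego //; last exact: hol_szego.
have -> : szego w ((r * r)%:C * w) = ((1 - r * r * cmod w ^+ 2)^-1)%:C.
  by rewrite /szego mulrCA [w^* * w]mulrC mulc_conj -rmorphM
    -(rmorph1 (real_complex R)) -rmorphB -fmorphV.
rewrite cRe_real.
have r2 : r * r <= 1 by rewrite mulr_ile1 // ltW.
have w2 : cmod w ^+ 2 < 1 by rewrite exprn_ilt1.
have := sqr_ge0 (cmod w) => w20.
have H : r * r * cmod w ^+ 2 <= cmod w ^+ 2 by rewrite ler_piMl.
rewrite lef_pV2 ?posrE ?lerD2l ?lerN2 // subr_gt0 //.
exact: le_lt_trans w2.
Qed.

Lemma ip_amgm r p q : hol p -> hol q -> 0 <= r < 1 ->
  cmod (ip r p q) <= (Re (ip r p p) + Re (ip r q q)) / 2.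
Proof.
move=> ph qh rP; have cpp := ip_cont ph ph rP; have cqq := ip_cont qh qh rP.
have ch : on_circle (fun _ : R => (2^-1 : R)%:C) by exact: cont_on_cst.
apply: le_trans (cmod_avg_le (b := fun t => 2^-1%:C * (p (circ r t) * (p (circ r t))^* +
   q (circ r t) * (q (circ r t))^*)) (ip_cont ph qh rP) _ _) _.
- by apply: cont_onM => //; exact: cont_onD.
- move=> t; rewrite !mulc_conj -rmorphD -rmorphM cRe_real cmodM cmod_conj.
  move: (cmod _) (cmod _) => a b; have := sqr_ge0 (a - b); nra.
rewrite avgM ?avgD //; last exact: cont_onD.
by rewrite cReM cRe_real cIm_real mul0r subr0 cReD mulrC.
Qed.

(** The two means differ by that of [(|u| ^ 2 - 1) * h * conj g]. Since [h] is
    bounded, it is enough that [1 - |u| ^ 2] tends to [0] in mean square while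
    [g] stays bounded in mean square. *)
Lemma ip_isometry u h g H G : inner_function u -> hol h -> hol g ->
  (forall z, cmod z < 1 -> cmod (h z) <= H) ->
  (forall n, \sum_(k < n) cmod (taylor_coef g k) ^+ 2 <= G) ->
  forall e, 0 < e -> \forall n \near \oo,
    cmod (ip (rseq n) (fun z => u z * h z) (fun z => u z * g z) - ip (rseq n) h g) <= e.
Proof.
move=> uin hh gh hH gG e e0; have [/holP uh _ _] := uin.
have H0 : 0 <= H by apply: le_trans (cmod_ge0 (h 0)) (hH _ _); rewrite cmod0.
have G0 : 0 <= G by have := gG 0%N; rewrite big_ord0.
(* The weight in [S * b <= T * S ^+ 2 + b ^+ 2 / T], where [b] is the modulus of
   [g]: it makes the contribution of [b ^+ 2] at most [e / 2]. *)
pose T := 2 * H * G / e + 1.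
have T0 : 0 < T by rewrite ltr_wpDl // divr_ge0 ?mulr_ge0 // ltW.
have HT0 : 0 < 2 * (H * T + 1) by rewrite mulr_gt0 // ltr_wpDl // mulr_ge0 // ltW.
have := inner_mean uin (divr_gt0 e0 HT0); apply: filterS => n mn.
have rP := rseq_ge0 n; have rP' := rseqP n; set r := rseq n in rP rP' mn *.
have uhh := holM uh hh; have ugh := holM uh gh.
have cu := hol_on_circle uh rP.
pose s t : R[i] := ((1 - cmod (u (circ r t)) ^+ 2) ^+ 2)%:C.
have cs : on_circle s.
  have -> : s = (fun t => (1 - u (circ r t) * (u (circ r t))^*) ^+ 2).
    by apply/funext => t; rewrite mulc_conj -(rmorph1 (real_complex R)) -rmorphB -rmorphXn.
  apply: cont_on_exp; apply: cont_onB; first exact: cont_on_cst.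
  by apply: cont_onM => //; exact: cont_on_conj.
have cgg := ip_cont gh gh rP.
rewrite /ip -avgB; [|exact: ip_cont uhh ugh rP|exact: ip_cont].
apply: le_trans (cmod_avg_le (b := fun t => (H * T)%:C * s t +
   (H / T)%:C * (g (circ r t) * (g (circ r t))^*)) _ _ _) _.
- by apply: cont_onB; [exact: ip_cont uhh ugh rP|exact: ip_cont].
- by apply: cont_onD; apply: cont_onM => //; exact: cont_on_cst.
- move=> t.
  have -> : u (circ r t) * h (circ r t) * (u (circ r t) * g (circ r t))^* -
      h (circ r t) * (g (circ r t))^* =
      (cmod (u (circ r t)) ^+ 2 - 1)%:C * (h (circ r t) * (g (circ r t))^*).
    by rewrite rmorphM mulrACA mulc_conj rmorphB rmorph1 mulrBl mul1r.
  rewrite /s mulc_conj -!rmorphM -rmorphD cRe_real !cmodM cmod_conj cmod_real.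
  have hb : cmod (h (circ r t)) <= H.
    by apply: hH; rewrite cmod_circ; have /andP[] := rP.
  have := cmod_ge0 (g (circ r t)); have := cmod_ge0 (h (circ r t)).
  move: hb; move: (cmod (u _)) (cmod (h _)) (cmod (g _)) => U a b aH a0 b0.
  have -> : (1 - U ^+ 2) ^+ 2 = `|U ^+ 2 - 1| ^+ 2 by rewrite real_normK ?num_real //; ring.
  have := normr_ge0 (U ^+ 2 - 1); move: (`|_|) => S S0.
  have SB : S * b <= T * S ^+ 2 + b ^+ 2 / T.
    rewrite -(ler_pM2r T0) mulrDl divfK ?gt_eqF //.
    have := sqr_ge0 (T * S - b); have := mulr_ge0 (ltW T0) (mulr_ge0 S0 b0).
    rewrite sqrrB !expr2 mulr2n; lra.
  apply: le_trans (_ : H * (S * b) <= _).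
    by rewrite mulrCA ler_wpM2r ?mulr_ge0.
  apply: le_trans (ler_wpM2l H0 SB) _.
  have -> : H * (T * S ^+ 2 + b ^+ 2 / T) = H * T * S ^+ 2 + H / T * b ^+ 2.
    by field; exact: lt0r_neq0.
  exact: lexx.
rewrite avgD ?avgM //; [|by apply: cont_onM => //; exact: cont_on_cst..].
rewrite cReD [Re ((H * T)%:C * _)]cRe_realM [Re ((H / T)%:C * _)]cRe_realM.
have := mean_le_coef gh rP' gG; rewrite -/(ip r g g) => gg.
have h1 : H * T * Re (avg s) <= e / 2.
  apply: le_trans (_ : H * T * (e / (2 * (H * T + 1))) <= _).
    by rewrite ler_wpM2l // mulr_ge0 // ltW.
  rewrite mulrA ler_pdivrMr //.
  by have := mulr_ge0 H0 (ltW T0); move: (H * T) => X X0; lra.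
have h2 : H / T * Re (ip r g g) <= e / 2.
  apply: le_trans (_ : H / T * G <= _); first by rewrite ler_wpM2l // divr_ge0 // ltW.
  rewrite mulrAC ler_pdivrMr // /T mulrDr mulr1.
  have -> : e / 2 * (2 * H * G / e) = H * G by field; exact: lt0r_neq0.
  by rewrite lerDl divr_ge0 // ltW.
by apply: le_trans (lerD h1 h2) _; rewrite -splitr.
Qed.

End Kernels.

(** * The model space and its kernels *)

Section Model.
Context {R : realType}.
Local Notation rseq := (@rseq R).
Local Notation rseqP := (@rseqP R).
Local Notation rseq_ge0 := (@rseq_ge0 R).
Implicit Types (f g h p q u : R[i] -> R[i]) (w z : R[i]).

Lemma szego_coef_le w : cmod w < 1 -> forall m,
  \sum_(k < m) cmod (taylor_coef (szego w) k) ^+ 2 <= (1 - cmod w ^+ 2)^-1.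
Proof.
move=> w1; apply: coef_sum_le; first exact: hol_szego.
move=> e e0; apply: nearW => n; apply: le_trans (ip_szego_le w1 (rseqP n)) _.
by rewrite lerDl ltW.
Qed.

(** With [k] the Szego kernel at [w], the value [u w * k w] is the limit of the
    inner products of [u * k] and [k], and [u * k] has the same norm as [k] by
    [ip_isometry]. As the squared norm of [k] is at most [k w], the inequality
    [ip_amgm] gives [|u w| * k w <= k w]. *)
Lemma inner_le1 u w : inner_function u -> cmod w < 1 -> cmod (u w) <= 1.
Proof.
move=> uin w1; have [/holP uh _ _] := uin; have kh := hol_szego w1.
have ukh := holM uh kh.
pose K : R := (1 - cmod w ^+ 2)^-1.
have K0 : 0 < K by rewrite invr_gt0 subr_gt0 exprn_ilt1 ?cmod_ge0.
suff H : cmod (u w) * K <= 1 * K by move: H; rewrite ler_pM2r.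
apply/ler_addgt0Pr => e e0; have e20 : 0 < e / 2 by rewrite divr_gt0.
have kb z : cmod z < 1 -> cmod (szego w z) <= (1 - cmod w)^-1.
  by move=> z1; exact: szego_bound w1 (ltW z1).
near \oo => n.
have n1 : cmod (ip (rseq n) (fun z => u z * szego w z) (fun z => u z * szego w z) -
    ip (rseq n) (szego w) (szego w)) <= e / 2.
  by near: n; exact: (ip_isometry uin kh kh kb (szego_coef_le w1) e20).
have n2 : cmod (u ((rseq n * rseq n)%:C * w) * szego w ((rseq n * rseq n)%:C * w) -
    u w * szego w w) <= e / 2.
  by near: n; exact: (near_shrink ukh w1 e20).
have kk := ip_szego_le w1 (rseqP n).
have := ip_amgm ukh kh (rseq_ge0 n).
rewrite (ip_szego ukh (rseqP n) w1) => am.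
have := cmodBl (u w * szego w w) (u ((rseq n * rseq n)%:C * w) * szego w ((rseq n * rseq n)%:C * w)).
rewrite cmodBC => /le_trans /(_ n2).
have -> : cmod (u w * szego w w) = cmod (u w) * K.
  by rewrite cmodM szego_diag cmod_real ger0_norm // ltW.
have := le_trans (cmod_Re _) n1; rewrite cReB ler_norml => /andP[_].
rewrite -/K in kk; move: am kk.
move: (Re (ip _ _ _)) (Re (ip _ _ _)) (cmod (_ * _)) => a b c; lra.
Unshelve. all: by end_near. Qed.

(** The reproducing kernel of the model space at [w]. *)
Definition model_kernel u w z : R[i] := szego w z * (1 - (u w)^* * u z).

Lemma hol_model_kernel u w : inner_function u -> cmod w < 1 -> hol (model_kernel u w).
Proof.
move=> [/holP uh _ _] w1; apply: holM; first exact: hol_szego.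
by apply: holB; [exact: hol_cst|apply: holM => //; exact: hol_cst].
Qed.

Lemma cmod_one_sub u w z : inner_function u -> cmod w < 1 -> cmod z < 1 ->
  cmod (1 - (u w)^* * u z) <= 2.
Proof.
move=> uin w1 z1; apply: le_trans (cmodB _ _) _; rewrite cmod1 cmodM cmod_conj.
have : cmod (u w) * cmod (u z) <= 1.
  by rewrite mulr_ile1 ?cmod_ge0 ?inner_le1.
by move: (_ * _) => x; lra.
Qed.

Lemma model_kernel_coef_le u w : inner_function u -> cmod w < 1 -> forall m,
  \sum_(k < m) cmod (taylor_coef (model_kernel u w) k) ^+ 2 <=
  4 * (1 - cmod w ^+ 2)^-1.
Proof.
move=> uin w1; have fh := hol_model_kernel uin w1; have kh := hol_szego w1.
apply: coef_sum_le => // e e0; apply: nearW => n.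
apply: le_trans (_ : 4 * (1 - cmod w ^+ 2)^-1 <= _); last by rewrite lerDl ltW.
apply: le_trans (ler_wpM2l _ (ip_szego_le w1 (rseqP n))); last by [].
have ck := ip_cont kh kh (rseq_ge0 n).
rewrite -cRe_realM /ip -avgM //; apply: le_avg_Re => [||t].
- exact: (ip_cont fh fh (rseq_ge0 n)).
- by apply: cont_onM => //; exact: cont_on_cst.
rewrite !mulc_conj -rmorphM !cRe_real /model_kernel cmodM exprMn mulrC.
rewrite ler_wpM2r ?sqr_ge0 //.
have -> : 4 = 2 ^+ 2 :> R by ring.
rewrite lerXn2r ?nnegrE ?cmod_ge0 // cmod_one_sub //.
by rewrite cmod_circ; have /andP[] := rseq_ge0 n.
Qed.

Lemma mul_coef_le u g G : inner_function u -> hol g ->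
  (forall n, \sum_(k < n) cmod (taylor_coef g k) ^+ 2 <= G) ->
  forall m, \sum_(k < m) cmod (taylor_coef (fun z => u z * g z) k) ^+ 2 <= G.
Proof.
move=> uin gh gG; have [/holP uh _ _] := uin; have ugh := holM uh gh.
apply: coef_sum_le => // e e0; apply: nearW => n.
apply: le_trans (_ : G <= _); last by rewrite lerDl ltW.
apply: le_trans (mean_le_coef gh (rseqP n) gG).
apply: le_avg_Re => [||t]; [exact: (ip_cont ugh ugh (rseq_ge0 n))|exact: (ip_cont gh gh (rseq_ge0 n))|].
rewrite !mulc_conj !cRe_real cmodM exprMn ler_piMl ?sqr_ge0 //.
rewrite exprn_ile1 ?cmod_ge0 // inner_le1 //.
by rewrite cmod_circ; have /andP[] := rseq_ge0 n.
Qed.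

Lemma hardy_norm2_le f G : (forall n, \sum_(k < n) cmod (taylor_coef f k) ^+ 2 <= G) ->
  (hardy_norm2 f <= G%:E)%E.
Proof.
move=> fG; rewrite /hardy_norm2; apply: lime_le.
  by apply: is_cvg_nneseries => n _ _; rewrite lee_fin sqr_ge0.
apply: nearW => n; rewrite sumEFin lee_fin.
by rewrite big_mkord; exact: fG.
Qed.

Lemma hardy_coef_le g : hardy_space g -> hol g /\
  exists G, forall n, \sum_(k < n) cmod (taylor_coef g k) ^+ 2 <= G.
Proof.
move=> [/holP gh gfin]; split => //.
have g0 : (0 <= hardy_norm2 g)%E.
  by apply: nneseries_ge0 => n _ _; rewrite lee_fin sqr_ge0.
exists (fine (hardy_norm2 g)) => n.
rewrite -lee_fin fineK ?ge0_fin_numE //.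
rewrite -(big_mkord xpredT (fun k => cmod (taylor_coef g k) ^+ 2)) -sumEFin.
by apply: nneseries_lim_ge => k _ _; rewrite lee_fin sqr_ge0.
Qed.

(** The kernel is [k - conj (u w) * (u * k)] with [k] the Szego kernel. The inner
    product of [k] and [u * g] tends to [conj (u w * g w)]; by [ip_isometry] that
    of [u * k] and [u * g] has the limit of that of [k] and [g], which is
    [conj (g w)]. *)
Lemma ip_small u w g G : inner_function u -> cmod w < 1 -> hol g ->
  (forall n, \sum_(k < n) cmod (taylor_coef g k) ^+ 2 <= G) ->
  forall e, 0 < e -> \forall n \near \oo,
    cmod (ip (rseq n) (model_kernel u w) (fun z => u z * g z)) <= e.
Proof.
move=> uin w1 gh gG e e0; have [/holP uh _ _] := uin; have kh := hol_szego w1.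
have ugh := holM uh gh; have ukh := holM uh kh.
have kb z : cmod z < 1 -> cmod (szego w z) <= (1 - cmod w)^-1.
  by move=> z1; exact: szego_bound w1 (ltW z1).
have e30 : 0 < e / 3 by rewrite divr_gt0.
near=> n.
have n1 : cmod (ip (rseq n) (fun z => u z * szego w z) (fun z => u z * g z) -
    ip (rseq n) (szego w) g) <= e / 3.
  by near: n; exact: (ip_isometry uin kh gh kb gG e30).
have n2 : cmod (u ((rseq n * rseq n)%:C * w) * g ((rseq n * rseq n)%:C * w) -
    u w * g w) <= e / 3.
  by near: n; exact: (near_shrink ugh w1 e30).
have n3 : cmod (g ((rseq n * rseq n)%:C * w) - g w) <= e / 3.
  by near: n; exact: (near_shrink gh w1 e30).
have rP := rseq_ge0 n; have rP' := rseqP n.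
set r := rseq n in n1 n2 n3 rP rP' *.
have E1 : ip r (model_kernel u w) (fun z => u z * g z) =
    ip r (szego w) (fun z => u z * g z) -
    (u w)^*%R * ip r (fun z => u z * szego w z) (fun z => u z * g z).
  rewrite /ip -avgM; last exact: (ip_cont ukh ugh rP).
  rewrite -avgB; [|exact: (ip_cont kh ugh rP)|].
    by apply: eq_avg => t; rewrite /model_kernel; ring.
  by apply: cont_onM; [exact: cont_on_cst|exact: (ip_cont ukh ugh rP)].
have E2 : ip r (szego w) (fun z => u z * g z) =
    (u ((r * r)%:C * w) * g ((r * r)%:C * w))^*%R.
  by rewrite (ip_sym kh ugh rP) (ip_szego ugh rP' w1).
have E3 : ip r (szego w) g = (g ((r * r)%:C * w))^*%R.
  by rewrite (ip_sym kh gh rP) (ip_szego gh rP' w1).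
have -> : ip r (model_kernel u w) (fun z => u z * g z) =
    (u ((r * r)%:C * w) * g ((r * r)%:C * w) - u w * g w)^*%R -
    (u w)^*%R * (g ((r * r)%:C * w) - g w)^*%R -
    (u w)^*%R * (ip r (fun z => u z * szego w z) (fun z => u z * g z) - ip r (szego w) g).
  rewrite E1 E2 E3 !(rmorphB, rmorphM) /=.
  by move: (ip _ _ _) => X; ring.
apply: le_trans (cmodB _ _) _; apply: le_trans (lerD (cmodB _ _) (lexx _)) _.
rewrite !cmodM !cmod_conj; have uw := inner_le1 uin w1.
have a1 := le_trans (ler_piMl (cmod_ge0 (g ((r * r)%:C * w) - g w)) uw) n3.
have a2 := le_trans (ler_piMl (cmod_ge0 (ip r (fun z => u z * szego w z)
  (fun z => u z * g z) - ip r (szego w) g)) uw) n1.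
by apply: le_trans (lerD (lerD n2 a1) a2) _; lra.
Unshelve. all: by end_near. Qed.

Theorem model_kernel_in u w : inner_function u -> cmod w < 1 ->
  model_space u (model_kernel u w).
Proof.
move=> uin w1; have fh := hol_model_kernel uin w1.
have fK := model_kernel_coef_le uin w1.
split.
  split; first exact/holP.
  exact: le_lt_trans (hardy_norm2_le fK) (ltry _).
move=> g /hardy_coef_le[gh [G gG]].
have [/holP uh _ _] := uin; have ugh := holM uh gh.
have ugG := mul_coef_le uin gh gG.
rewrite /hardy_dot; apply/cvg_lim => //; apply/cvgrPdist_le => e e0.
have [eE re0] := gt0_complex e0.
have e20 : 0 < Re e / 2 by rewrite divr_gt0.
have [N NP] := ip_abel fh ugh fK ugG e20.
exists N => // m /= Nm; rewrite eE sub0r normrN normC_cmod lecR.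
rewrite /series /= big_mkord.
near \oo => n.
have n1 : cmod (ip (rseq n) (model_kernel u w) (fun z => u z * g z) -
  \sum_(k < m) taylor_coef (model_kernel u w) k *
     (taylor_coef (fun z => u z * g z) k)^*) <= Re e / 2.
  by near: n; exact: NP.
have n2 : cmod (ip (rseq n) (model_kernel u w) (fun z => u z * g z)) <= Re e / 2.
  by near: n; exact: (ip_small uin w1 gh gG e20).
rewrite cmodBC in n1; have := le_trans (cmodBl _ _) n1.
by move: n2; move: (cmod _) (cmod _) => a b; lra.
Unshelve. all: by end_near. Qed.

End Model.

(** * The Schwarz-Pick inequality *)

Section SchwarzPick.
Context {R : realType}.
Local Notation rseq := (@rseq R).
Local Notation rseqP := (@rseqP R).
Local Notation rseq_ge0 := (@rseq_ge0 R).
Implicit Types (f g h p q u v : R[i] -> R[i]) (w z s : R[i]).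

Lemma taylor_coef0 f : taylor_coef f 0 = f 0.
Proof. by rewrite /taylor_coef fact0 divr1. Qed.

Lemma taylor_coef1 f d : is_cderiv f 0 d -> taylor_coef f 1 = d.
Proof.
move=> fd; rewrite /taylor_coef divr1.
exact: (cderiv_derive1 fd).
Qed.

(** The cross terms are multiples of the mean of the identity function, which is
    its value at [0]. *)
Lemma ip_affine_le a b n :
  Re (ip (rseq n) (fun s => a + b * s) (fun s => a + b * s)) <= cmod a ^+ 2 + cmod b ^+ 2.
Proof.
have rP := rseq_ge0 n; have /andP[r0 r1] := rseqP n; set r := rseq n in rP r0 r1 *.
pose c := b * a^*.
have cc : on_circle (fun t => c * circ r t).
  by apply: cont_onM; [exact: cont_on_cst|exact: on_circle_circ].
have avg_circ : avg (circ r) = 0.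
  have p0 : cmod (0 : R[i]) < r by rewrite cmod0.
  apply: (@circle_mean_center _ (fun z => z) 0 r r0 p0) => z.
    by move=> _; exact: cderiv_cont (cderiv_id z).
  by move=> _ _; eexists; exact: cderiv_id.
have -> : ip r (fun s => a + b * s) (fun s => a + b * s) =
    avg (fun t => (cmod a ^+ 2 + cmod b ^+ 2 * r ^+ 2)%:C + (c * circ r t + (c * circ r t)^*)).
  apply: eq_avg => t.
  have xx : circ r t * (circ r t)^* = (r ^+ 2)%:C by rewrite mulc_conj cmod_circ // ltW.
  have -> : (cmod a ^+ 2 + cmod b ^+ 2 * r ^+ 2)%:C =
      a * a^* + b * b^* * (circ r t * (circ r t)^*).
    by rewrite xx !mulc_conj rmorphD [X in _ + X]rmorphM.
  have -> : (a + b * circ r t)^*%R = a^* + b^* * (circ r t)^*.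
    by rewrite rmorphD rmorphM.
  have -> : (c * circ r t)^*%R = b^* * a * (circ r t)^*.
    by rewrite [LHS]rmorphM; congr (_ * _); rewrite [LHS]rmorphM; congr (_ * _); exact: conjcK.
  by rewrite /c; ring.
have cj := cont_on_conj cc.
rewrite avgD; [|exact: cont_on_cst|exact: cont_onD].
rewrite avgD // avg_cst avg_conj // avgM; last exact: on_circle_circ.
rewrite avg_circ mulr0 conjc0 !addr0 cRe_real lerD2l ler_piMr ?sqr_ge0 //.
by rewrite exprn_ile1 ?ltW.
Qed.

(** Multiplication by [v] does not increase the norm of [a + b s]; looking at
    the first two Taylor coefficients of the product gives a two by two
    contraction, whose best instance is the Schwarz-Pick inequality at [0]. *)
Lemma contraction2 v d a b : hol v -> (forall z, cmod z < 1 -> cmod (v z) <= 1) ->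
  is_cderiv v 0 d ->
  cmod (v 0 * a) ^+ 2 + cmod (d * a + v 0 * b) ^+ 2 <= cmod a ^+ 2 + cmod b ^+ 2.
Proof.
move=> vh v1 vd; pose l s := a + b * s.
have ld z : is_cderiv l z (0 + b * 1).
  by apply: cderivD; [exact: cderiv_cst|exact/cderivZ/cderiv_id].
have lh : hol l by move=> z _; eexists; exact: ld.
have ph := holM vh lh.
have H : forall m, \sum_(k < m) cmod (taylor_coef (fun z => v z * l z) k) ^+ 2 <=
    cmod a ^+ 2 + cmod b ^+ 2.
  apply: coef_sum_le => // e e0; apply: nearW => n.
  apply: le_trans (_ : cmod a ^+ 2 + cmod b ^+ 2 <= _); last by rewrite lerDl ltW.
  apply: le_trans (ip_affine_le a b n).
  apply: le_avg_Re => [||t].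
  - exact: (ip_cont ph ph (rseq_ge0 n)).
  - exact: (ip_cont lh lh (rseq_ge0 n)).
  rewrite !mulc_conj !cRe_real cmodM exprMn ler_piMl ?sqr_ge0 //.
  rewrite exprn_ile1 ?cmod_ge0 // v1 //.
  by rewrite cmod_circ; have /andP[] := rseq_ge0 n.
have := H 2%N; rewrite !big_ord_recr big_ord0 /= add0r taylor_coef0.
rewrite (taylor_coef1 (cderivM vd (ld 0))).
by rewrite /l mulr0 addr0 mulr1 add0r.
Qed.

Lemma one_sub_sqr z : (1 - cmod z ^+ 2)%:C = 1 - z * z^*.
Proof. by rewrite mulc_conj -(rmorph1 (real_complex R)) -rmorphB. Qed.

(** The instance [a = 1 - |v 0|^2], [b = conj (v 0) * d] of [contraction2] makes
    its second component equal to [d]; when [|v 0| = 1] the instance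
    [a = 1], [b = 0] is needed. *)
Lemma schwarz_pick0 v d : hol v -> (forall z, cmod z < 1 -> cmod (v z) <= 1) ->
  is_cderiv v 0 d -> cmod d <= 1 - cmod (v 0) ^+ 2.
Proof.
move=> vh v1 vd.
have := contraction2 1 0 vh v1 vd; rewrite !mulr1 mulr0 addr0 cmod1 cmod0 expr0n addr0 expr1n => H1.
have := contraction2 (1 - cmod (v 0) ^+ 2)%:C ((v 0)^* * d) vh v1 vd.
have -> : d * (1 - cmod (v 0) ^+ 2)%:C + v 0 * ((v 0)^* * d) = d.
  by rewrite one_sub_sqr; ring.
rewrite !cmodM cmod_conj cmod_real real_normK ?num_real // !exprMn real_normK ?num_real //.
have := cmod_ge0 (v 0); have := cmod_ge0 d.
move: H1; move: (cmod (v 0)) (cmod d) => a b H1 b0 a0 H.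
have [a1|a1] := ltrP a 1.
  have a2 : 0 < 1 - a ^+ 2 by rewrite subr_gt0 exprn_ilt1.
  rewrite -(@ler_pXn2r _ 2) ?nnegrE ?(ltW a2) //.
  rewrite -(ler_pM2l a2); move: H; nra.
by nra.
Qed.

(** The automorphism of the disc that sends [0] to [w]. *)
Definition moebius w s : R[i] := (s + w) / (1 + w^* * s).

Lemma moebius_den w s : cmod w < 1 -> cmod s < 1 -> 1 + w^* * s != 0.
Proof.
move=> w1 s1; rewrite -cmod_gt0.
have := cmodBl 1 (- (w^* * s)); rewrite opprK cmod1 cmodN cmodM cmod_conj.
have : cmod w * cmod s < 1 by rewrite mulr_ilt1 ?cmod_ge0.
by move: (_ * _) (cmod _) => x y; lra.
Qed.

Lemma cmod_moebius w s : cmod w < 1 -> cmod s < 1 -> cmod (moebius w s) < 1.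
Proof.
move=> w1 s1; have n0 := moebius_den w1 s1.
rewrite /moebius cmodM cmodV ltr_pdivrMr ?cmod_gt0 // mul1r.
rewrite -(@ltr_pXn2r _ 2) ?nnegrE ?cmod_ge0 //.
have w2 : 0 < 1 - cmod w ^+ 2 by rewrite subr_gt0 exprn_ilt1 ?cmod_ge0.
have s2 : 0 < 1 - cmod s ^+ 2 by rewrite subr_gt0 exprn_ilt1 ?cmod_ge0.
have := mulr_gt0 w2 s2; rewrite !cmod_sqr.
case: w {w1 n0 w2} => a b; case: s {s1 s2} => c d /=; nra.
Qed.

Lemma cderiv_moebius w s : cmod w < 1 -> cmod s < 1 -> exists d, is_cderiv (moebius w) s d.
Proof.
move=> w1 s1; eexists; apply: cderivM.
  by apply: cderivD; [exact: cderiv_id|exact: cderiv_cst].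
apply: (@cderiv_comp _ (fun x => x^-1) (fun s => 1 + w^* * s)).
  exact/cderivV/moebius_den.
by apply: cderivD; [exact: cderiv_cst|exact/cderivZ/cderiv_id].
Qed.

Lemma cderiv_moebius0 w : is_cderiv (moebius w) 0 (1 - cmod w ^+ 2)%:C.
Proof.
have -> : (1 - cmod w ^+ 2)%:C = (1 + 0) * (1 + w^* * 0)^-1 +
    (0 + w) * (- ((1 + w^* * 0) ^+ 2)^-1 * (0 + w^* * 1)).
  by rewrite mulr0 !addr0 expr1n invr1 one_sub_sqr; ring.
apply: cderivM.
  by apply: cderivD; [exact: cderiv_id|exact: cderiv_cst].
apply: (@cderiv_comp _ (fun x => x^-1) (fun s => 1 + w^* * s)).
  by apply: cderivV; rewrite mulr0 addr0 oner_eq0.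
by apply: cderivD; [exact: cderiv_cst|exact/cderivZ/cderiv_id].
Qed.

Lemma hol_moebius u w : hol u -> cmod w < 1 -> hol (fun s => u (moebius w s)).
Proof.
move=> uh w1 s s1; have [d md] := cderiv_moebius w1 s1.
have [c uc] := uh _ (cmod_moebius w1 s1).
by eexists; exact: cderiv_comp uc md.
Qed.

Lemma moebius0 w : moebius w 0 = w.
Proof. by rewrite /moebius mulr0 add0r addr0 divr1. Qed.

(** [moebius z] brings the point [z] to the origin. *)
Lemma schwarz_pick u z d : hol u -> (forall z, cmod z < 1 -> cmod (u z) <= 1) ->
  cmod z < 1 -> is_cderiv u z d ->
  cmod d * (1 - cmod z ^+ 2) <= 1 - cmod (u z) ^+ 2.
Proof.
move=> uh u1 z1 ud.
have vh := hol_moebius uh z1.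
have v1 s : cmod s < 1 -> cmod (u (moebius z s)) <= 1.
  by move=> s1; apply: u1; exact: cmod_moebius.
have ud' : is_cderiv u (moebius z 0) d by rewrite moebius0.
have := schwarz_pick0 vh v1 (cderiv_comp ud' (cderiv_moebius0 z)).
rewrite moebius0 cmodM cmod_real ger0_norm //.
by rewrite subr_ge0 exprn_ile1 ?cmod_ge0 ?ltW.
Qed.

(** The Taylor coefficients of [v] are bounded by [1], so the series without its
    constant term is dominated by a geometric series. *)
Lemma bounded_near0 v s : hol v -> (forall z, cmod z < 1 -> cmod (v z) <= 1) ->
  cmod s < 1 -> cmod (v s - v 0) * (1 - cmod s) <= cmod s.
Proof.
move=> vh v1 s1; have s0 := cmod_ge0 s; have s10 : 0 < 1 - cmod s by rewrite subr_gt0.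
have H : forall m, \sum_(k < m) cmod (taylor_coef v k) ^+ 2 <= 1.
  apply: coef_sum_le => // e e0; apply: nearW => n.
  apply: le_trans (_ : 1 <= _); last by rewrite lerDl ltW.
  have -> : 1 = Re (avg (fun _ : R => (1 : R[i]))) by rewrite avg_cst.
  apply: le_avg_Re => [||t].
  - exact: (ip_cont vh vh (rseq_ge0 n)).
  - exact: cont_on_cst.
  rewrite mulc_conj cRe_real /= exprn_ile1 ?cmod_ge0 // v1 //.
  by rewrite cmod_circ; have /andP[] := rseq_ge0 n.
have ck k : cmod (taylor_coef v k) <= 1.
  rewrite -(@ler_pXn2r _ 2) ?nnegrE ?cmod_ge0 // expr1n.
  apply: le_trans (H k.+1); rewrite big_ord_recr /= lerDr.
  by apply: sumr_ge0 => i _; exact: sqr_ge0.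
rewrite -ler_pdivlMr //; apply/ler_addgt0Pr => e e0.
have [N NP] := taylor_series vh s1 e0.
have := NP N.+1 (leqnSn N).
rewrite big_ord_recl taylor_coef0 expr0 mulr1 => NP1.
set S := \sum_(i < N) _ in NP1.
have SB : cmod S <= cmod s / (1 - cmod s).
  apply: le_trans (cmod_sum _ _ _) _.
  apply: le_trans (_ : \sum_(i < N) cmod s ^+ i.+1 <= _).
    apply: ler_sum => i _; rewrite cmodM cmodX ler_piMl ?exprn_ge0 //.
  rewrite ler_pdivlMr // mulr_suml.
  have : \sum_(i < N) cmod s ^+ i.+1 * (1 - cmod s) = cmod s - cmod s ^+ N.+1.
    elim: N {NP NP1 S} => [|n IH]; first by rewrite big_ord0 expr1 subrr.
    by rewrite big_ord_recr /= IH mulrBr mulr1 [cmod s ^+ n.+1 * cmod s]mulrC -exprS addrA subrK.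
  by move=> ->; rewrite gerBl exprn_ge0.
rewrite (_ : v s - v 0 = (v s - (v 0 + S)) + S); last by ring.
by apply: le_trans (cmodD _ _) _; rewrite addrC lerD.
Qed.

End SchwarzPick.

(** * Kernels of the model space vary fast near their pole *)

Section Lower.
Context {R : realType}.
Implicit Types (u : R[i] -> R[i]) (w z : R[i]).

Lemma cderiv_model_kernel u w z d : cmod w < 1 -> cmod z < 1 -> is_cderiv u z d ->
  is_cderiv (model_kernel u w) z
    (w^* / (1 - w^* * z) ^+ 2 * (1 - (u w)^* * u z) +
     szego w z * (0 - (u w)^* * d)).
Proof.
move=> w1 z1 ud; apply: cderivM; first exact: cderiv_szego w1 (ltW z1).
by apply: cderivB; [exact: cderiv_cst|exact: cderivZ].
Qed.

Lemma moebius_inv w z : cmod w < 1 -> cmod z < 1 ->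
  moebius w ((z - w) / (1 - w^* * z)) = z.
Proof.
move=> w1 z1; have n0 := szego_den0 w1 (ltW z1).
have n1 : 1 - w^* * w != 0 by exact: szego_den0 w1 (ltW w1).
rewrite /moebius.
have -> : 1 + w^* * ((z - w) / (1 - w^* * z)) = (1 - w^* * w) / (1 - w^* * z).
  by field.
have -> : (z - w) / (1 - w^* * z) + w = z * (1 - w^* * w) / (1 - w^* * z).
  by field.
by field; rewrite n0 n1.
Qed.

(** Near [w] on the scale of its distance to the circle, [u] is nearly constant:
    in the coordinate [moebius w] the point [z] has modulus at most [e]. *)
Lemma inner_near u w z e : inner_function u -> cmod w < 1 -> cmod z < 1 ->
  0 < e <= 1 / 2 -> cmod (z - w) <= e * (1 - cmod w) -> cmod (u z - u w) <= 2 * e.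
Proof.
move=> uin w1 z1 /andP[e0 e1] zw; have [/holP uh _ _] := uin.
set s := (z - w) / (1 - w^* * z).
have dw : 0 < 1 - cmod w by rewrite subr_gt0.
have se : cmod s <= e.
  rewrite /s cmodM cmodV ler_pdivrMr; last by rewrite cmod_gt0 szego_den0 // ltW.
  apply: le_trans zw _; rewrite ler_wpM2l ?(ltW e0) //.
  exact: szego_den w1 (ltW z1).
have s1 : cmod s < 1 by lra.
have vh := hol_moebius uh w1.
have v1 x : cmod x < 1 -> cmod (u (moebius w x)) <= 1.
  by move=> x1; apply: inner_le1 => //; exact: cmod_moebius.
have := bounded_near0 vh v1 s1; rewrite moebius0 moebius_inv //.
have := cmod_ge0 (u z - u w); move: (cmod _) => x x0 H.
have : x * (1 / 2) <= x * (1 - cmod s) by rewrite ler_wpM2l //; lra.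
lra.
Qed.

(** The derivative of the kernel has two terms,
    [conj w * (1 - conj (u w) * u z) / (1 - conj w * z)^2] and
    [conj (u w) * u' z / (1 - conj w * z)]. For [z = w], and up to the common
    factor [(1 - |u w|^2) / (1 - |w|^2)^2], the first one has modulus [|w|] and
    the second one at most [|u w|] by the Schwarz-Pick inequality. As [|w|] is
    closer to [1] than [|u w|], the first one dominates, and this persists for
    [z] close to [w]. *)
Lemma model_kernel_deriv_lower u w z t : inner_function u -> cmod w < 1 ->
  0 < t <= 1 -> cmod (u w) <= 1 - t -> 1 - cmod w <= t / 4 ->
  cmod (z - w) <= t ^+ 2 / 16 * (1 - cmod w) ->
  cmod z < 1 /\
  t ^+ 2 / 36 / (1 - cmod w) ^+ 2 <= cmod (derive1 (model_kernel u w) z).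
Proof.
move=> uin w1 /andP[t0 t1] uw wt zw; have [/holP uh _ _] := uin.
set e := t ^+ 2 / 16 in zw; set d := 1 - cmod w in wt zw *.
have t20 : 0 < t ^+ 2 by rewrite exprn_gt0.
have t21 : t ^+ 2 <= 1 by rewrite exprn_ile1 // ltW.
have e0 : 0 < e by rewrite divr_gt0.
have e16 : e <= 1 / 16 by rewrite /e; lra.
have d0 : 0 < d by rewrite subr_gt0.
have ed : e * d <= d / 16 by have := ler_wpM2r (ltW d0) e16; lra.
have zl : cmod z <= cmod w + e * d.
  by have := cmodBl z w; lra.
have zl' : cmod w - e * d <= cmod z.
  by have := cmodBl w z; rewrite cmodBC; lra.
have z1 : cmod z < 1 by rewrite /d in d0 ed zl; lra.
split => //; have [c uc] := uh z z1.
rewrite (cderiv_derive1 (cderiv_model_kernel w1 z1 uc)).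
have n0 := szego_den0 w1 (ltW z1).
pose D := cmod (1 - w^* * z).
have D0 : 0 < D by rewrite cmod_gt0.
pose P := 1 - cmod z ^+ 2.
have P0 : 0 < P by rewrite subr_gt0 exprn_ilt1 ?cmod_ge0.
have z0 := cmod_ge0 z.
have Pl : d - e * d <= P.
  have : cmod z ^+ 2 <= cmod z by rewrite expr2 ler_piMr // ltW.
  by rewrite /P /d in zl *; lra.
have Pu : P <= 2 * (d + e * d).
  have : 1 - cmod z ^+ 2 = (1 - cmod z) * (1 + cmod z) by ring.
  rewrite -/P => ->.
  have : 1 - cmod z <= d + e * d by rewrite /d in zl' *; lra.
  have : 0 < 1 - cmod z by lra.
  by move: (1 - cmod z) (d + _) => x y; nra.
have DP : D <= P + e * d.
  have -> : D = cmod (P%:C + (z - w)^* * z).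
    by rewrite /P one_sub_sqr /D rmorphB; congr cmod; ring.
  apply: le_trans (cmodD _ _) _; rewrite cmod_real gtr0_norm // lerD2l.
  rewrite cmodM cmod_conj; apply: le_trans zw.
  by rewrite ler_piMr ?cmod_ge0 // ltW.
have D3 : D <= 3 * d by lra.
have sp := schwarz_pick uh (fun x => inner_le1 uin (w := x)) z1 uc.
have e12 : 0 < e <= 1 / 2 by rewrite e0 /=; lra.
have near := inner_near uin w1 z1 e12 zw.
set a := cmod (u w) in uw *; set b := cmod (u z) in sp *.
have a0 : 0 <= a by exact: cmod_ge0. have b0 : 0 <= b by exact: cmod_ge0.
have b1 : b <= 1 by exact: inner_le1.
have ab : a - b <= 2 * e by apply: le_trans near; rewrite cmodBC; exact: cmodBl.
rewrite -/P in sp.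
have -> : w^* / (1 - w^* * z) ^+ 2 * (1 - (u w)^* * u z) + szego w z * (0 - (u w)^* * c) =
    (w^* * (1 - (u w)^* * u z) - (u w)^* * c * (1 - w^* * z)) / (1 - w^* * z) ^+ 2.
  by rewrite /szego; field.
rewrite cmodM cmodV cmodX -/D.
have key : t ^+ 2 / 4 <= cmod (w^* * (1 - (u w)^* * u z) - (u w)^* * c * (1 - w^* * z)).
  apply: le_trans (cmodBl _ _); rewrite !cmodM !cmod_conj -/D -/a.
  have h1 : 1 - a * b <= cmod (1 - (u w)^* * u z).
    by have := cmodBl 1 ((u w)^* * u z); rewrite cmod1 cmodM cmod_conj.
  have h2 : cmod c * D <= (1 - b ^+ 2) * (1 + 2 * e).
    apply: le_trans (_ : cmod c * (P * (1 + 2 * e)) <= _).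
      rewrite ler_wpM2l ?cmod_ge0 //; apply: le_trans DP _.
      have : e * d <= 2 * e * P.
        have : e * d <= e * (2 * P) by rewrite ler_pM2l //; lra.
        by lra.
      by lra.
    by rewrite mulrA ler_wpM2r //; lra.
  have h3 : 1 - b ^+ 2 <= 1 - a * b + 2 * e.
    have : b * (a - b) <= b * (2 * e) by rewrite ler_wpM2l.
    have : b * (2 * e) <= 2 * e by rewrite ler_piMl //; lra.
    by rewrite expr2; lra.
  have ab0 : 0 <= a * b by rewrite mulr_ge0.
  have aba : a * b <= a by rewrite ler_piMr.
  have w0 := cmod_ge0 w.
  have h4 : cmod w * (1 - a * b) <= cmod w * cmod (1 - (u w)^* * u z).
    by rewrite ler_wpM2l.
  have h5 : a * (cmod c * D) <= a * ((1 - a * b + 2 * e) * (1 + 2 * e)).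
    rewrite ler_wpM2l //; apply: le_trans h2 _; rewrite ler_wpM2r //; lra.
  have h6 : a * ((1 - a * b + 2 * e) * (1 + 2 * e)) <= a * (1 - a * b) + 6 * e.
    have x0 : 0 <= 1 - a * b <= 1 by apply/andP; split; lra.
    have a1 : a <= 1 by lra.
    have -> : a * ((1 - a * b + 2 * e) * (1 + 2 * e)) =
       a * (1 - a * b) + a * (2 * e * (1 - a * b) + 2 * e + 4 * e ^+ 2) by ring.
    rewrite lerD2l; move: x0 => /andP[x0 x1].
    have : 2 * e * (1 - a * b) <= 2 * e by rewrite ler_piMr //; lra.
    have : e ^+ 2 <= e / 16 by rewrite expr2 ler_wpM2l ?(ltW e0) //; lra.
    move=> y1 y2.
    apply: le_trans (_ : 1 * (2 * e * (1 - a * b) + 2 * e + 4 * e ^+ 2) <= _).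
      by rewrite ler_wpM2r // !addr_ge0 ?mulr_ge0 ?sqr_ge0 // ltW.
    by rewrite mul1r; lra.
  have h7 : 3 / 4 * t ^+ 2 <= (1 - a * b) * (cmod w - a).
    have : t <= 1 - a * b by lra.
    have : 3 / 4 * t <= cmod w - a by rewrite /d in wt; lra.
    move: (1 - a * b) (cmod w - a) => x y; nra.
  have -> : a * cmod c * D = a * (cmod c * D) by rewrite mulrA.
  have h8 := le_trans h5 h6.
  have e6 : 6 * e = 3 / 8 * t ^+ 2 by rewrite /e; field.
  rewrite mulrBr in h7.
  move: h4 h7 h8; rewrite e6 [(1 - a * b) * cmod w]mulrC [(1 - a * b) * a]mulrC.
  move: (cmod w * _) (cmod w * _) (a * (1 - _)) (a * (_ * _)) => x1 x2 x3 x4.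
  by clear -t20; lra.
apply: le_trans (_ : t ^+ 2 / 4 / D ^+ 2 <= _); last first.
  by rewrite ler_wpM2r // invr_ge0 sqr_ge0.
have -> : t ^+ 2 / 36 / d ^+ 2 = t ^+ 2 / 4 / (3 * d) ^+ 2.
  by field; rewrite gt_eqF.
rewrite ler_wpM2l ?divr_ge0 ?sqr_ge0 // lef_pV2 ?posrE ?exprn_gt0 ?mulr_gt0 //.
by rewrite lerXn2r ?nnegrE ?mulr_ge0 ?(ltW d0) ?(ltW D0).
Qed.

End Lower.

(** * Lower bounds for Poisson and Dirichlet integrals *)

Section Measure.
Context {R : realType}.
Implicit Types (u : R[i] -> R[i]) (w z : R[i]).

Import HBNNSimple.

(** The integral of a nonnegative function is a supremum over the simple
    functions below it, and [c] times the indicator of [S] is one of them. *)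
Lemma integral_ge_cst d (T : measurableType d) (mu : {measure set T -> \bar R})
  (D S : set T) (f : T -> \bar R) (c : R) : measurable S -> S `<=` D -> 0 <= c ->
  (forall x, D x -> (0 <= f x)%E) -> (forall x, S x -> (c%:E <= f x)%E) ->
  (c%:E * mu S <= \int[mu]_(x in D) f x)%E.
Proof.
move=> mS SD c0 f0 fc; rewrite ge0_integralE //=.
apply: le_ereal_sup_tmp.
exists (sintegral mu (scale_nnsfun (indic_nnsfun R mS) c0)); last first.
  by rewrite sintegralrM sintegral_indic.
exists (scale_nnsfun (indic_nnsfun R mS) c0) => //= x.
rewrite mindicE /patch; case: ifPn => xD.
  case: (boolP (x \in S)) => xS; first by rewrite mulr1 fc //; exact: set_mem.
  by rewrite mulr0 f0 //; exact: set_mem.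
case: (boolP (x \in S)) => xS; last by rewrite mulr0.
by move: xD; rewrite (mem_set (SD _ (set_mem xS))).
Qed.

Definition sqdist z (p : plane R) : R := (p.1 - Re z) ^+ 2 + (p.2 - Im z) ^+ 2.

Lemma sqdistE z p : sqdist z p = cmod (cplx p - z) ^+ 2.
Proof. by rewrite cmod_sqr /sqdist; case: z. Qed.

Lemma measurable_sqdist z : measurable_fun [set: plane R] (sqdist z).
Proof.
by apply: measurable_funD; apply: measurable_funX; apply: measurable_funB.
Qed.

Definition disc z (r : R) : set (plane R) := [set p | cmod (cplx p - z) < r].

Lemma measurable_disc z r : measurable (disc z r).
Proof.
have [r0|r0] := leP r 0.
  rewrite (_ : disc z r = set0) //; apply/seteqP; split => p //=.
  by rewrite /disc /= ltNge (le_trans r0) ?cmod_ge0.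
have -> : disc z r = [set: plane R] `&` sqdist z @^-1` [set` `]-oo, r ^+ 2[ ].
  apply/seteqP; split => p; rewrite /disc /= in_itv /= sqdistE.
    by move=> pr; split => //; rewrite ltr_pXn2r ?nnegrE ?cmod_ge0 ?(ltW r0).
  by move=> [_]; rewrite ltr_pXn2r ?nnegrE ?cmod_ge0 ?(ltW r0).
by apply: measurable_sqdist => //; exact: measurable_itv.
Qed.

Definition circle : set (plane R) := @cplx R @^-1` unit_circle.

Lemma measurable_circle : measurable circle.
Proof.
have -> : circle = [set: plane R] `&` sqdist 0 @^-1` [set 1].
  apply/seteqP; split => p; rewrite /circle /unit_circle /= sqdistE subr0.
    by move=> ->; rewrite expr1n.
  move=> [_ /eqP]; rewrite sqrp_eq1 ?cmod_ge0 // => /eqP //.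
by apply: measurable_sqdist => //; exact: measurable_set1.
Qed.

Definition square z (s : R) : set (plane R) :=
  `[Re z - s, Re z + s]%classic `*` `[Im z - s, Im z + s]%classic.

Lemma measurable_square z s : measurable (square z s).
Proof. by apply: measurableX; exact: measurable_itv. Qed.

Lemma measure_square z s : 0 < s ->
  (@lebesgue_measure R \x @lebesgue_measure R)%E (square z s) = ((2 * s) ^+ 2)%:E.
Proof.
move=> s0; rewrite product_measure1E; try exact: measurable_itv.
have lt x : x - s < x + s by lra.
rewrite /= !lebesgue_measure_itv /= !lte_fin !lt -!EFinB -EFinM; congr (_%:E).
by ring.
Qed.

Lemma square_near z s p : square z s p -> cmod (cplx p - z) <= 2 * s.
Proof.
move=> [/=]; rewrite !in_itv /= => /andP[a b] /andP[c d].
apply: le_trans (cmod_le_ReIm _) _; rewrite mulr_natl mulr2n; apply: lerD.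
  by rewrite cReB ler_norml /=; apply/andP; split; lra.
have -> : Im (cplx p - z) = p.2 - Im z by case: z {a b c d}.
by rewrite ler_norml; apply/andP; split; lra.
Qed.

(** Discarding the mass outside the disc [disc l r], on which the Poisson kernel
    at [z] is at least [(d / 2) / (3 * r)^2]. *)
Lemma poisson_lower (mu : {finite_measure set (plane R) -> \bar R}) z l (r d : R) :
  cmod z < 1 -> 0 < d -> 0 < r -> d / 2 <= 1 - cmod z ->
  (forall p, disc l r p -> cmod (cplx p - z) <= 3 * r) ->
  ((d / (18 * r ^+ 2))%:E * mu (circle `&` disc l r) <= poisson mu z)%E.
Proof.
move=> z1 d0 r0 dz near; have z0 := cmod_ge0 z.
have c0 : 0 <= d / (18 * r ^+ 2).
  by rewrite divr_ge0 ?(ltW d0) // mulr_ge0 // sqr_ge0.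
have pos p : 0 <= (1 - cmod z ^+ 2) / cmod (cplx p - z) ^+ 2.
  by rewrite divr_ge0 ?sqr_ge0 // subr_ge0 exprn_ile1 // ltW.
apply: integral_ge_cst.
- by apply: measurableI; [exact: measurable_circle|exact: measurable_disc].
- exact: subIsetl.
- exact: c0.
- by move=> p _; rewrite lee_fin.
move=> p [pc pd]; rewrite lee_fin.
have pz : 0 < cmod (cplx p - z).
  by have := cmodBl (cplx p) z; rewrite (pc : cmod _ = 1); lra.
rewrite ler_pdivlMr ?exprn_gt0 //.
apply: le_trans (_ : d / (18 * r ^+ 2) * (3 * r) ^+ 2 <= _).
  rewrite ler_wpM2l //.
  by rewrite lerXn2r ?nnegrE ?mulr_ge0 ?(ltW r0) ?(ltW pz) // near.
have -> : d / (18 * r ^+ 2) * (3 * r) ^+ 2 = d / 2 by field; exact: lt0r_neq0.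
apply: le_trans dz _; rewrite lerD2l lerN2 expr2 ler_piMr // ltW //.
Qed.

(** Discarding everything outside a square of side [2 * s] centered at [w]. *)
Lemma dirichlet_lower (mu : {finite_measure set (plane R) -> \bar R}) f w (s k m : R) :
  0 < s -> 0 <= k -> 0 <= m ->
  (forall z, cmod (z - w) <= 2 * s -> cmod z < 1 /\
     k <= cmod (derive1 f z) /\ (m%:E <= poisson mu z)%E) ->
  ((pi^-1 * (k ^+ 2 * m * (2 * s) ^+ 2))%:E <= dirichlet_integral mu f)%E.
Proof.
move=> s0 k0 m0 H; rewrite /dirichlet_integral EFinM.
apply: lee_wpmul2l; first by rewrite lee_fin invr_ge0 pi_ge0.
rewrite EFinM -(measure_square w s0).
have P0 (p : plane R) : cmod (cplx p) < 1 -> (0 <= poisson mu (cplx p))%E.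
  move=> p1; apply: integral_ge0 => q _; rewrite lee_fin divr_ge0 ?sqr_ge0 //.
  by rewrite subr_ge0 exprn_ile1 ?cmod_ge0 ?ltW.
apply: integral_ge_cst.
- exact: measurable_square.
- by move=> p /square_near /H[].
- by rewrite mulr_ge0 ?sqr_ge0.
- by move=> p p1; rewrite mule_ge0 ?P0 // lee_fin sqr_ge0.
move=> p /square_near /H[p1 [kf mP]].
rewrite EFinM; apply: lee_pmul; rewrite ?lee_fin ?sqr_ge0 //.
by rewrite lerXn2r ?nnegrE ?cmod_ge0.
Qed.

End Measure.

(** * Small discs around points of the boundary spectrum *)

Section Spectrum.
Context {R : realType}.
Implicit Types (u : R[i] -> R[i]) (w z l : R[i]).

Lemma dirichlet_model_kernel_le (mu : {finite_measure set (plane R) -> \bar R}) u w (C : R) :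
  inner_function u -> cmod w < 1 -> 0 < C ->
  (forall f, model_space u f ->
    (hardy_norm2 f + dirichlet_integral mu f <= C%:E * hardy_norm2 f)%E) ->
  (dirichlet_integral mu (model_kernel u w) <= (4 * C / (1 - cmod w))%:E)%E.
Proof.
move=> uin w1 C0 emb; have := emb _ (model_kernel_in uin w1).
have n0 : (0 <= hardy_norm2 (model_kernel u w))%E.
  by apply: nneseries_ge0 => n _ _; rewrite lee_fin sqr_ge0.
have nK := hardy_norm2_le (model_kernel_coef_le uin w1).
have w0 := cmod_ge0 w; have d0 : 0 < 1 - cmod w by rewrite subr_gt0.
move=> H; apply: le_trans (le_trans (leeDr _ n0) H) _.
apply: le_trans (lee_wpmul2l _ nK) _; first by rewrite lee_fin ltW.
rewrite -EFinM lee_fin mulrA [C * 4]mulrC ler_wpM2l ?mulr_ge0 ?(ltW C0) //.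
have w2 : cmod w ^+ 2 <= cmod w by rewrite expr2 ler_piMr // ltW.
rewrite lef_pV2 ?posrE //; lra.
Qed.

(** This is where the embedding is used. Apply it to the kernel at a point [w]
    close to [l]: its squared norm is [O(1/d)] with [d = 1 - |w|], while by
    [model_kernel_deriv_lower] its derivative is at least of order [1/d^2] on a
    square of side [e * d] around [w], where the Poisson integral of [mu] is at
    least of order [d / r^2] times the mass of the disc of radius [r] around
    [l]. All powers of [d] cancel. *)
Lemma disc_measure_le (mu : {finite_measure set (plane R) -> \bar R}) u (C t : R) :
  inner_function u -> 0 < C ->
  (forall f, model_space u f ->
    (hardy_norm2 f + dirichlet_integral mu f <= C%:E * hardy_norm2 f)%E) ->
  0 < t <= 1 -> exists2 K, 0 <= K & forall l r, cmod l = 1 -> 0 < r ->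
    (exists w, [/\ cmod w < 1, cmod (l - w) < r, cmod (l - w) < t / 4 & cmod (u w) <= 1 - t]) ->
    (mu (circle `&` disc l r) <= (K * r ^+ 2)%:E)%E.
Proof.
move=> uin C0 emb tP; have /andP[t0 t1] := tP.
pose e := t ^+ 2 / 16.
have t20 : 0 < t ^+ 2 by rewrite exprn_gt0.
have t21 : t ^+ 2 <= 1 by rewrite exprn_ile1 // ltW.
have e0 : 0 < e by rewrite divr_gt0.
have e16 : e <= 1 / 16 by rewrite /e; lra.
(* What remains of the lower bound of the Dirichlet integral once the powers of
   [d] and [r] are removed. *)
pose q := (t ^+ 2 / 36) ^+ 2 * e ^+ 2 / 18.
have q0 : 0 < q by rewrite divr_gt0 // mulr_gt0 ?exprn_gt0 // divr_gt0.
exists (4 * C * pi / q).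
  by rewrite divr_ge0 ?(ltW q0) // mulr_ge0 ?pi_ge0 // mulr_ge0 // ltW.
move=> l r l1 r0 [w [w1 wr wt uw]].
pose d := 1 - cmod w; have d0 : 0 < d by rewrite subr_gt0.
have dl : d <= cmod (l - w) by have := cmodBl l w; rewrite l1.
have ed : e * d <= d / 16 by have := ler_wpM2r (ltW d0) e16; lra.
have mS : measurable (circle `&` disc l r).
  by apply: measurableI; [exact: measurable_circle|exact: measurable_disc].
have [m m0 mE] : exists2 m : R, 0 <= m & mu (circle `&` disc l r) = m%:E.
  exists (fine (mu (circle `&` disc l r))); first exact: fine_ge0.
  by rewrite fineK // fin_num_measure.
rewrite mE lee_fin.
have s0 : 0 < e * d / 2 by rewrite divr_gt0 // mulr_gt0.
have k0 : 0 <= t ^+ 2 / 36 / d ^+ 2 by rewrite !divr_ge0 ?sqr_ge0.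
have m'0 : 0 <= d / (18 * r ^+ 2) * m.
  by rewrite mulr_ge0 // divr_ge0 ?(ltW d0) // mulr_ge0 // sqr_ge0.
have lower z : cmod (z - w) <= 2 * (e * d / 2) -> cmod z < 1 /\
     t ^+ 2 / 36 / d ^+ 2 <= cmod (derive1 (model_kernel u w) z) /\
     ((d / (18 * r ^+ 2) * m)%:E <= poisson mu z)%E.
  rewrite mulrC divfK // => zw.
  have dt : d <= t / 4 by lra.
  have dr : d < r by exact: le_lt_trans wr.
  have [z1 kz] := model_kernel_deriv_lower uin w1 tP uw dt zw.
  do 2 split => //; rewrite EFinM -mE; apply: poisson_lower => //.
    by have := cmodBl z w; rewrite /d in ed zw d0 *; lra.
  move=> p; rewrite /disc /= => pl.
  rewrite (_ : cplx p - z = (cplx p - l) + (l - w) - (z - w)); last by ring.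
  apply: le_trans (cmodB _ _) _; have := cmodD (cplx p - l) (l - w).
  move: pl wr zw; move: (cmod _) (cmod _) (cmod _) (cmod _) => x1 x2 x3 x4.
  by move: (e * d) ed => y; lra.
have := le_trans (dirichlet_lower s0 k0 m'0 lower)
  (dirichlet_model_kernel_le uin w1 C0 emb).
rewrite -/d lee_fin.
have -> : pi^-1 * ((t ^+ 2 / 36 / d ^+ 2) ^+ 2 * (d / (18 * r ^+ 2) * m) * (2 * (e * d / 2)) ^+ 2)
   = (q * m / (pi * r ^+ 2)) / d.
  rewrite /q; have := pi_gt0 R => /lt0r_neq0; move: (pi : R) => p p0.
  by field; rewrite p0 !lt0r_neq0.
rewrite ler_pM2r ?invr_gt0 // ler_pdivrMr ?mulr_gt0 ?pi_gt0 ?exprn_gt0 // => H.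
rewrite -[4 * C * pi / q * r ^+ 2]mulrA [q^-1 * _]mulrC mulrA ler_pdivlMr // mulrC.
by rewrite -mulrA.
Qed.

Lemma nbhs_cmod l (P : R[i] -> Prop) : nbhs l P <->
  exists2 d : R, 0 < d & forall z, cmod (l - z) < d -> P z.
Proof.
split.
  move=> /nbhs_ballP[e /= e0 H].
  have [eE re0] := gt0_complex e0.
  exists (Re e) => //.
  by move=> z zl; apply: H; rewrite -ball_normE /= normC_cmod eE ltcR.
move=> [d d0 H]; apply/nbhs_ballP; exists d%:C => /=; first by rewrite ltcR.
by move=> z; rewrite -ball_normE /= normC_cmod ltcR; exact: H.
Qed.

Definition approach u l (t : R) := forall n : nat,
  exists w, [/\ cmod w < 1, cmod (l - w) < n.+1%:R^-1 & cmod (u w) < 1 - t].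

Lemma invn_le (e : R) : 0 < e -> exists n : nat, n.+1%:R^-1 <= e.
Proof.
move=> e0; exists (Num.bound e^-1).
rewrite -[e in leRHS]invrK lef_pV2 ?posrE ?ltr0n ?invr_gt0 //.
apply: ltW; apply: lt_le_trans (archi_boundP (ltW _)) _; first by rewrite invr_gt0.
by rewrite ler_nat.
Qed.

Lemma spectrumP u l :
  (limf_einf (fun z => (cmod (u z))%:E) (within unit_disc (nbhs l)) < 1)%E <->
  exists k : nat, approach u l k.+1%:R^-1.
Proof.
rewrite /limf_einf lteNl /limf_esup; set X := ereal_inf _; split.
  move=> X1.
  have [e e0 eX] : exists2 e : R, 0 < e & ((e - 1)%:E < X)%E.
    move: X1; case: X => [x||] //=.
      move=> x1; have {}x1 : -1 < x by rewrite -lte_fin.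
      exists ((x + 1) / 2); first lra.
      by rewrite lte_fin; lra.
    by move=> _; exists 1; rewrite ?ltry.
  have [k ke] := invn_le e0; exists k => n.
  pose V := [set z : R[i] | unit_disc z /\ cmod (l - z) < n.+1%:R^-1].
  have VF : within unit_disc (nbhs l) V.
    apply/nbhs_cmod; exists n.+1%:R^-1; first by rewrite invr_gt0.
    by move=> z zl z1; split.
  have : ((e - 1)%:E < ereal_sup [set (\- (fun z => (cmod (u z))%:E))%E x | x in V])%E.
    by apply: lt_le_trans eX _; apply: ereal_inf_lbound; exists V.
  move=> /ereal_sup_gt[_ [w [w1 wl] <-]]; rewrite /= lte_fin => H.
  exists w; split => //; apply: lt_le_trans (_ : 1 - e <= _); last by rewrite lerD2l lerN2.
  by move: H; move: (cmod _) => x; lra.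
move=> [k H].
apply: lt_le_trans (_ : (k.+1%:R^-1 - 1)%:E <= _)%E.
  by rewrite (_ : (- 1)%E = (-1)%:E) // lte_fin ltrDr invr_gt0.
apply: le_ereal_inf_tmp => _ [V VF <-].
have /nbhs_cmod[d d0 dV] := VF.
have [n nd] := invn_le d0; have [w [w1 wl uw]] := H n.
apply: le_trans (_ : (- (cmod (u w))%:E <= _)%E).
  by rewrite -EFinN lee_fin lerNr opprB ltW.
by apply: ereal_sup_ubound; exists w => //; apply: dV => //; exact: lt_le_trans nd.
Qed.

End Spectrum.

(** * The boundary spectrum is a null set *)

Section Covering.
Context {R : realType}.
Implicit Types (u : R[i] -> R[i]) (w z l : R[i]).

Lemma cis_lip (a b : R) : a <= b -> cmod (cis b - cis a) <= 2 * (b - a).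
Proof.
rewrite le_eqVlt => /predU1P[->|ab]; first by rewrite !subrr cmod0 mulr0.
have lip (f df : R -> R) : (forall x : R, is_derive x (1 : R) f (df x)) ->
    continuous f -> (forall x, `|df x| <= 1) -> `|f b - f a| <= b - a.
  move=> fd cf dfb.
  have [c _ ->] := MVT ab (fun x _ => fd x) (continuous_subspaceT cf).
  by rewrite normrM [`|b - a|]ger0_norm ?subr_ge0 ?(ltW ab) // ler_piMl ?subr_ge0 ?(ltW ab).
apply: le_trans (cmod_le_ReIm _) _; rewrite mulr_natl mulr2n cReB /=.
apply: lerD.
  apply: (@lip cos (fun x => - sin x)) => [|x]; first exact: continuous_cos.
  by rewrite normrN ler_norml sin_geN1 sin_le1.
apply: (@lip sin cos) => [|x]; first exact: continuous_sin.
by rewrite ler_norml cos_geN1 cos_le1.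
Qed.

(** The lower half of the circle is reached by [2 * pi - acos x]. *)
Lemma cis_onto l : cmod l = 1 -> exists2 t, 0 <= t < 2 * pi & l = cis t.
Proof.
move=> l1; have := cmod_sqr l; rewrite l1 expr1n.
case: l l1 => x y _ /= xy.
have x1 : -1 <= x <= 1.
  by rewrite -ler_norml -(@ler_pXn2r _ 2) ?nnegrE // real_normK ?num_real // expr1n xy lerDl sqr_ge0.
have pi0 := pi_gt0 R.
have ya : Num.sqrt (1 - x ^+ 2) = `|y| by rewrite xy addrC addKr sqrtr_sqr.
have ac : 0 <= acos x <= pi by rewrite acos_ge0 // acos_lepi.
have sa : sin (acos x) = `|y| by rewrite sin_acos.
have ca : cos (acos x) = x by rewrite acosK // in_itv.
have [y0|y0] := leP 0 y.
  exists (acos x); first by lra.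
  by apply: complex_ext; rewrite /= ?ca // sa ger0_norm.
exists (2 * pi - acos x).
  have : 0 < acos x.
    rewrite lt_def; have /andP[-> _] := ac; rewrite andbT.
    by apply: contraTneq y0 => a0; move: sa; rewrite a0 sin0 -leNgt => /esym/normr0_eq0 ->.
  by lra.
rewrite cisD cis2pi mul1r.
by apply: complex_ext; rewrite /= ?cosN ?ca ?sinN ?sa // ltr0_norm // opprK.
Qed.

(** Round the argument of [l] down to a multiple of [2 * pi / N]; the factor two
    lost in [cis_lip] explains the constant. *)
Lemma circle_net l N : (0 < N)%N -> cmod l = 1 -> exists j : 'I_N,
  cmod (l - cis (2 * pi * j%:R / N%:R)) < (4 * pi + 1) / N%:R.
Proof.
move=> N0 /cis_onto[t /andP[t0 t2] ->].
have Nr : 0 < N%:R :> R by rewrite ltr0n.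
have pi0 := pi_gt0 R.
pose x := t * N%:R / (2 * pi).
have x0 : 0 <= x by rewrite divr_ge0 ?mulr_ge0 // ltW.
have xN : x < N%:R by rewrite ltr_pdivrMr ?mulr_gt0 // mulrC ltr_pM2l.
have /andP[jx xj] := truncn_itv x0.
have jN : (Num.truncn x < N)%N by rewrite -(ltr_nat R) (le_lt_trans jx).
exists (Ordinal jN) => /=; set j := Num.truncn x in jx xj *.
have xt : 2 * pi * x / N%:R = t.
  by rewrite /x; move: (pi : R) pi0 => p p0; field; rewrite !lt0r_neq0.
have c0 : 0 < 2 * pi / N%:R :> R by rewrite divr_gt0 // mulr_gt0.
have E (y : R) : 2 * pi * y / N%:R = 2 * pi / N%:R * y by rewrite mulrAC.
have st : 2 * pi * j%:R / N%:R <= t by rewrite -xt !E ler_pM2l.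
apply: le_lt_trans (cis_lip st) _.
have : t - 2 * pi * j%:R / N%:R <= 2 * pi / N%:R.
  rewrite -xt !E -mulrBr ler_piMr ?(ltW c0) //.
  by move: xj; rewrite -natr1; lra.
have -> : (4 * pi + 1) / N%:R = 2 * (2 * pi / N%:R) + N%:R^-1 :> R.
  by move: (pi : R) => p; field; rewrite lt0r_neq0.
have : 0 < N%:R^-1 :> R by rewrite invr_gt0.
by move: (N%:R^-1) (2 * pi / N%:R) (t - _) => a b c; lra.
Qed.

Definition ratc (q1 q2 : rat) : R[i] := ratr q1 +i* ratr q2.

(** Only centers with rational coordinates are used, so that the union is
    countable and hence measurable. *)
Definition approach_set u t n : set (plane R) :=
  \bigcup_(q1 : rat) \bigcup_(q2 : rat)
    if (cmod (ratc q1 q2) < 1) && (cmod (u (ratc q1 q2)) < 1 - t)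
    then disc (ratc q1 q2) n.+1%:R^-1 else set0.

Lemma measurable_approach_set u t n : measurable (approach_set u t n).
Proof.
apply: bigcupT_measurable_rat => q1; apply: bigcupT_measurable_rat => q2.
by case: ifP => _; [exact: measurable_disc|exact: measurable0].
Qed.

Lemma ratc_near z e : 0 < e -> exists q1 q2, cmod (ratc q1 q2 - z) < e.
Proof.
move=> e0.
have near (x : R) : exists q : rat, `|ratr q - x| < e / 2.
  have xx : x - e / 2 < x + e / 2 by lra.
  have [q] := rat_in_itvoo xx; rewrite in_itv /= => /andP[a b].
  by exists q; rewrite ltr_norml; apply/andP; split; lra.
have [q1 H1] := near (Re z); have [q2 H2] := near (Im z).
exists q1, q2; apply: le_lt_trans (cmod_le_ReIm _) _.
have -> : Re (ratc q1 q2 - z) = ratr q1 - Re z by case: z {H1 H2}.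
have -> : Im (ratc q1 q2 - z) = ratr q2 - Im z by case: z {H1 H2}.
by rewrite [e]splitr ltrD.
Qed.

(** The point [w] of the disc may be moved to a rational one because [u] is
    continuous. *)
Lemma approach_setP u t (p : plane R) : hol u ->
  (forall n, approach_set u t n p) <-> approach u (cplx p) t.
Proof.
move=> uh; split=> H n.
  have [q1 _ [q2 _]] := H n; case: ifP => // /andP[w1 uw] pw.
  by exists (ratc q1 q2).
have [w [w1 wl uw]] := H n.
pose e := Num.min (1 - cmod w) (n.+1%:R^-1 - cmod (cplx p - w)).
have e0 : 0 < e by rewrite lt_min !subr_gt0 w1.
have u0 : 0 < 1 - t - cmod (u w) by rewrite subr_gt0.
have [d d0 du] := hol_cont uh w1 u0.
have m0 : 0 < Num.min e d by rewrite lt_min e0.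
have [q1 [q2 qw]] := ratc_near w m0.
move: qw; rewrite !lt_min -andbA => /and3P[qw1 qw2 qd].
exists q1 => //; exists q2 => //.
have -> : cmod (ratc q1 q2) < 1.
  by have := le_lt_trans (cmodBl (ratc q1 q2) w) qw1; rewrite ltrD2r.
have -> /= : cmod (u (ratc q1 q2)) < 1 - t.
  have := du _ qd; rewrite subrKC => /(le_lt_trans (cmodBl _ _)).
  by rewrite ltrD2r.
rewrite /disc /= (_ : _ - _ = (cplx p - w) - (ratc q1 q2 - w)); last by ring.
apply: le_lt_trans (cmodB _ _) _.
rewrite ltrBrDl in qw2; exact: qw2.
Qed.

Definition spectral_set u t := circle `&` \bigcap_n approach_set u t n.

Lemma measurable_spectral_set u t : measurable (spectral_set u t).
Proof.
apply: measurableI; first exact: measurable_circle.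
by apply: bigcapT_measurable => n; exact: measurable_approach_set.
Qed.

Lemma spectrum_bigcup u : hol u ->
  @cplx R @^-1` boundary_spectrum u = \bigcup_k spectral_set u k.+1%:R^-1.
Proof.
move=> uh; apply/seteqP; split => p.
  move=> [pc /spectrumP[k /approach_setP H]].
  by exists k => //; split => // n _; exact: H.
move=> [k _ [pc H]]; split => //; apply/spectrumP; exists k.
by apply/approach_setP => // n; exact: H.
Qed.

(** The circle has dimension one: [N] discs of radius [O(1/N)] cover it. By
    [disc_measure_le] each of them carries [O(1/N^2)] of the mass of the set,
    which makes [O(1/N)] in total. *)
Lemma spectral_set_null (mu : {finite_measure set (plane R) -> \bar R}) u (C t : R) :
  inner_function u -> 0 < C ->
  (forall f, model_space u f ->
    (hardy_norm2 f + dirichlet_integral mu f <= C%:E * hardy_norm2 f)%E) ->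
  0 < t <= 1 -> mu (spectral_set u t) = 0%E.
Proof.
move=> uin C0 emb tP; have [/holP uh _ _] := uin.
have [K K0 H] := disc_measure_le uin C0 emb tP; have /andP[t0 t1] := tP.
pose c : R := 4 * pi + 1.
have c0 : 0 < c by have := pi_gt0 R; rewrite /c; lra.
have mE := measurable_spectral_set u t.
apply/eqP; rewrite -measure_le0; apply/lee_addgt0Pr => e e0; rewrite add0e.
have [M ME] : exists M : nat, K * (2 * c) ^+ 2 / M.+1%:R <= e.
  have K10 : 0 < K * (2 * c) ^+ 2 + 1 by rewrite ltr_wpDl // mulr_ge0 ?sqr_ge0.
  have [M MP] := invn_le (divr_gt0 e0 K10); exists M.
  rewrite ler_pdivrMr ?ltr0n //; move: MP.
  rewrite ler_pdivlMr // mulrC ler_pdivrMr ?ltr0n // => MP.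
  by apply: le_trans MP; rewrite lerDl.
set N := M.+1 in ME.
have Nr : 0 < N%:R :> R by rewrite ltr0n.
pose G (j : nat) := spectral_set u t `&` disc (cis (2 * pi * j%:R / N%:R)) (c / N%:R).
have mG j : measurable (G j) by apply: measurableI => //; exact: measurable_disc.
have cover : spectral_set u t `<=` \big[setU/set0]_(j < N) G j.
  move=> p pE; have pc : cmod (cplx p) = 1 by case: pE.
  have [j jP] := @circle_net (cplx p) N isT pc.
  by rewrite -bigcup_mkord; exists (j : nat) => //=; split.
have Gle j : (mu (G j) <= (K * (2 * c / N%:R) ^+ 2)%:E)%E.
  have [->|/set0P[p0 [[p0c p0E] p0d]]] := eqVneq (G j) set0.
    by rewrite measure0 lee_fin mulr_ge0 // sqr_ge0.
  have sub : G j `<=` circle `&` disc (cplx p0) (2 * c / N%:R).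
    move=> p [[pc _] pd]; split => //; move: pd p0d; rewrite /disc /= => pd p0d.
    rewrite (_ : _ - _ = (cplx p - cis (2 * pi * j%:R / N%:R)) -
      (cplx p0 - cis (2 * pi * j%:R / N%:R))); last by ring.
    apply: le_lt_trans (cmodB _ _) _.
    rewrite (_ : 2 * c / N%:R = c / N%:R + c / N%:R); first by rewrite ltrD.
    by rewrite -mulrA mulr_natl mulr2n.
  apply: le_trans (le_measure mu _ _ sub) _; rewrite ?inE //.
    by apply: measurableI; [exact: measurable_circle|exact: measurable_disc].
  have r0 : 0 < 2 * c / N%:R by rewrite divr_gt0 // mulr_gt0.
  apply: H => //.
  have t40 : 0 < Num.min (2 * c / N%:R) (t / 4) by rewrite lt_min r0 divr_gt0.
  have [n nP] := invn_le t40.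
  have /approach_setP H0 : forall n, approach_set u t n p0 by move=> k; exact: p0E.
  have [w [w1 wl uw]] := H0 uh n.
  have := lt_le_trans wl nP; rewrite lt_min => /andP[wr wt].
  by exists w; split => //; exact: ltW.
apply: le_trans (_ : \sum_(j < N) mu (G j) <= _)%E.
  exact: (content_subadditive mu (fun k _ => mG k) mE cover).
apply: le_trans (lee_sum _ (fun (j : 'I_N) _ => Gle j)) _.
rewrite sumEFin lee_fin sumr_const card_ord -[_ *+ _]mulr_natl.
apply: le_trans ME.
have -> : N%:R * (K * (2 * c / N%:R) ^+ 2) = K * (2 * c) ^+ 2 / N%:R.
  by field; rewrite lt0r_neq0.
exact: lexx.
Qed.

End Covering.

Theorem theorem1p4 (R : realType)
    (mu : {finite_measure set (plane R) -> \bar R})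
    (mu_circle : carried_by_circle mu)
    (u : R[i] -> R[i]) (u_inner : inner_function u)
    (embeds : model_space_embeds u mu) :
  mu (@cplx R @^-1` boundary_spectrum u) = 0%E.
Proof.
have [_ [C C0 emb]] := embeds; have [/holP uh _ _] := u_inner.
rewrite spectrum_bigcup //; apply: measure_negligible.
  by apply: bigcupT_measurable => k; exact: measurable_spectral_set.
apply: negligible_bigcup => k; apply/negligibleP; first exact: measurable_spectral_set.
apply: (spectral_set_null u_inner C0 emb).
by rewrite invr_gt0 ltr0n invf_le1 ?ler1n ?ltr0n.
Qed.
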